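(* Let $\mathcal V$ be a smooth complex representation of $G=\mathrm{GL}(N,F)$ which is generated, as a $G$-module, by its subspace $\mathcal V^{I}$ of vectors fixed by an Iwahori subgroup $I$ of $G$. Then the augmented complex of oriented chains $$0\rightarrow C_{N-1}^{\rm or}(X,\mathcal C)\xrightarrow{\ \partial\ }\cdots\xrightarrow{\ \partial\ }C_{0}^{\rm or}(X,\mathcal C)\xrightarrow{\ \epsilon\ }\mathcal V$$ is a resolution of $\mathcal V$ in the category $\mathcal R(G)$ of smooth complex representations of $G$ (that is, the sequence is exact and $\epsilon$ is surjective).
   Context: $F$ is a locally compact non-archimedean field, $N\geq 1$ is an integer, $G=\mathrm{GL}(N,F)$, and $X$ is the semisimple affine (Bruhat–Tits) building of $G$, a simplicial complex of dimension $N-1$. For a simplex $\sigma$ of $X$, $P_\sigma$ denotes the (compact) parahoric subgroup of $G$ attached to $\sigma$ and $U_\sigma$ its pro-unipotent radical. Iwahori subgroups are the parahoric subgroups attached to chambers (maximal simplices). The coefficient system $\mathcal C=(\mathcal V_\sigma)_\sigma$ on $X$ is defined by $\mathcal V_\sigma=\mathcal V^{U_\sigma}$; for $\tau\subset\sigma$ one has $U_\tau\subset U_\sigma$, and the restriction map $\mathcal V_\sigma\to\mathcal V_\tau$ is the inclusion. Oriented chains: an oriented $q$-simplex is a $q$-simplex with an ordering of its vertices up to even permutation, written $[v_0,\dots,v_q]$ (a vertex has only one orientation). $C_q^{\rm or}(X,\mathcal C)$ is the space of finitely supported functions $\omega$ on the set of oriented $q$-simplices such that $\omega(\langle\sigma\rangle)\in\mathcal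 V_\sigma$ for every orientation $\langle\sigma\rangle$ of $\sigma$, and, for $q\geq 1$, $\omega$ changes sign when the orientation is reversed. The group $G$ acts by $(g\omega)(\langle\sigma\rangle)=g\,\omega(g^{-1}\langle\sigma\rangle)$. The boundary map is $(\partial\omega)([v_0,\dots,v_q])=\sum_v\omega([v,v_0,\dots,v_q])$, the sum being over vertices $v$ such that $\{v,v_0,\dots,v_q\}$ is a $(q+1)$-simplex, and $\epsilon(\omega)=\sum_{v}\omega([v])$, the sum over all vertices of $X$. *)

(* Defs.v *)
From HB Require Import structures.
From mathcomp Require Import all_boot all_order all_fingroup all_algebra.
From mathcomp Require Import complex.
From mathcomp Require Import all_classical all_reals all_analysis.

Set Implicit Arguments.
Unset Strict Implicit.
Unset Printing Implicit Defensive.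

Import Order.TTheory GRing.Theory Num.Theory.

Local Open Scope classical_set_scope.
Local Open Scope ring_scope.

(* Fields whose topology is defined by a nontrivial ultrametric absolute value.
   A locally compact non-archimedean field is such an F for which
   [locally_compact [set: F]] holds. *)
HB.mixin Record isNonArchimedean (R : realType) F
    of Topological F & GRing.Field F := {
  fabs : F -> R;
  fabs_ge0 : forall x : F, 0 <= fabs x;
  fabs_eq0 : forall x : F, fabs x = 0 <-> x = 0;
  fabsM : forall x y : F, fabs (x * y) = fabs x * fabs y;
  fabsD : forall x y : F, fabs (x + y) <= Num.max (fabs x) (fabs y);
  fabs_nontrivial : exists x : F, x != 0 /\ fabs x != 1;
  fabs_nbhs : forall (x : F) (A : set F),
    nbhs x A <-> exists2 r : R, 0 < r & [set y | fabs (y - x) < r] `<=` A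
}.

#[short(type="nonArchFieldType")]
HB.structure Definition NonArchField (R : realType) :=
  {F of Topological F & GRing.Field F & isNonArchimedean R F}.

Section GeneralLinearGroup.
Variables (F : fieldType) (N : nat).

Record GL := MkGL { GL_mx :> 'M[F]_N; GL_unit : GL_mx \in unitmx }.

HB.instance Definition _ := [isSub for GL_mx].
HB.instance Definition _ := [Choice of GL by <:].

Definition GL_one := MkGL (unitmx1 F N).

Definition GL_inv (g : GL) : GL := @MkGL (invmx g)
  (etrans (unitmx_inv g) (GL_unit g)).

Fact GL_mul_subproof (g h : GL) : g *m h \in unitmx.
Proof. by rewrite unitmx_mul !GL_unit. Qed.

Definition GL_mul (g h : GL) : GL := MkGL (GL_mul_subproof g h).

Fact GL_mulA : associative GL_mul.
Proof. by move=> f g h; apply/val_inj; rewrite /= mulmxA. Qed.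

Fact GL_mul1 : left_id GL_one GL_mul.
Proof. by move=> g; apply/val_inj; rewrite /= mul1mx. Qed.

Fact GL_mulr1 : right_id GL_one GL_mul.
Proof. by move=> g; apply/val_inj; rewrite /= mulmx1. Qed.

Fact GL_mulV : left_inverse GL_one GL_inv GL_mul.
Proof. by move=> g; apply/val_inj; rewrite /= mulVmx ?GL_unit. Qed.

Fact GL_mulrV : right_inverse GL_one GL_inv GL_mul.
Proof. by move=> g; apply/val_inj; rewrite /= mulmxV ?GL_unit. Qed.

HB.instance Definition _ :=
  isGroup.Build GL GL_mulA GL_mul1 GL_mulr1 GL_mulV GL_mulrV.

End GeneralLinearGroup.

(* GL(N,F) has the topology induced from the space of N x N matrices. *)
HB.instance Definition _ (R : realType) (F : nonArchFieldType R) (N : nat) :=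
  Topological.copy (GL F N) (initial_topology (@GL_mx F N : GL F N -> 'M[F]_N)).

Section Building.
Variables (R : realType) (F : nonArchFieldType R) (N : nat).
Implicit Types (g : GL F N) (L M : set 'cV[F]_N).

Let vtx : Type := set (set 'cV[F]_N).
Implicit Types (x v : vtx) (s : set vtx).

Definition integral_vectors : set 'cV[F]_N :=
  [set u | forall i, fabs (u i 0) <= 1].

(* Lattices: the spans, over the ring of integers {a | fabs a <= 1}, of the
   F-bases of F^N (here the columns of A). *)
Definition lattice L := exists2 A : 'M[F]_N, A \in unitmx &
  L = [set A *m u | u in integral_vectors].

Definition homothety_class L : vtx :=
  [set M | exists2 c : F, c != 0 & M = [set c *: u | u in L]].

Definition vertices : set vtx :=
  [set x | exists2 L, lattice L & x = homothety_class L].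

Definition lattices_of s : set (set 'cV[F]_N) := \bigcup_(x in s) x.

(* The simplices are the lattice chains up to homothety: the vertices of s
   have representatives L_0 > L_1 > ... > L_q > pi L_0, pi a uniformizer, iff
   the lattices L_i and all their multiples are totally ordered by inclusion. *)
Definition simplex s := [/\ finite_set s, s !=set0, s `<=` vertices &
  forall L M, lattices_of s L -> lattices_of s M -> L `<=` M \/ M `<=` L].

Definition chamber s :=
  simplex s /\ forall s', simplex s' -> s `<=` s' -> s' = s.

Definition lattice_act g L : set 'cV[F]_N := [set GL_mx g *m u | u in L].

Definition vertex_act g x : vtx := [set lattice_act g L | L in x].

Definition parahoric s : set (GL F N) :=
  [set g | forall L, lattices_of s L -> lattice_act g L = L].

Definition next_lattice s L M :=
  [/\ lattices_of s L, lattices_of s M, M `<` L &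
  forall L', lattices_of s L' -> M `<=` L' -> L' `<=` L -> L' = M \/ L' = L].

(* The kernel of the map from the parahoric subgroup to its reductive quotient,
   the group of automorphisms of the graded pieces L / M of the chain. *)
Definition pro_unipotent_radical s : set (GL F N) :=
  [set g | parahoric s g /\ forall L M, next_lattice s L M ->
    forall u, L u -> M (GL_mx g *m u - u)].

Definition iwahori (I : set (GL F N)) := exists2 s, chamber s & I = parahoric s.

Definition ordered_simplex q (t : q.-tuple vtx) := uniq t /\ simplex [set` t].

End Building.

Section Representations.
Variables (R : realType) (F : nonArchFieldType R) (N : nat).
Implicit Types (V W : lmodType R[i]) (g h : GL F N).

Definition linear_on V W (D : set V) (f : V -> W) :=
  forall (a : R[i]) u v, D u -> D v -> f (a *: u + v) = a *: f u + f v.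

(* [D] is a subspace of [V] which is a smooth representation of GL(N,F)
   under [act]. *)
Record smooth_representation V (D : set V) (act : GL F N -> V -> V) : Prop := {
  smooth_subspace : submod_closed [in D];
  smooth_stable : forall g v, D v -> D (act g v);
  smooth_linear : forall g, linear_on D (act g);
  smooth_act1 : forall v, D v -> act 1%g v = v;
  smooth_actM : forall g h v, D v -> act (g * h)%g v = act g (act h v);
  smooth_stabilizer : forall v, D v -> open [set g | act g v = v]
}.

Record intertwiner V W (D : set V) (E : set W) (actV : GL F N -> V -> V)
    (actW : GL F N -> W -> W) (f : V -> W) : Prop := {
  intertwiner_maps : forall v, D v -> E (f v);
  intertwiner_linear : linear_on D f;
  intertwiner_equivariant : forall g v, D v -> f (actV g v) = actW g (f v)
}.

Definition fixed_vectors V (rho : GL F N -> V -> V) (H : set (GL F N)) : set V :=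
  [set v | forall g, H g -> rho g v = v].

Definition generated_by V (rho : GL F N -> V -> V) (S : set V) :=
  forall D : set V, submod_closed [in D] -> (forall g v, D v -> D (rho g v)) ->
  S `<=` D -> D = setT.

End Representations.

Section OrientedChains.
Variables (R : realType) (F : nonArchFieldType R) (N : nat) (V : lmodType R[i]).
Variable rho : GL F N -> V -> V.

Let vtx : Type := set (set 'cV[F]_N).

Definition coefficient_space (s : set vtx) : set V :=
  fixed_vectors rho (pro_unipotent_radical s).

Definition tuple_perm q (p : 'S_q) (t : q.-tuple vtx) : q.-tuple vtx :=
  [tuple tnth t (p i) | i < q].

(* A function on oriented q-simplices is encoded as a function on orderings
   [v_0, ..., v_q] of q-simplices that is invariant under even permutations,
   extended by 0 to the tuples that do not enumerate a q-simplex. *)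
Record oriented_chain q (w : q.+1.-tuple vtx -> V) : Prop := {
  chain_simplex : forall t, ~ ordered_simplex t -> w t = 0;
  chain_support : finite_set [set t | w t != 0];
  chain_coefficient : forall t, ordered_simplex t ->
    coefficient_space [set` t] (w t);
  chain_even : forall (p : 'S_q.+1) t, ~~ odd_perm p ->
    w (tuple_perm p t) = w t;
  chain_odd : forall (p : 'S_q.+1) t, odd_perm p ->
    w (tuple_perm p t) = - w t
}.

Definition chains q : set (q.+1.-tuple vtx -> V) := [set w | oriented_chain w].

Definition chain_act q (g : GL F N) (w : q.+1.-tuple vtx -> V) :
    q.+1.-tuple vtx -> V :=
  fun t => rho g (w (map_tuple (vertex_act g^-1%g) t)).

Definition boundary q (w : q.+2.-tuple vtx -> V) : q.+1.-tuple vtx -> V :=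
  fun t => \sum_(v \in [set v | ordered_simplex [tuple of v :: t]])
    w [tuple of v :: t].

Definition augmentation (w : 1.-tuple vtx -> V) : V :=
  \sum_(v \in @vertices R F N) w [tuple v].

End OrientedChains.

Arguments chains {R F N V} rho q.
Arguments chain_act {R F N V} rho q g w.
Arguments boundary {R F N V q} w.

(* Main.v *)
(* The coefficient space of a simplex is cut out by commuting projectors e_x, one
   for each vertex x = [L], the averages over the groups 1 + pi End(L); here one uses
   that the pro-unipotent radical of a lattice chain is generated by the groups of
   its vertices.

   Normalize the lattices by L in O^N, L not in pi O^N, and fill a cycle by downward
   induction on the valuation of det L. Let K be the vertex of largest valuation in
   the support. For another vertex K' of the support, the lattice
   J = (K + K') /\ pi^-1 K is a vertex adjacent to K of smaller valuation, and
   e_K v = e_K e_J e_(K + K') v for all v fixed by e_K'. This solves the problem in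
   degree 0. In degree q the values of the cycle on the simplices K * t form a cycle
   of degree q - 1 in the link of K, supported above K, which is filled by induction
   on q, uniformly over all links; coning off with K removes K from the support. *)

Require Import Defs.
From HB Require Import structures.
From mathcomp Require Import all_boot all_order all_fingroup all_algebra.
From mathcomp Require Import complex.
From mathcomp Require Import all_classical all_reals all_analysis.
From mathcomp Require Import finmap zify.

Set Implicit Arguments.
Unset Strict Implicit.
Unset Printing Implicit Defensive.

Import Order.TTheory GRing.Theory Num.Theory numFieldNormedType.Exports.

Local Open Scope classical_set_scope.
Local Open Scope ring_scope.

(** * Alternating functions on sequences *)

(** The coefficients vary with the simplex, so contracting the support is not enough: a value fixed
    at K' has to become a value fixed at J. This rests on two factorizations of congruence groups:
    that of K + K' into those of K and K', and that of J into those of K and K + K'. If a group lies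
    in a product HS and v is fixed by S, averaging v over that group and then over H is the same as
    averaging over H. Averages commute for adjacent vertices, and K + K' need not be adjacent to K;
    J is interposed because it is. Adjacent vertices of equal valuation coincide, so no simplex
    contains two vertices of the largest valuation, and all of these can be coned off at once. A
    filling must stay adjacent to, and fixed by, the vertices already used; the list [tau] records
    them. Chains become alternating functions on vertex sequences of all lengths, where the
    augmentation is the boundary at the empty sequence. Generation by Iwahori-fixed vectors gives
    surjectivity at the end: I contains the congruence group of each vertex of its chamber. *)

Section FiniteSums.
Variables (T : choiceType) (V : zmodType).
Implicit Types (f : T -> V) (r : seq T).

Lemma fsumTE r f : uniq r -> (forall v, f v != 0 -> v \in r) ->
  \sum_(v \in [set: T]) f v = \sum_(v <- r) f v.
Proof.
move=> ur fr; rewrite [RHS]fsbig_seq //; apply/esym/fsbig_widen => // x [_ /=].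
by apply: contra_notP => /eqP /fr.
Qed.

Lemma fsumT0 f : (forall v, f v = 0) -> \sum_(v \in [set: T]) f v = 0.
Proof. by move=> f0; apply: fsbig1. Qed.

Lemma fsumT1 K f : (forall v, v != K -> f v = 0) ->
  \sum_(v \in [set: T]) f v = f K.
Proof.
move=> f0; rewrite (@fsumTE [:: K]) ?big_seq1 // => v.
by rewrite inE; apply: contra_neqT => /f0.
Qed.

End FiniteSums.

Section AlternatingFunctions.
Variables (C : numFieldType) (V : lmodType C) (T : choiceType).
Implicit Types (w z : seq T -> V) (s t : seq T).

(** Adjacent transpositions generate the symmetric groups, so the sign rule for all permutations
    follows ([alternating_tuple_perm]), while this form only involves concatenation. *)
Definition alternating w :=
  forall s1 a b s2, w (s1 ++ a :: b :: s2) = - w (s1 ++ b :: a :: s2).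

(** Bounding the vertices that occur, rather than the sequences, puts the sums of [bd w t] for all
    [t] on one common list. *)
Definition finsupp w := exists r : seq T, uniq r /\ forall t, w t != 0 -> {subset t <= r}.

(** The sum has no simplex condition: for chains it is carried by the support of [w]. At the empty
    sequence this is the augmentation. *)
Definition bd w t := \sum_(v \in [set: T]) w (v :: t).

Lemma finsupp_seq w (r : seq T) : (forall t, w t != 0 -> {subset t <= r}) -> finsupp w.
Proof.
move=> wr; exists (undup r); split; first exact: undup_uniq.
by move=> t wt x xt; rewrite mem_undup; apply: wr xt.
Qed.

Lemma bdE w t (r : seq T) : uniq r -> (forall t, w t != 0 -> {subset t <= r}) ->
  bd w t = \sum_(v <- r) w (v :: t).
Proof.
by move=> ur wr; apply: fsumTE => // v /wr /(_ v); apply; rewrite mem_head.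
Qed.

Lemma alternating_move w s1 K s2 : alternating w ->
  w (s1 ++ K :: s2) = (-1) ^+ size s1 *: w (K :: s1 ++ s2).
Proof.
move=> alt; elim/last_ind: s1 s2 => [|s1 a IH] s2 /=.
  by rewrite expr0 scale1r.
by rewrite -!cats1 -!catA /= alt IH size_cat addn1 exprS mulN1r scaleNr.
Qed.

Lemma scaler_neg_eq0 (u : V) : u = - u -> u = 0.
Proof.
move/eqP; rewrite -subr_eq0 opprK -mulr2n -scaler_nat scaler_eq0 pnatr_eq0 /=.
by move/eqP.
Qed.

Lemma finsupp_bd w : finsupp w -> finsupp (bd w).
Proof.
move=> [r [ur wr]]; apply: (@finsupp_seq _ r) => t.
apply: contraNP => nr; rewrite /bd fsumT0 // => v.
apply: contra_notP nr => /eqP /wr vt x xt.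
by apply: vt; rewrite inE xt orbT.
Qed.

Lemma bdD w z : finsupp w -> finsupp z ->
  bd (fun t => w t + z t) = (fun t => bd w t + bd z t).
Proof.
move=> [r [ur wr]] [r' [ur' zr]]; apply/funext => t.
have sub1 u : w u != 0 -> {subset u <= undup (r ++ r')}.
  by move=> /wr sr x /sr xr; rewrite mem_undup mem_cat xr.
have sub2 u : z u != 0 -> {subset u <= undup (r ++ r')}.
  by move=> /zr sr x /sr xr; rewrite mem_undup mem_cat xr orbT.
have uu : uniq (undup (r ++ r')) by exact: undup_uniq.
rewrite (bdE t uu sub1) (bdE t uu sub2) -big_split.
apply: fsumTE => // v; apply: contra_neqT => vr.
have out f : (forall u, f u != 0 -> {subset u <= undup (r ++ r')}) ->
    f (v :: t) = 0 :> V.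
  by move=> sf; apply: contraNeq vr => /sf; apply; rewrite mem_head.
by rewrite !out ?addr0.
Qed.

Lemma bdN w : finsupp w -> bd (fun t => - w t) = (fun t => - bd w t).
Proof.
move=> [r [ur wr]]; apply/funext => t.
rewrite (bdE t ur wr) -sumrN; apply: fsumTE => // v.
by rewrite oppr_eq0 => /wr; apply; rewrite mem_head.
Qed.

Lemma alternating_bd w : finsupp w -> alternating w -> alternating (bd w).
Proof.
move=> [r [ur wr]] alt s1 a b s2.
rewrite !(bdE _ ur wr) -sumrN; apply: eq_bigr => v _.
exact: (alt (v :: s1)).
Qed.

(** Exchanging the two prepended vertices changes the sign of every term, so the double sum is its
    own opposite, and 2 is invertible. *)
Lemma bd_bd w : finsupp w -> alternating w -> bd (bd w) = (fun=> 0).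
Proof.
move=> fw alt; have [r [ur wr]] := fw; have [r' [ur' wr']] := finsupp_bd fw.
apply/funext => t; apply: scaler_neg_eq0.
have rbd u : bd w u != 0 -> {subset u <= r}.
  apply: contraNP => nr; rewrite /bd fsumT0 // => v.
  apply: contra_notP nr => /eqP /wr vt x xt.
  by apply: vt; rewrite inE xt orbT.
rewrite {1}(bdE t ur rbd) (bdE t ur rbd) -sumrN.
under eq_bigr do rewrite (bdE _ ur wr).
rewrite exchange_big /=; apply: eq_bigr => u _.
by rewrite (bdE _ ur wr) -sumrN; apply: eq_bigr => v _; apply: (alt [::]).
Qed.

Section Insertion.
Variables (P : pred T) (zf : T -> seq T -> V).

(* The function supported on the sequences with exactly one entry K in P, whose
   value on K :: s is zf K s, provided zf K vanishes on sequences meeting P. *)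
Definition insertion t := match drop (find P t) t with
  | K :: s2 => (-1) ^+ find P t *: zf K (take (find P t) t ++ s2)
  | [::] => 0 end.

Lemma insertionE s1 K s2 : ~~ has P s1 -> P K ->
  insertion (s1 ++ K :: s2) = (-1) ^+ size s1 *: zf K (s1 ++ s2).
Proof.
move=> nP PK; rewrite /insertion find_cat (negPf nP) /= PK addn0.
by rewrite drop_size_cat // take_size_cat.
Qed.

Lemma insertion0 t : ~~ has P t -> insertion t = 0.
Proof. by move=> /hasNfind fP; rewrite /insertion fP drop_size. Qed.

Lemma split_first t : has P t ->
  exists s1 K s2, [/\ t = s1 ++ K :: s2, ~~ has P s1 & P K].
Proof. by case/split_find => K s1 s2 PK nP; exists s1, K, s2; rewrite cat_rcons. Qed.

Hypothesis zfP : forall K t, has P t -> zf K t = 0.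
Hypothesis zf_alt : forall K, alternating (zf K).

(** If exactly one of [a], [b] lies in [P], the swap changes by one the length of the prefix, hence
    the sign. If both do, both sides vanish by [zfP]. If neither does, the swap takes place in the
    argument of some [zf K]. *)
Lemma alternating_insertion : alternating insertion.
Proof.
move=> s1 a b s2.
have [/split_first [u1 [K [u2 [-> nu PK]]]]|ns1] := boolP (has P s1).
  rewrite -!catA /= !insertionE // !catA zf_alt scalerN.
  by [].
have [Pa|nPa] := boolP (P a); have [Pb|nPb] := boolP (P b).
- by rewrite !insertionE // !zfP ?scaler0 ?oppr0 // has_cat /= ?Pa ?Pb orbT.
- rewrite -(cat_rcons b s1 (a :: s2)) !insertionE ?has_rcons ?negb_or ?nPb //.
  by rewrite size_rcons exprS mulN1r scaleNr opprK cat_rcons.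
- rewrite -(cat_rcons a s1 (b :: s2)) !insertionE ?has_rcons ?negb_or ?nPa //.
  by rewrite size_rcons exprS mulN1r scaleNr cat_rcons.
have [/split_first [u1 [K [u2 [-> nu PK]]]]|ns2] := boolP (has P s2); last first.
  by rewrite !insertion0 ?oppr0 // has_cat /= (negPf nPa) (negPf nPb) negb_or ns1.
rewrite -!cat_cons !catA insertionE ?PK //; last first.
  by rewrite has_cat /= (negPf nPa) (negPf nPb) negb_or ns1.
rewrite insertionE //; last first.
  by rewrite has_cat /= (negPf nPa) (negPf nPb) negb_or ns1.
by rewrite -!catA /= zf_alt scalerN !size_cat.
Qed.

(** This is the boundary of a cone, read at simplices through the apex [K]: prepending [v] pushes
    [K] one place further, whence the minus sign, and a [v] in [P] contributes nothing to either
    side. *)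
Lemma bd_insertion s1 K s2 : finsupp (zf K) -> ~~ has P s1 -> P K ->
  bd insertion (s1 ++ K :: s2) = - ((-1) ^+ size s1 *: bd (zf K) (s1 ++ s2)).
Proof.
move=> [r [ur zr]] nP PK; rewrite (bdE _ ur zr) scaler_sumr -sumrN.
have E v : insertion (v :: s1 ++ K :: s2) =
    - ((-1) ^+ size s1 *: zf K (v :: s1 ++ s2)).
  have [Pv|nPv] := boolP (P v).
    rewrite (insertionE (s1 := [::])) //= !zfP ?scaler0 ?oppr0 //= ?Pv //.
    by rewrite has_cat /= PK orbT.
  rewrite -cat_cons insertionE //= ?negb_or ?nPv //.
  by rewrite exprS mulN1r scaleNr.
under eq_bigr do rewrite -E.
apply: fsumTE => // v; rewrite E oppr_eq0 scaler_eq0 negb_or => /andP[_ /zr].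
by apply; rewrite mem_head.
Qed.

End Insertion.

End AlternatingFunctions.

(** * Acyclicity from commuting projectors with the hull property *)

Section Acyclicity.
Variables (C : numFieldType) (V : lmodType C) (T : choiceType).
Variables (vert : T -> Prop) (adj : T -> T -> Prop) (rk : T -> nat).
Variable e : T -> V -> V.
Implicit Types (w z : seq T -> V) (s t tau : seq T).

Definition simplicial t := [/\ uniq t, forall x, x \in t -> vert x &
  forall x y, x \in t -> y \in t -> adj x y].

(** In the building a smaller rank belongs to a larger lattice, hence the name. *)
Definition above tau x := forall y, y \in tau -> adj x y /\ (rk x < rk y)%N.

Definition fixes s v := forall x, x \in s -> e x v = v.

Hypothesis adj_sym : forall x y, adj x y -> adj y x.
Hypothesis adj_refl : forall x, vert x -> adj x x.
Hypothesis adj_rk : forall x y, vert x -> vert y -> adj x y -> rk x = rk y -> x = y.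
Hypothesis eD : forall x u v, e x (u + v) = e x u + e x v.
Hypothesis e_idem : forall x v, vert x -> e x (e x v) = e x v.
Hypothesis eC : forall x y v, vert x -> vert y -> adj x y ->
  e x (e y v) = e y (e x v).
(** [K'] may have the same rank as [K], since several vertices of maximal rank can occur in a
    support; [J] still has strictly smaller rank. The vector [v'] is only fixed by [tau]: it is
    [e K (e J v')] that is fixed by [J] and [K] as well, by commutation. *)
Hypothesis hull : forall tau K K' v, (forall x, x \in tau -> vert x) ->
  vert K -> vert K' -> K <> K' -> (rk K' <= rk K)%N ->
  above tau K -> above tau K' -> fixes (K' :: tau) v ->
  exists J v', [/\ vert J /\ adj J K, (rk J < rk K)%N,
    (forall x, x \in tau -> adj J x), fixes tau v' & e K v = e K (e J v')].

(* The chains of the link of the simplex tau with coefficients in the vectors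
   fixed by the projectors of all the vertices. *)
Record link_chain tau q w : Prop := {
  link_supp : forall t, w t != 0 ->
    [/\ size t = q, simplicial t & forall x, x \in t -> above tau x];
  link_fix : forall t, w t != 0 -> fixes (t ++ tau) (w t);
  link_alt : alternating w;
  link_fin : finsupp w }.

Lemma e0 x : e x 0 = 0.
Proof. by apply: (addrI (e x 0)); rewrite -eD !addr0. Qed.

Lemma eN x u : e x (- u) = - e x u.
Proof. by apply/eqP; rewrite -subr_eq0 opprK -eD addNr e0. Qed.

Lemma e_sum (I : Type) (r : seq I) (P : pred I) (f : I -> V) x :
  e x (\sum_(i <- r | P i) f i) = \sum_(i <- r | P i) e x (f i).
Proof. exact: (big_morph (e x) (eD x) (e0 x)). Qed.

Lemma fixes0 s : fixes s 0.
Proof. by move=> x _; apply: e0. Qed.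

Lemma fixesD s u v : fixes s u -> fixes s v -> fixes s (u + v).
Proof. by move=> su sv x xs; rewrite eD su // sv. Qed.

Lemma fixes_sum (I : Type) (r : seq I) (P : pred I) (f : I -> V) s :
  (forall i, P i -> fixes s (f i)) -> fixes s (\sum_(i <- r | P i) f i).
Proof. by move=> sf; elim/big_ind: _ => //; [apply: fixes0|apply: fixesD]. Qed.

Lemma fixesS s s' v : {subset s <= s'} -> fixes s' v -> fixes s v.
Proof. by move=> ss sv x /ss /sv. Qed.

Lemma simplicialS s s' : uniq s -> {subset s <= s'} -> simplicial s' -> simplicial s.
Proof.
by move=> us ss [_ vs as']; split=> // [x /ss /vs //|x y /ss xs /ss ys]; apply: as'.
Qed.

Lemma link_chain0 tau q : link_chain tau q (fun=> 0).
Proof.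
split=> [t|t|s1 a b s2|]; rewrite ?eqxx ?oppr0 //.
by exists [::]; split=> // t; rewrite eqxx.
Qed.

Lemma link_chainD tau q w z : link_chain tau q w -> link_chain tau q z ->
  link_chain tau q (fun t => w t + z t).
Proof.
move=> cw cz; split.
- move=> t; have [->|wt _] := eqVneq (w t) 0; last exact: link_supp cw _ wt.
  by rewrite add0r => /(link_supp cz).
- move=> t _; apply: fixesD.
    by have [->|/(link_fix cw)//] := eqVneq (w t) 0; exact: fixes0.
  by have [->|/(link_fix cz)//] := eqVneq (z t) 0; exact: fixes0.
- by move=> s1 a b s2; rewrite (link_alt cw) (link_alt cz) opprD.
have [r [ur wr]] := link_fin cw; have [r' [ur' zr]] := link_fin cz.
apply: (@finsupp_seq _ _ _ _ (r ++ r')) => t.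
have [->|/wr sr _] := eqVneq (w t) 0; last first.
  by move=> x /sr xr; rewrite mem_cat xr.
by rewrite add0r => /zr sr x /sr xr; rewrite mem_cat xr orbT.
Qed.

Lemma link_chainN tau q w : link_chain tau q w -> link_chain tau q (fun t => - w t).
Proof.
move=> cw; split=> [t|t|s1 a b s2|]; rewrite ?oppr_eq0.
- exact: link_supp.
- by move=> /(link_fix cw) f x /f; rewrite eN => ->.
- by rewrite (link_alt cw).
have [r [ur wr]] := link_fin cw; exists r; split=> // t; rewrite oppr_eq0; exact: wr.
Qed.

Lemma link_chain_bd tau q w : link_chain tau q.+1 w -> link_chain tau q (bd w).
Proof.
move=> cw; have [r [ur wr]] := link_fin cw; split.
- move=> t bt; have [v wv] : exists v, w (v :: t) != 0.
    apply: contra_neqP bt => nv; apply: fsumT0 => v.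
    by apply/eqP; apply: contra_notT nv => wv; exists v.
  have [/= [sz] sv av] := link_supp cw wv; split=> //.
    apply: (simplicialS _ _ sv); last by move=> x xt; rewrite inE xt orbT.
    by case: sv => /andP[].
  by move=> x xt; apply: av; rewrite inE xt orbT.
- move=> t _; rewrite (bdE _ ur wr); apply: fixes_sum => v _.
  have [->|/(link_fix cw)] := eqVneq (w (v :: t)) 0; first exact: fixes0.
  by apply: fixesS => x xt; rewrite inE xt orbT.
- exact: alternating_bd (link_fin cw) (link_alt cw).
exact: finsupp_bd (link_fin cw).
Qed.

(** The maximality of [K] is a weak inequality; the strict one demanded by the link of [K] comes
    from [adj_rk], because [K] does not occur in [t]. *)
Lemma link_chain_cons tau q w K : link_chain tau q.+1 w ->
  (forall t, w (K :: t) != 0 -> forall x, x \in t -> (rk x <= rk K)%N) ->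
  link_chain (K :: tau) q (fun t => w (K :: t)).
Proof.
move=> cw rkw; split.
- move=> t wt; have [/= [sz] sK aK] := link_supp cw wt; split=> //.
    apply: (simplicialS _ _ sK); last by move=> x xt; rewrite inE xt orbT.
    by case: sK => /andP[].
  case: sK => /= /andP[Kt _] vK adjK x xt y; rewrite inE => /orP[/eqP->|]; last first.
    by apply: aK; rewrite inE xt orbT.
  have axK : adj x K by apply: adjK; rewrite ?mem_head // inE xt orbT.
  split=> //; rewrite ltn_neqAle (rkw _ wt) // andbT; apply: contraNneq Kt => erk.
  rewrite -(adj_rk _ _ axK erk) //; apply: vK; rewrite ?mem_head // inE xt orbT //.
- move=> t /(link_fix cw); apply: fixesS => x.
  by rewrite !(inE, mem_cat) => /or3P[->|->|->]; rewrite ?orbT.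
- by move=> s1 a b s2; apply: (link_alt cw (K :: s1)).
have [r [ur wr]] := link_fin cw; exists r; split=> // t /wr sr x xt; apply: sr.
by rewrite inE xt orbT.
Qed.

Lemma bd_cons w K : finsupp w -> alternating w -> bd w = (fun=> 0) ->
  bd (fun t => w (K :: t)) = (fun=> 0).
Proof.
move=> [r [ur wr]] alt bw; apply/funext => t.
have := congr1 (fun f => f (K :: t)) bw; rewrite (bdE _ ur wr).
rewrite (bdE (r := r) t) //; last first.
  by move=> s /wr sr x xs; apply: sr; rewrite inE xs orbT.
move=> /(congr1 -%R); rewrite oppr0 -sumrN => b0; apply: etrans b0.
by apply: eq_bigr => v _; rewrite (alt [::]).
Qed.

(* Applying e K to the relation expressing w [:: K] by the other values moves
   these into the coefficients of edges containing K, by the hull property. *)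
Lemma link_fill0 tau w K : (forall x, x \in tau -> vert x) ->
  link_chain tau 1 w -> bd w = (fun=> 0) -> w [:: K] != 0 ->
  (forall v, w [:: v] != 0 -> (rk v <= rk K)%N) ->
  exists z, link_chain (K :: tau) 1 z /\ bd z = (fun t => w (K :: t)).
Proof.
move=> vtau cw bw wK rkw; have [r [ur wr]] := link_fin cw.
have supp v : w [:: v] != 0 -> [/\ vert v, above tau v & fixes (v :: tau) (w [:: v])].
  move=> wv; have [_ [_ vv _] av] := link_supp cw wv.
  by split; [apply: vv|apply: av|apply: (link_fix cw wv)]; rewrite mem_head.
have [vK aK fK] := supp _ wK.
pose good v := (v != K) && (w [:: v] != 0).
have : forall v, exists p : T * V, good v ->
   [/\ vert p.1 /\ adj p.1 K, (rk p.1 < rk K)%N,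
    (forall x, x \in tau -> adj p.1 x), fixes tau p.2 &
    e K (w [:: v]) = e K (e p.1 p.2)].
  move=> v; have [/andP[vK' wv]|_] := boolP (good v); last by exists (K, 0).
  have [vv av fv] := supp _ wv.
  have nKv : K <> v by move/eqP; rewrite eq_sym; apply/negP.
  have [J [v' [? ? ? ? ?]]] := hull vtau vK vv nKv (rkw _ wv) aK av fv.
  by exists (J, v').
move=> /choice [p pP].
pose g v := e K (e (p v).1 (p v).2).
(* Several [v] may share the same [J], so the values are collected by [J]. The minus sign comes from
   the cycle condition, which makes [w [:: K]], itself fixed by [e K], minus the sum of the other
   values. *)
pose zz u := - \sum_(v <- r | good v && ((p v).1 == u)) g v.
pose z t := if t is [:: u] then zz u else 0.
pose rJ := undup [seq (p v).1 | v <- r].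
have zr t : z t != 0 -> exists2 u, t = [:: u] & exists2 v, v \in r &
    good v /\ (p v).1 = u.
  case: t => [|u [|? ?]]; rewrite /z ?eqxx // => zu; exists u => //.
  apply: contra_neqP zu => nv; rewrite /zz big_seq_cond big_pred0 ?oppr0 // => v.
  apply/negP => /and3P[vr gv /eqP pv]; apply: nv; by exists v.
have zrJ t : z t != 0 -> {subset t <= rJ}.
  move=> /zr [u -> [v vr [gv pv]]] x; rewrite inE => /eqP ->.
  by rewrite mem_undup -pv (map_f (fun v => (p v).1)).
have cz : link_chain (K :: tau) 1 z.
  split.
  - move=> t /zr [u -> [v vr [gv pv]]]; have [[vJ aJ] rJK adjJ _ _] := pP v gv.
    rewrite -pv; split=> //.
      split=> // [x|x y]; rewrite !inE; first by move=> /eqP ->.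
      by move=> /eqP-> /eqP->; apply: adj_refl.
    move=> x; rewrite inE => /eqP-> y; rewrite inE => /orP[/eqP -> //|yt].
    split; first exact: adjJ.
    by apply: ltn_trans rJK _; have [] := aK _ yt.
  - move=> t /zr [u -> _]; rewrite /z /zz -sumrN; apply: fixes_sum => v.
    move=> /andP[gv /eqP pv]; have [[vJ aJ] _ adjJ fv' _] := pP v gv.
    move=> x; rewrite !(mem_cat, inE) -pv eN /g => /or3P[/eqP->|/eqP->|xt].
    + by rewrite eC // e_idem.
    + by rewrite e_idem.
    have [adjK _] := aK _ xt.
    by rewrite -(eC _ vK (vtau _ xt) adjK) -(eC _ vJ (vtau _ xt) (adjJ _ xt)) fv'.
  - move=> [|? [|? ?]] a b [|? ?] /=; rewrite ?oppr0 //.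
  exact: finsupp_seq zrJ.
exists z; split=> //; apply/funext => t; rewrite (bdE _ (undup_uniq _) zrJ).
case: t => [|x t]; last first.
  rewrite big1 //; apply/esym/eqP; apply/negPn/negP => wt.
  by have [] := link_supp cw wt.
rewrite /z /zz sumrN.
under eq_bigr do rewrite big_mkcondr.
rewrite exchange_big /=.
have -> : \sum_(v <- r | good v) \sum_(u <- rJ) (if (p v).1 == u then g v else 0) =
    \sum_(v <- r | good v) e K (w [:: v]).
  rewrite big_seq_cond [RHS]big_seq_cond; apply: eq_bigr => v /andP[vr gv].
  rewrite (bigD1_seq (p v).1) ?undup_uniq ?mem_undup ?(map_f (fun v => (p v).1)) //= eqxx big1 ?addr0.
    by have [] := pP v gv.
  by move=> u; rewrite eq_sym => /negPf ->.
have Kr : K \in r by apply: (wr _ wK); rewrite mem_head.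
have /(congr1 (fun f => f [::])) := bw; rewrite (bdE _ ur wr).
rewrite (bigD1_seq K) //= => /eqP; rewrite addr_eq0 => /eqP wKE.
rewrite -e_sum -(fK K) ?mem_head // wKE eN; congr (- e K _).
rewrite [RHS]big_mkcond [LHS]big_mkcond; apply: eq_bigr => v _.
by rewrite /good; case: (v != K) => //=; case: eqVneq.
Qed.

(** All vertices of rank [n] serve as apexes simultaneously. The cones do not interfere: where
    [zf K] is nonzero, [K] has rank [n] and the entries of the argument lie strictly above it, so a
    simplex of a cone has one vertex of rank [n]. The list [r] bounds the set of apexes. *)
Lemma link_insertion tau q w n (zf : T -> seq T -> V) (r : seq T) :
  (forall t, w t != 0 -> forall x, x \in t -> (rk x < n.+1)%N) ->
  (forall K, [/\ link_chain (K :: tau) q.+1 (zf K),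
     forall t, zf K t != 0 -> [/\ vert K, above tau K, rk K = n & K \in r] &
     rk K = n -> bd (zf K) = (fun t => w (K :: t))]) ->
  link_chain tau q.+2 (insertion (fun x => rk x == n) zf).
Proof.
move=> rkw zfP; set P := fun x => rk x == n.
have zfl K t : zf K t != 0 -> forall x, x \in t -> (rk x < n)%N.
  have [cK /(_ t) gK _] := zfP K => zt x xt; have [_ _ <- _] := gK zt.
  have [_ _ /(_ _ xt K)] := link_supp cK zt.
  by rewrite mem_head => /(_ isT) [].
have zf0 K t : has P t -> zf K t = 0.
  move=> /hasP [x xt /eqP rx]; apply/eqP; apply/negPn/negP => /zfl /(_ x xt).
  by rewrite rx ltnn.
have zf_alt K : alternating (zf K) by have [/link_alt] := zfP K.
have spl t : insertion P zf t != 0 -> exists s1 K s2,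
    [/\ t = s1 ++ K :: s2, zf K (s1 ++ s2) != 0 &
     insertion P zf t = (-1) ^+ size s1 *: zf K (s1 ++ s2)].
  have [/split_first [s1 [K [s2 [-> ns1 PK]]]]|nP] := boolP (has P t); last first.
    by rewrite insertion0 // eqxx.
  rewrite insertionE // => nz; exists s1, K, s2; split=> //.
  by move: nz; apply: contra_neq => ->; rewrite scaler0.
split.
- move=> t /spl [s1 [K [s2 [-> zK _]]]]; have [cK /(_ _ zK) [vK aK rK _] _] := zfP K.
  have [sz [us vs ads] as'] := link_supp cK zK.
  have memE x : x \in s1 ++ K :: s2 -> x = K \/ x \in s1 ++ s2.
    by rewrite !(inE, mem_cat) => /or3P[->|/eqP|->]; rewrite ?orbT; auto.
  split.
  + by move: sz; rewrite !size_cat /= addnS => ->.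
  + split.
    * rewrite -cat_rcons -cats1 -catA uniq_catCA /= us andbT.
      by apply/negP => /(zfl _ _ zK); rewrite rK ltnn.
    * by move=> x /memE[-> //|/vs].
    have aKx x : x \in s1 ++ s2 -> adj x K.
      by move=> /as' /(_ K); rewrite mem_head => /(_ isT) [].
    move=> x y /memE[->|xs] /memE[->|ys]; [exact: adj_refl| |exact: aKx|exact: ads].
    exact/adj_sym/aKx.
  move=> x /memE[-> //|/as' ax] y yt; apply: ax; by rewrite inE yt orbT.
- move=> t /spl [s1 [K [s2 [-> zK ->]]]]; have [cK _ _] := zfP K.
  have zz : forall a : V, forall k, (-1) ^+ k *: a = a \/ (-1) ^+ k *: a = - a.
    by move=> a k; rewrite -signr_odd; case: odd; rewrite ?expr0 ?expr1 ?scaleN1r ?scale1r; auto.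
  have := link_fix cK zK.
  case: (zz (zf K (s1 ++ s2)) (size s1)) => -> f x xs; rewrite ?eN f // !(inE, mem_cat);
  by move: xs; rewrite !(inE, mem_cat) => /orP[/or3P[]|] ->; rewrite ?orbT.
- exact: alternating_insertion.
have : forall K, exists rK : seq T, forall t, zf K t != 0 -> {subset t <= rK}.
  by move=> K; have [/link_fin [rK [_ ?]] _ _] := zfP K; exists rK.
move=> /choice [rf rfP].
apply: (@finsupp_seq _ _ _ _ (r ++ flatten [seq rf K | K <- r])).
move=> t /spl [s1 [K [s2 [-> zK _]]]] x.
have [_ /(_ _ zK) [_ _ _ Kr] _] := zfP K.
rewrite (_ : (x \in s1 ++ K :: s2) = (x == K) || (x \in s1 ++ s2)); last first.
  by rewrite !(inE, mem_cat) orbCA.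
move=> /orP[/eqP->|xs]; rewrite mem_cat ?Kr //.
apply/orP; right; apply/flattenP; exists (rf K); first exact: map_f.
exact: rfP zK _ xs.
Qed.

(** This is the induction on the rank common to degree 0 and to higher degrees; these only differ in
    the way the part of the cycle through a vertex [K] of maximal rank is filled in the link of
    [K]. *)
Lemma link_fill_step q tau :
  (forall K w, link_chain tau q.+1 w -> bd w = (fun=> 0) ->
     (exists t, w (K :: t) != 0) ->
     (forall t, w t != 0 -> forall x, x \in t -> (rk x <= rk K)%N) ->
     exists z, link_chain (K :: tau) q.+1 z /\ bd z = (fun t => w (K :: t))) ->
  forall w, link_chain tau q.+1 w -> bd w = (fun=> 0) ->
  exists z, link_chain tau q.+2 z /\ bd z = w.
Proof.
move=> fillK w cw bw.
have [n] : exists n, forall t, w t != 0 -> forall x, x \in t -> (rk x < n)%N.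
  have [r [ur wr]] := link_fin cw; exists (\max_(x <- r) rk x).+1 => t /wr sr x /sr xr.
  by rewrite ltnS (big_rem x) //= leq_maxl.
(* With the strict bound 0 no vertex is left, and [w] vanishes because its arguments are nonempty
   sequences. *)
elim: n => [|n IHn] in w cw bw * => rkw.
  exists (fun=> 0); split; first exact: link_chain0.
  apply/funext => t; rewrite /bd fsumT0 //; apply/esym/eqP/negPn/negP => wt.
  by have [] := link_supp cw wt; case: t wt => // x t /rkw /(_ x (mem_head _ _)).
have [r [ur wr]] := link_fin cw.
have /choice [zf zfP] : forall K, exists z,
  [/\ link_chain (K :: tau) q.+1 z,
     forall t, z t != 0 -> [/\ vert K, above tau K, rk K = n & K \in r] &
     rk K = n -> bd z = (fun t => w (K :: t))].
  move=> K.
  have [rK|rK] := eqVneq (rk K) n; last first.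
    exists (fun=> 0); split; [exact: link_chain0|by move=> t; rewrite eqxx|].
    by move/eqP; rewrite (negPf rK).
  have [[t wt]|nt] := pselect (exists t, w (K :: t) != 0).
    have [|z [cz bz]] := fillK K w cw bw (ex_intro _ t wt).
      by move=> t' /rkw rkt' x /rkt'; rewrite rK.
    exists z; split=> // _ _; have [_ [_ vK _] aK] := link_supp cw wt.
    by split=> //; [apply: vK|apply: aK|apply: wr wt _ _]; rewrite mem_head.
  exists (fun=> 0); split; [exact: link_chain0|by move=> t; rewrite eqxx|].
  move=> _; apply/funext => t; rewrite /bd fsumT0 //; apply/esym/eqP.
  by apply: contra_notT nt => wt; exists t.
set P := fun x => rk x == n.
pose z := insertion P zf.
have cz : link_chain tau q.+2 z := link_insertion rkw zfP.
have zf0 K t : has P t -> zf K t = 0.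
  move=> /hasP [x xt /eqP rx]; apply/eqP; apply/negPn/negP => zt.
  have [cK /(_ _ zt) [_ _ rK _] _] := zfP K.
  have [_ _ /(_ _ xt K)] := link_supp cK zt.
  by rewrite mem_head rx rK ltnn => /(_ isT) [].
(* The sign is that of [bd_insertion]: at a sequence with an entry of rank [n] the boundary of the
   cones is minus [w]. Accordingly the final filling is [z'] minus [z]. *)
pose w' t := w t + bd z t.
have cw' : link_chain tau q.+1 w' := link_chainD cw (link_chain_bd cz).
have bw' : bd w' = (fun=> 0).
  rewrite /w' bdD ?bw ?bd_bd; try exact: link_fin cw; try exact: link_fin cz.
  - by apply/funext => t; rewrite addr0.
  - exact: link_alt cz.
  exact: finsupp_bd (link_fin cz).
have [|z' [cz' bz']] := IHn w' cw' bw'.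
  move=> t w't x xt.
  have [/split_first [s1 [K [s2 [tE ns1 PK]]]]|nP] := boolP (has P t).
    have [cK _ bzK] := zfP K.
    have : w' t = 0.
      rewrite /w' tE bd_insertion //; last exact: link_fin cK.
      rewrite bzK; last exact/eqP.
      by rewrite (alternating_move _ _ _ (link_alt cw)) subrr.
    by move/eqP; rewrite (negPf w't).
  (* No larger rank is created: without an entry of rank [n] in [t], a nonzero [bd z t] comes from
     an apex [v] of rank [n], and the entries of [t] then lie strictly above [v]. *)
  have : (rk x <= n)%N.
    have [wt|wt] := eqVneq (w t) 0; last exact: rkw wt _ xt.
    have bzt : bd z t != 0 by move: w't; rewrite /w' wt add0r.
    have [v zv] : exists v, z (v :: t) != 0.
      apply: contra_neqP bzt => nv; apply: fsumT0 => v.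
      by apply/eqP; apply: contra_notT nv => zv; exists v.
    have Pv : P v.
      move: zv; apply: contraNT => nv; rewrite /z insertion0 //=.
      by rewrite negb_or nv.
    have zvt : zf v t != 0.
      apply: contraNneq zv => zvt; rewrite /z (insertionE _ (s1 := [::])) //=.
      by rewrite zvt scaler0.
    have [cv /(_ _ zvt) [_ _ <- _] _] := zfP v.
    have [_ _ /(_ _ xt v)] := link_supp cv zvt.
    by rewrite mem_head => /(_ isT) [_ /ltnW].
  rewrite leq_eqVlt => /orP[Px|//].
  by case/negP: nP; apply/hasP; exists x.
exists (fun t => z' t + - z t); split.
  exact/link_chainD/link_chainN.
rewrite bdD ?bdN ?bz'; first by apply/funext=> t; rewrite /w' addrK.
- exact: link_fin cz.
- exact: link_fin cz'.
exact: link_fin (link_chainN cz).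
Qed.

Theorem link_fill q tau w : (forall x, x \in tau -> vert x) ->
  link_chain tau q.+1 w -> bd w = (fun=> 0) ->
  exists z, link_chain tau q.+2 z /\ bd z = w.
Proof.
elim: q tau w => [|q IHq] tau w vtau cw bw.
  apply: link_fill_step cw bw => K {}w cw bw [t wKt] rkw.
  have t0 : t = [::] by have [/= [/size0nil]] := link_supp cw wKt.
  apply: link_fill0 => //; first by rewrite -t0.
  by move=> v /rkw; apply; rewrite mem_head.
apply: link_fill_step cw bw => K {}w cw bw [t wKt] rkw.
apply: IHq.
- have [_ [_ vK _] _] := link_supp cw wKt.
  by move=> x; rewrite inE => /orP[/eqP->|/vtau//]; apply: vK; rewrite mem_head.
- apply: link_chain_cons cw _ => s /rkw rks x xs; apply: rks.
  by rewrite inE xs orbT.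
exact: bd_cons (link_fin cw) (link_alt cw) bw.
Qed.

End Acyclicity.

(** * Lattices over a non-archimedean local field *)

Section AbsoluteValue.
Variables (R : realType) (F : nonArchFieldType R).
Implicit Types a b c x y : F.

Lemma fabs0 : fabs (0 : F) = 0.
Proof. exact/fabs_eq0. Qed.

Lemma fabs_eq0b x : (fabs x == 0) = (x == 0).
Proof. by apply/eqP/eqP => /fabs_eq0. Qed.

Lemma fabs_gt0 x : (0 < fabs x) = (x != 0).
Proof. by rewrite lt_neqAle fabs_ge0 andbT eq_sym fabs_eq0b. Qed.

Lemma fabs1 : fabs (1 : F) = 1.
Proof.
have := fabsM (1 : F) 1; rewrite mulr1 => /eqP.
rewrite -{1}(mulr1 (fabs 1)) (inj_eq (mulfI _)) ?fabs_eq0b ?oner_eq0 //.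
by move/eqP.
Qed.

Lemma fabsN x : fabs (- x) = fabs x.
Proof.
suff fN1 : fabs (-1 : F) = 1 by rewrite -mulN1r fabsM fN1 mul1r.
have := fabsM (-1 : F) (-1); rewrite mulrNN mulr1 fabs1 => /esym/eqP.
by rewrite -expr2 sqrp_eq1 ?fabs_ge0 // => /eqP.
Qed.

Lemma fabsB x y : fabs (x - y) = fabs (y - x).
Proof. by rewrite -fabsN opprB. Qed.

Lemma fabsV x : fabs (x^-1) = (fabs x)^-1.
Proof.
have [->|x0] := eqVneq x 0; first by rewrite invr0 fabs0 invr0.
have fx : fabs x != 0 by rewrite fabs_eq0b.
by apply: (mulfI fx); rewrite -fabsM !divff // fabs1.
Qed.

Lemma fabsX x n : fabs (x ^+ n) = fabs x ^+ n.
Proof. by elim: n => [|n IH]; rewrite ?expr0 ?fabs1 // !exprS fabsM IH. Qed.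

Lemma fabsD_le x y (r : R) : fabs x <= r -> fabs y <= r -> fabs (x + y) <= r.
Proof. by move=> xr yr; apply: le_trans (fabsD _ _) _; rewrite ge_max xr. Qed.

Lemma fabsD_lt x y (r : R) : fabs x < r -> fabs y < r -> fabs (x + y) < r.
Proof. by move=> xr yr; apply: le_lt_trans (fabsD _ _) _; rewrite gt_max xr. Qed.

Lemma fabs_sum_le (I : Type) (s : seq I) (P : pred I) (f : I -> F) (r : R) :
  0 <= r -> (forall i, P i -> fabs (f i) <= r) -> fabs (\sum_(i <- s | P i) f i) <= r.
Proof.
by move=> r0 fr; elim/big_ind: _ => [|x y|//]; rewrite ?fabs0 //; exact: fabsD_le.
Qed.

Lemma fabs_eq_of_lt x y : fabs (x - y) < fabs x -> fabs x = fabs y.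
Proof.
move=> xy; apply/eqP; rewrite eq_le; apply/andP; split.
  rewrite leNgt; apply/negP => yx.
  by have := fabsD_lt xy yx; rewrite subrK ltxx.
rewrite leNgt; apply/negP => yx.
have yx' : fabs (y - x) < fabs y by rewrite fabsB (lt_trans xy).
by have := fabsD_lt yx' yx; rewrite subrK ltxx.
Qed.

Lemma fabs_small_nonzero (r : R) : 0 < r -> exists2 a : F, a != 0 & fabs a < r.
Proof.
move=> r0.
have [x [x0 nx1]] := fabs_nontrivial (s := F).
wlog xlt : x x0 nx1 / fabs x < 1.
  move=> W; case: (ltgtP (fabs x) 1) => [/W|x1|/eqP]; [exact| |].
    apply: (W x^-1); rewrite ?invr_eq0 ?fabsV ?invr_eq1 //.
    by rewrite invf_lt1 // fabs_gt0.
  by rewrite (negPf nx1).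
have [n xn] : exists n, fabs x ^+ n < r.
  have /cvgrPdist_lt /(_ r r0) [n _ /(_ n (leqnn n)) /=] :
      (fun n => fabs x ^+ n) @ \oo --> (0 : R).
    by apply: cvg_expr; rewrite ger0_norm ?fabs_ge0.
  rewrite sub0r normrN ger0_norm; last by rewrite exprn_ge0 ?fabs_ge0.
  by move=> xn; exists n.
by exists (x ^+ n); rewrite ?expf_neq0 // fabsX.
Qed.

Hypothesis lc : locally_compact [set: F].

(** A compact neighbourhood of 0 contains a ball; multiplication by a small [d] sends the integers
    into it, and a finite cover of it by balls of radius [eps * fabs d] is scaled back. *)
Lemma ring_of_integers_totally_bounded (eps : R) : 0 < eps ->
  exists s : seq F, forall a, fabs a <= 1 -> exists2 b, b \in s & fabs (a - b) < eps.
Proof.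
move=> e0; have [U nU [cU _]] := lc (I : [set: F] 0).
have /fabs_nbhs [r r0 rU] : nbhs (0 : F) U.
  by move: nU; rewrite /within /=; apply: filterS => x; apply.
have [d d0 dr] := fabs_small_nonzero r0.
have fd0 : 0 < fabs d by rewrite fabs_gt0.
pose B (x : F) : set F := [set y | fabs (y - x) < eps * fabs d].
have cov : U `<=` cover [set: F] B.
  by move=> x _; exists x => //; rewrite /B /= subrr fabs0 mulr_gt0.
have oB x : [set: F] x -> open (B x).
  move=> _; rewrite openE => y By; rewrite /interior; apply/fabs_nbhs.
  exists (eps * fabs d); first exact: mulr_gt0.
  move=> z /= zy; rewrite /B /= -(subrK y z) -addrA; exact: fabsD_lt.
(* [compact_cover] speaks of pointed spaces; [PF] is [F] with the point 0. *)
pose PF : ptopologicalType := HB.pack F (isPointed.Build F 0).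
have : @compact PF U := cU.
rewrite compact_cover => /(_ F [set: F] B oB cov) [D _ UD].
exists [seq b / d | b <- enum_fset D] => a a1.
have [b /= bD ab] : cover [set` D] B (a * d).
  apply/UD/rU => /=; rewrite subr0 fabsM; apply: le_lt_trans dr.
  by rewrite ler_piMl // fabs_ge0.
exists (b / d); first exact: map_f.
have -> : a - b / d = (a * d - b) / d by rewrite mulrBl mulfK.
by rewrite fabsM fabsV ltr_pdivrMr.
Qed.

Definition uniformizer (pi : F) :=
  [/\ pi != 0, fabs pi < 1 & forall a, fabs a < 1 -> fabs a <= fabs pi].

(** Finitely many balls of radius |x| cover the integers, and an element larger than x has the
    absolute value of the centre of its ball. Hence only finitely many absolute values lie between
    |x| and 1, and the largest one below 1 is attained. *)
Lemma exists_uniformizer : exists pi, uniformizer pi.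
Proof.
have [x x0 x1] := @fabs_small_nonzero 1 ltr01.
have fx0 : 0 < fabs x by rewrite fabs_gt0.
have [s sP] := ring_of_integers_totally_bounded fx0.
have big_ub : forall s0 : seq F, exists p : F, [/\ p != 0, fabs p < 1, fabs x <= fabs p &
    forall b, b \in s0 -> fabs b < 1 -> fabs b <= fabs p].
  move=> s0; elim: s0 => [|b s0 [p [p0 p1 xp ps]]]; first by exists x.
  have [/andP[b1 pb]|] := boolP ((fabs b < 1) && (fabs p < fabs b)).
    exists b; split=> //.
    - by rewrite -fabs_gt0 (le_lt_trans _ pb) ?fabs_ge0.
    - exact: le_trans xp (ltW pb).
    move=> c; rewrite inE => /orP[/eqP->//|/ps cp /cp] /le_trans; apply; exact: ltW.
  rewrite negb_and -!leNgt => nb; exists p; split=> // c.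
  rewrite inE => /orP[/eqP-> b1|/ps//].
  by move: nb; rewrite leNgt b1.
have [p [p0 p1 xp ps]] := big_ub s.
exists p; split=> // a a1; have [b bs ab] := sP a (ltW a1).
have [ax|xa] := leP (fabs a) (fabs x); first exact: le_trans xp.
have := fabs_eq_of_lt (lt_trans ab xa) => E; rewrite E; apply: ps => //.
by rewrite -E.
Qed.

(** The exponent is the predecessor of the first one at which the powers of |pi| drop below |a|; a
    strict inequality |a| < |pi|^n would contradict the maximality of |pi| among the values below
    1. *)
Lemma uniformizer_power pi a : uniformizer pi -> a != 0 -> fabs a <= 1 ->
  exists n, fabs a = fabs pi ^+ n.
Proof.
move=> [p0 p1 pmax] a0 a1; have fa0 : 0 < fabs a by rewrite fabs_gt0.
have fp0 : 0 < fabs pi by rewrite fabs_gt0.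
have ex : exists n, fabs pi ^+ n < fabs a.
  have /cvgrPdist_lt /(_ _ fa0) [n _ /(_ n (leqnn n)) /=] :
      (fun n => fabs pi ^+ n) @ \oo --> (0 : R).
    by apply: cvg_expr; rewrite ger0_norm ?fabs_ge0.
  rewrite sub0r normrN ger0_norm; last by rewrite exprn_ge0 ?fabs_ge0.
  by move=> xn; exists n.
case: (ex_minnP ex) => [[|n]]; first by rewrite expr0 ltNge a1.
move=> an nmin; exists n; apply/eqP; rewrite eq_le; apply/andP; split.
  by rewrite leNgt; apply/negP => /nmin; rewrite ltnn.
have fpn : 0 < fabs pi ^+ n by rewrite exprn_gt0.
rewrite leNgt; apply/negP => pa.
have := pmax (a / pi ^+ n); rewrite fabsM fabsV fabsX ltr_pdivrMr // mul1r => /(_ pa).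
by rewrite ler_pdivrMr // -exprS leNgt an.
Qed.

End AbsoluteValue.

Section Lattices.
Variables (R : realType) (F : nonArchFieldType R) (N : nat) (pi : F).
Hypothesis piP : uniformizer pi.
Implicit Types (A B X Y : 'M[F]_N) (L M K : set 'cV[F]_N) (u v : 'cV[F]_N) (c d : F).

Definition integral_mx X := forall i j, fabs (X i j) <= 1.

Definition lat A : set 'cV[F]_N := [set A *m u | u in @integral_vectors R F N].

Definition scl c L : set 'cV[F]_N := [set c *: u | u in L].

(** Modules over the ring of integers, without finiteness: sums and intersections of lattices are
    first seen to be such modules, and [lattice_between] then makes them lattices. *)
Record omodule L : Prop := {
  omodule0 : L 0;
  omoduleD : forall u v, L u -> L v -> L (u + v);
  omoduleZ : forall c u, fabs c <= 1 -> L u -> L (c *: u) }.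

Lemma pi_neq0 : pi != 0. Proof. by case: piP. Qed.
Lemma fabs_pi_lt1 : fabs pi < 1. Proof. by case: piP. Qed.
Lemma fabs_pi_gt0 : 0 < fabs pi. Proof. by rewrite fabs_gt0 pi_neq0. Qed.
Lemma fabs_pi_max c : fabs c < 1 -> fabs c <= fabs pi.
Proof. by case: piP => _ _; apply. Qed.

Lemma latE A u : A \in unitmx -> lat A u <-> integral_vectors (invmx A *m u).
Proof.
move=> Au; split=> [[v iv <-]|iv]; first by rewrite mulKmx.
by exists (invmx A *m u) => //; rewrite mulKVmx.
Qed.

Lemma lattice_lat A : A \in unitmx -> lattice (lat A).
Proof. by exists A. Qed.

Lemma omoduleN L u : omodule L -> L u -> L (- u).
Proof. by move=> oL Lu; rewrite -scaleN1r; apply: omoduleZ; rewrite ?fabsN ?fabs1. Qed.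

Lemma omoduleB L u v : omodule L -> L u -> L v -> L (u - v).
Proof. by move=> oL Lu Lv; apply: omoduleD => //; apply: omoduleN. Qed.

Lemma omodule_sum L (I : Type) (r : seq I) (P : pred I) (f : I -> 'cV[F]_N) :
  omodule L -> (forall i, P i -> L (f i)) -> L (\sum_(i <- r | P i) f i).
Proof.
by move=> oL Lf; elim/big_ind: _ => //; [exact: omodule0 | exact: omoduleD].
Qed.

Lemma integral_vectors_omodule : omodule (@integral_vectors R F N).
Proof.
split=> [i|u v iu iv i|c u c1 iu i]; rewrite !mxE ?fabs0 //.
  exact: fabsD_le.
by rewrite fabsM mulr_ile1 ?fabs_ge0.
Qed.

Lemma omodule_image A L : omodule L -> omodule [set A *m u | u in L].
Proof.
move=> oL; split=> [|_ _ [u Lu <-] [v Lv <-]|c _ c1 [u Lu <-]].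
- by exists 0; rewrite ?mulmx0 //; exact: omodule0.
- by exists (u + v); rewrite ?mulmxDr //; exact: omoduleD.
by exists (c *: u); rewrite -?scalemxAr //; exact: omoduleZ.
Qed.

Lemma lattice_omodule L : lattice L -> omodule L.
Proof. move=> [A _ ->]; exact: omodule_image integral_vectors_omodule. Qed.

Lemma sclE c L u : c != 0 -> scl c L u <-> L (c^-1 *: u).
Proof.
move=> c0; split=> [[v Lv <-]|Lu]; first by rewrite scalerA mulVf // scale1r.
by exists (c^-1 *: u); rewrite // scalerA divff // scale1r.
Qed.

Lemma scl1 L : scl 1 L = L.
Proof.
apply/seteqP; split=> [_ [u Lu <-]|u Lu]; rewrite ?scale1r //.
by exists u; rewrite ?scale1r.
Qed.

Lemma sclA c d L : scl c (scl d L) = scl (c * d) L.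
Proof.
apply/seteqP; split=> [_ [_ [u Lu <-] <-]|_ [u Lu <-]].
  by exists u; rewrite ?scalerA.
by exists (d *: u); rewrite ?scalerA //; exists u.
Qed.

Lemma sclS c L M : L `<=` M -> scl c L `<=` scl c M.
Proof. by move=> LM _ [u Lu <-]; exists u => //; apply: LM. Qed.

Lemma scl_le c d L : omodule L -> fabs c <= fabs d -> scl c L `<=` scl d L.
Proof.
move=> oL cd _ [u Lu <-].
have [d0|d0] := eqVneq d 0.
  move: cd; rewrite d0 fabs0 le_eqVlt ltNge fabs_ge0 orbF fabs_eq0b => /eqP ->.
  by exists u; rewrite // !scale0r.
apply/(sclE _ _ d0); rewrite scalerA; apply: omoduleZ => //.
by rewrite fabsM fabsV mulrC ler_pdivrMr ?mul1r // fabs_gt0.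
Qed.

Lemma scl_eq c d L : omodule L -> fabs c = fabs d -> scl c L = scl d L.
Proof. by move=> oL cd; apply/seteqP; split; apply: scl_le; rewrite ?cd. Qed.

Lemma scl_sub c L : omodule L -> fabs c <= 1 -> scl c L `<=` L.
Proof. by move=> oL c1; rewrite -{2}(scl1 L); apply: scl_le; rewrite ?fabs1. Qed.

Lemma scl_pi_sub L : omodule L -> scl pi L `<=` L.
Proof. by move=> oL; apply: scl_sub => //; apply/ltW/fabs_pi_lt1. Qed.

Lemma omodule_scl c L : omodule L -> omodule (scl c L).
Proof.
move=> oL; split=> [|_ _ [u Lu <-] [v Lv <-]|d _ d1 [u Lu <-]].
- by exists 0; rewrite ?scaler0 //; exact: omodule0.
- by exists (u + v); rewrite ?scalerDr //; exact: omoduleD.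
by exists (d *: u); rewrite ?scalerA 1?mulrC //; exact: omoduleZ.
Qed.

Lemma scl_lat c A : scl c (lat A) = lat (c *: A).
Proof.
apply/seteqP; split=> [_ [_ [u iu <-] <-]|_ [u iu <-]].
  by exists u; rewrite -?scalemxAl.
by exists (A *m u); rewrite ?scalemxAl //; exists u.
Qed.

Lemma unitmxZ c A : c != 0 -> (c *: A \in unitmx) = (A \in unitmx).
Proof. by move=> c0; rewrite !unitmxE detZ unitrM unitfE expf_neq0. Qed.

Lemma lattice_scl c L : c != 0 -> lattice L -> lattice (scl c L).
Proof. by move=> c0 [A Au ->]; exists (c *: A); rewrite ?unitmxZ // scl_lat. Qed.

Lemma integral_mulmx X u : integral_mx X -> integral_vectors u ->
  integral_vectors (X *m u).
Proof.
move=> iX iu i; rewrite mxE; apply: fabs_sum_le => // j _.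
by rewrite fabsM mulr_ile1 ?fabs_ge0.
Qed.

Lemma fabs_sign (k : nat) : fabs ((-1) ^+ k : F) = 1.
Proof. by rewrite fabsX fabsN fabs1 expr1n. Qed.

Lemma fabs_det_le n (X : 'M[F]_n) :
  (forall i j, fabs (X i j) <= 1) -> fabs (\det X) <= 1.
Proof.
move=> iX; rewrite /determinant; apply: fabs_sum_le => // s _.
rewrite fabsM fabs_sign mul1r; elim/big_ind: _ => [|x y x1 y1|i _] //.
  by rewrite fabs1.
by rewrite fabsM mulr_ile1 ?fabs_ge0.
Qed.

Lemma integral_invmx X : integral_mx X -> fabs (\det X) = 1 ->
  X \in unitmx /\ integral_mx (invmx X).
Proof.
move=> iX dX; have Xu : X \in unitmx.
  by rewrite unitmxE unitfE -fabs_eq0b dX oner_eq0.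
split=> // i j; rewrite /invmx Xu !mxE fabsM fabsV dX invr1 mul1r.
rewrite /cofactor fabsM fabs_sign mul1r; apply: fabs_det_le => k l.
by rewrite !mxE.
Qed.

Lemma lat_col A j : lat A (col j A).
Proof.
exists (delta_mx j 0); last by rewrite -colE.
by move=> i; rewrite mxE; case: (_ && _); rewrite ?fabs1 ?fabs0.
Qed.

Lemma lat_sub_omodule A L : omodule L -> (forall j, L (col j A)) -> lat A `<=` L.
Proof.
move=> oL LA _ [u iu <-]; rewrite -(mul1mx u).
have -> : A *m (1%:M *m u) = \sum_j u j 0 *: col j A.
  apply/matrixP => i k; rewrite mul1mx mxE summxE; apply: eq_bigr => j _.
  by rewrite !mxE mulrC (ord1 k).
by apply: omodule_sum => // j _; apply: omoduleZ.
Qed.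

Lemma lat_sub A B : A \in unitmx -> B \in unitmx -> lat A `<=` lat B ->
  exists2 X, integral_mx X & A = B *m X.
Proof.
move=> Au Bu AB; exists (invmx B *m A); last by rewrite mulKVmx.
move=> i j; have /latE /(_ i) := AB _ (lat_col A j).
by move=> /(_ Bu); rewrite colE mulmxA -colE mxE.
Qed.

Lemma lat_mul B X : integral_mx X -> lat (B *m X) `<=` lat B.
Proof.
move=> iX _ [u iu <-]; exists (X *m u); rewrite ?mulmxA //; exact: integral_mulmx.
Qed.

Lemma lat_mul_eq B X : integral_mx X -> fabs (\det X) = 1 -> lat (B *m X) = lat B.
Proof.
move=> iX dX; have [Xu iVX] := integral_invmx iX dX.
apply/seteqP; split; first exact: lat_mul.
by rewrite -{1}(mulmxK Xu B); apply: lat_mul.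
Qed.

Lemma fabs_det_gt0 A : A \in unitmx -> 0 < fabs (\det A).
Proof. by rewrite unitmxE unitfE fabs_gt0. Qed.

(** The change of basis is integral, and it is invertible over the integers exactly when its
    determinant is a unit. *)
Lemma lat_sub_det A B : A \in unitmx -> B \in unitmx -> lat A `<=` lat B ->
  fabs (\det A) <= fabs (\det B) ?= iff `[< lat A = lat B >].
Proof.
move=> Au Bu AB; have [X iX AX] := lat_sub Au Bu AB.
have le A' B' X' : integral_mx X' -> A' = B' *m X' -> fabs (\det A') <= fabs (\det B').
  by move=> iX' ->; rewrite det_mulmx fabsM ler_piMr ?fabs_ge0 // fabs_det_le.
split; first exact: le iX AX.
apply/eqP/asboolP => [dE|E].
  rewrite AX lat_mul_eq //; apply: (mulfI (_ : fabs (\det B) != 0)).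
    by rewrite gt_eqF // fabs_det_gt0.
  by rewrite -fabsM -det_mulmx -AX dE mulr1.
have BA : lat B `<=` lat A by rewrite E.
have [Y iY BY] := lat_sub Bu Au BA.
by apply/eqP; rewrite eq_le (le _ _ _ iX AX) (le _ _ _ iY BY).
Qed.

(** A size of lattices, independent of the basis by [vol_lat]; it plays the part of an index, since
    nested lattices of equal size are equal ([vol_eq]). *)
Definition vol L : R := xget 0 [set r | exists2 A, A \in unitmx & L = lat A /\ r = fabs (\det A)].

Lemma vol_lat A : A \in unitmx -> vol (lat A) = fabs (\det A).
Proof.
move=> Au; rewrite /vol; case: xgetP => [r _ [B Bu [AB ->]]|/(_ (fabs (\det A)))].
  have sAB : lat A `<=` lat B by rewrite AB.
  by have := lat_sub_det Au Bu sAB; rewrite AB asboolT // => -[_ /eqP ->].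
by case; exists A.
Qed.

Lemma vol_gt0 L : lattice L -> 0 < vol L.
Proof. by move=> [A Au ->]; rewrite -/(lat A) vol_lat // fabs_det_gt0. Qed.

Lemma vol_le L M : lattice L -> lattice M -> L `<=` M -> vol L <= vol M.
Proof.
move=> [A Au ->] [B Bu ->] /(lat_sub_det Au Bu); rewrite -!/(lat _) !vol_lat //.
by case.
Qed.

Lemma vol_eq L M : lattice L -> lattice M -> L `<=` M -> vol L = vol M -> L = M.
Proof.
move=> [A Au ->] [B Bu ->] /(lat_sub_det Au Bu); rewrite -!/(lat _) !vol_lat //.
by move=> [_ E] /eqP; rewrite E => /asboolP.
Qed.

Lemma vol_scl c L : c != 0 -> lattice L -> vol (scl c L) = fabs c ^+ N * vol L.
Proof.
move=> c0 [A Au ->]; rewrite -/(lat A) scl_lat !vol_lat ?unitmxZ //.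
by rewrite detZ fabsM fabsX.
Qed.

(** Right multiplication of [A] by this matrix exchanges the [i]-th column of [A] for [A *m c]; its
    determinant [c i 0] is Cramer's rule. Both exchange arguments on bases rely on it. *)
Definition col_replace (i : 'I_N) (c : 'cV[F]_N) : 'M[F]_N :=
  \matrix_(k, j) if j == i then c k 0 else (k == j)%:R.

Lemma det_col_replace i (c : 'cV[F]_N) : \det (col_replace i c) = c i 0.
Proof.
rewrite (expand_det_row _ i) (bigD1 i) //= mxE eqxx big1 ?addr0 => [|j ji]; last first.
  by rewrite mxE (negPf ji) eq_sym (negPf ji) mul0r.
rewrite /cofactor addnn -signr_odd odd_double expr0 mul1r.
suff -> : row' i (col' i (col_replace i c)) = 1%:M by rewrite det1 mulr1.
apply/matrixP => k l; rewrite !mxE eq_sym (negPf (neq_lift i l)).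
by rewrite (inj_eq lift_inj).
Qed.

Lemma col_mul_replace A i (c : 'cV[F]_N) j :
  col j (A *m col_replace i c) = if j == i then A *m c else col j A.
Proof.
rewrite [LHS]colE -mulmxA -colE; case: eqVneq => [->|ji].
  by rewrite (_ : col i _ = c) //; apply/matrixP => k l; rewrite !mxE eqxx (ord1 l).
by rewrite [RHS]colE (_ : col j _ = delta_mx j 0) //; apply/matrixP => k l; rewrite !mxE (negPf ji) (ord1 l) eqxx andbT.
Qed.

(* A basis of maximal |det| among the vectors of L spans L, by Cramer. *)
Lemma lattice_between L L1 L2 : omodule L -> lattice L1 -> lattice L2 ->
  L1 `<=` L -> L `<=` L2 -> lattice L.
Proof.
move=> oL [A1 A1u L1E] [A2 A2u L2E] L1L LL2.
(* Inside [L2] the determinants are bounded by that of [A2] and take the discrete values |det A2|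
   |pi|^n, so a largest one is a least [n]. *)
pose P n := exists A, [/\ A \in unitmx, forall j, L (col j A) &
  fabs (\det A) = fabs (\det A2) * fabs pi ^+ n].
have PE A : A \in unitmx -> (forall j, L (col j A)) -> exists n, [/\ P n &
   fabs (\det A) = fabs (\det A2) * fabs pi ^+ n].
  move=> Au LA; have AL2 : lat A `<=` lat A2.
    rewrite -[lat A2]/([set A2 *m u | u in @integral_vectors R F N]) -L2E.
    by apply: subset_trans LL2; apply: lat_sub_omodule.
  have [X iX AX] := lat_sub Au A2u AL2.
  have dX0 : \det X != 0.
    by move: Au; rewrite AX unitmx_mul => /andP[_]; rewrite unitmxE unitfE.
  have [n dn] := uniformizer_power piP dX0 (fabs_det_le iX).
  by exists n; split; [exists A; split|]; rewrite // AX det_mulmx fabsM dn.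
have ex : exists n, `[< P n >].
  have [|n [Pn _]] := PE A1 A1u; last by exists n; apply/asboolP.
  by move=> j; apply: L1L; rewrite L1E; apply: lat_col.
case: (ex_minnP ex) => n /asboolP [A [Au LA dA]] nmin.
exists A => //; apply/seteqP; split; last exact: lat_sub_omodule.
move=> u Lu; apply/(latE _ Au) => i; rewrite leNgt; apply/negP => ci.
(* With a coordinate of absolute value above 1, exchanging the [i]-th column for [u] would give a
   basis in [L] with larger determinant. *)
set c := invmx A *m u in ci.
have Bu : A *m col_replace i c \in unitmx.
  rewrite unitmx_mul Au unitmxE unitfE det_col_replace -fabs_gt0.
  exact: lt_trans ltr01 ci.
have LB j : L (col j (A *m col_replace i c)).
  by rewrite col_mul_replace; case: eqP => // _; rewrite mulKVmx.
have [m [Pm dm]] := PE _ Bu LB.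
have := nmin m (asboolT Pm); rewrite leqNgt => /negP; apply.
move: dm; rewrite det_mulmx det_col_replace fabsM dA -mulrA.
move=> /(mulfI (lt0r_neq0 (fabs_det_gt0 A2u))) E.
rewrite ltnNge; apply/negP => nm.
have : fabs pi ^+ m <= fabs pi ^+ n.
  by rewrite ler_wiXn2l ?fabs_ge0 // ltW // fabs_pi_lt1.
by rewrite -E leNgt ltr_pMr ?ci // exprn_gt0 // fabs_pi_gt0.
Qed.

End Lattices.

(** * Sums and intersections of lattices, and factorizations of their congruence groups *)

Section LatticeOperations.
Variables (R : realType) (F : nonArchFieldType R) (N : nat) (pi : F).
Hypothesis piP : uniformizer pi.
Implicit Types (A B X Y : 'M[F]_N) (L M K : set 'cV[F]_N) (u v : 'cV[F]_N) (c d : F).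
Implicit Types (g h : GL F N).

Let pi0 : pi != 0 := pi_neq0 piP.

Lemma fabs_absorb c : exists n, fabs (pi ^+ n * c) <= 1.
Proof.
have [c1|c1] := leP (fabs c) 1; first by exists 0%N; rewrite expr0 mul1r.
have c0 : c != 0 by rewrite -fabs_gt0 (lt_trans ltr01).
have [|n cn] := uniformizer_power piP (invr_neq0 c0).
  by rewrite fabsV invf_le1 ?ltW // (lt_trans ltr01).
exists n; rewrite fabsM fabsX -cn fabsV mulVf //.
by rewrite fabs_eq0b.
Qed.

Lemma fabs_pi_exp_le1 n : fabs (pi ^+ n) <= 1.
Proof. by rewrite fabsX exprn_ile1 ?fabs_ge0 // ltW // fabs_pi_lt1. Qed.

Lemma lattice_absorb L u : lattice L -> exists n, L (pi ^+ n *: u).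
Proof.
move=> [A Au ->]; rewrite -/(lat A).
have /choice [f fP] : forall i, exists n, fabs (pi ^+ n * (invmx A *m u) i 0) <= 1.
  by move=> i; exact: fabs_absorb.
exists (\sum_i f i)%N; apply/(latE _ Au) => i.
rewrite -scalemxAr mxE (bigD1 i) //= exprD mulrC mulrA fabsM.
by rewrite mulr_ile1 ?fabs_ge0 ?fabs_pi_exp_le1 // mulrC.
Qed.

(** Some multiple of [u] by a power of pi lies in [L], and the hypothesis removes one factor pi at a
    time. This is used where Nakayama's lemma or a geometric series would be expected. *)
Lemma lattice_descent L u : lattice L ->
  (forall n, L (pi ^+ n.+1 *: u) -> L (pi ^+ n *: u)) -> L u.
Proof.
move=> lL desc; have [n] := lattice_absorb u lL.
by elim: n => [|n IH]; rewrite ?expr0 ?scale1r // => /desc /IH.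
Qed.

Lemma lattice_no_line L u : lattice L -> (forall c, L (c *: u)) -> u = 0.
Proof.
move=> [A Au ->]; rewrite -/(lat A) => Lc.
set w := invmx A *m u.
suff w0 : w = 0 by rewrite -(mulKVmx Au u) -/w w0 mulmx0.
apply/matrixP => i j; rewrite (ord1 j) [RHS]mxE; apply/eqP/negPn/negP => wi.
have /(latE _ Au) /(_ i) := Lc (w i 0 * pi)^-1.
rewrite -scalemxAr mxE -/w invfM mulrAC mulVf // mul1r fabsV.
by rewrite leNgt invf_gt1 ?fabs_pi_lt1 // fabs_pi_gt0.
Qed.

Lemma scl_pi_exp_sub n L : omodule L -> scl (pi ^+ n) L `<=` L.
Proof. by move=> oL; apply: scl_sub => //; apply: fabs_pi_exp_le1. Qed.

Lemma lattice_common L M : lattice L -> lattice M ->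
  exists n, forall u, M u -> L (pi ^+ n *: u).
Proof.
move=> lL [B Bu ->]; have oL := lattice_omodule lL.
have /choice [f fP] : forall j, exists n, L (pi ^+ n *: col j B).
  by move=> j; apply: lattice_absorb.
exists (\sum_j f j)%N => u Bmu.
have : lat (pi ^+ (\sum_j f j)%N *: B) (pi ^+ (\sum_j f j)%N *: u).
  by rewrite -scl_lat; exists u.
apply: lat_sub_omodule => // j.
have -> : col j (pi ^+ (\sum_j f j)%N *: B) = pi ^+ (\sum_j f j)%N *: col j B.
  by apply/matrixP => k l; rewrite !mxE.
rewrite (bigD1 j) //= exprD mulrC -scalerA; apply: omoduleZ => //.
exact: fabs_pi_exp_le1.
Qed.

Definition lsum L M : set 'cV[F]_N := [set w | exists u v, [/\ L u, M v & w = u + v]].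

Lemma lsuml L M : omodule M -> L `<=` lsum L M.
Proof. by move=> oM u Lu; exists u, 0; rewrite addr0; split=> //; apply: omodule0. Qed.

Lemma lsumr L M : omodule L -> M `<=` lsum L M.
Proof. by move=> oL u Lu; exists 0, u; rewrite add0r; split=> //; apply: omodule0. Qed.

Lemma lsum_sub L M K : omodule K -> L `<=` K -> M `<=` K -> lsum L M `<=` K.
Proof. by move=> oK LK MK _ [u [v [/LK ? /MK ? ->]]]; apply: omoduleD. Qed.

Lemma omodule_lsum L M : omodule L -> omodule M -> omodule (lsum L M).
Proof.
move=> oL oM; split.
- by apply: lsuml => //; apply: omodule0.
- move=> _ _ [u [v [Lu Mv ->]]] [u' [v' [Lu' Mv' ->]]].
  by exists (u + u'), (v + v'); split; rewrite 1?addrACA //; apply: omoduleD.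
move=> c _ c1 [u [v [Lu Mv ->]]]; exists (c *: u), (c *: v).
by split; rewrite ?scalerDr //; apply: omoduleZ.
Qed.

Lemma omoduleI L M : omodule L -> omodule M -> omodule (L `&` M).
Proof.
move=> oL oM; split=> [|u v [Lu Mu] [Lv Mv]|c u c1 [Lu Mu]].
- by split; apply: omodule0.
- by split; apply: omoduleD.
by split; apply: omoduleZ.
Qed.

Lemma lattice_lsum L M : lattice L -> lattice M -> lattice (lsum L M).
Proof.
move=> lL lM; have [oL oM] := (lattice_omodule lL, lattice_omodule lM).
have [n LM] := lattice_common lL lM.
have pn0 : pi ^+ n != 0 by rewrite expf_neq0.
have lP : lattice (scl (pi ^+ n)^-1 L) by apply: lattice_scl; rewrite ?invr_eq0.
apply: (lattice_between piP (omodule_lsum oL oM) lL lP); first exact: lsuml.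
apply: lsum_sub; first exact: lattice_omodule lP.
  move=> u Lu; apply/sclE; rewrite ?invr_eq0 // invrK; apply: omoduleZ => //.
  exact: fabs_pi_exp_le1.
by move=> u Mu; apply/sclE; rewrite ?invr_eq0 // invrK; apply: LM.
Qed.

Lemma latticeI L M : lattice L -> lattice M -> lattice (L `&` M).
Proof.
move=> lL lM; have [oL oM] := (lattice_omodule lL, lattice_omodule lM).
have [n LM] := lattice_common lL lM.
have pn0 : pi ^+ n != 0 by rewrite expf_neq0.
apply: (lattice_between piP (omoduleI oL oM) (lattice_scl pn0 lM) lL); last first.
  by move=> u [].
by move=> _ [u Mu <-]; split; [exact: LM|apply: scl_pi_exp_sub => //; exists u].
Qed.

Lemma mulmx_cols_in A L u : omodule L -> integral_vectors u ->
  (forall j, L (col j A)) -> L (A *m u).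
Proof. by move=> oL iu LA; apply: (lat_sub_omodule oL LA); exists u. Qed.

(** Decompositions in L + M are not unique, but choosing them on a basis of the sum makes the choice
    linear. *)
Lemma lattice_split L M : lattice L -> lattice M -> exists s : 'M[F]_N,
  forall u, lsum L M u -> L (s *m u) /\ M (u - s *m u).
Proof.
move=> lL lM; have [oL oM] := (lattice_omodule lL, lattice_omodule lM).
have [A Au SE] := lattice_lsum lL lM.
have /choice [f fP] : forall j, exists x, L x /\ M (col j A - x).
  move=> j; have : lsum L M (col j A) by rewrite SE; apply: lat_col.
  by move=> [x [y [Lx My ->]]]; exists x; rewrite addrC addKr.
pose X := \matrix_(i, j) f j i 0.
have colX j : col j X = f j by apply/matrixP => i k; rewrite !mxE (ord1 k).
exists (X *m invmx A) => u; rewrite SE => /(latE _ Au) iu; rewrite -mulmxA.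
split; first by apply: mulmx_cols_in => // j; rewrite colX; case: (fP j).
rewrite -{1}(mulKVmx Au u) -mulmxBl; apply: mulmx_cols_in => // j.
have -> : col j (A - X) = col j A - col j X by apply/matrixP => i k; rewrite !mxE.
by rewrite colX; case: (fP j).
Qed.

(* The basis A of L is chosen with as many columns in M as possible. *)
Lemma lattice_projector L M : lattice L -> lattice M -> M `<=` L ->
  exists s : 'M[F]_N, (forall u, L u -> M (s *m u)) /\
    (forall u, M u -> scl pi L (u - s *m u)).
Proof.
move=> lL lM ML; have [oL oM] := (lattice_omodule lL, lattice_omodule lM).
pose nb A := #|[set j | `[< M (col j A) >]]%SET|.
pose P n := `[< exists A, [/\ A \in unitmx, L = lat A & n = nb A] >].
have exP : exists n, P n.
  by case: lL => A Au LA; exists (nb A); apply/asboolP; exists A.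
have ubP n : P n -> (n <= N)%N.
  by move=> /asboolP [A [_ _ ->]]; rewrite -[leqRHS](card_ord N) max_card.
case: (ex_maxnP exP ubP) => n /asboolP [A [Au LA ->]] nmax {n}.
pose X := \matrix_(i, j) if `[< M (col j A) >] then A i j else 0.
have colX j : col j X = if `[< M (col j A) >] then col j A else 0.
  by apply/matrixP => i k; rewrite !mxE; case: ifP; rewrite !mxE.
exists (X *m invmx A); split=> u; rewrite -mulmxA.
  rewrite LA => /(latE _ Au) iu; apply: mulmx_cols_in => // j; rewrite colX.
  by case: asboolP => // _; apply: omodule0.
move=> Mu; have := ML u Mu; rewrite {1}LA => /(latE _ Au); set c := invmx A *m u => ic.
rewrite -{1}(mulKVmx Au u) -mulmxBl -/c.
have -> : (A - X) *m c = \sum_(j | ~~ `[< M (col j A) >]) c j 0 *: col j A.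
  rewrite [RHS]big_mkcond; apply/matrixP => i k; rewrite mxE summxE.
  apply: eq_bigr => j _; rewrite !mxE (ord1 k).
  case: asboolP => _ /=; rewrite !mxE ?subrr ?mul0r //.
  by rewrite subr0 mulrC.
apply: omodule_sum; first exact: omodule_scl.
move=> j nMj; have : fabs (c j 0) <= fabs pi.
  apply: fabs_pi_max; rewrite // lt_neqAle ic andbT; apply/negP => /eqP cj1.
  (* If the coordinate along a column outside [M] were a unit, exchanging that column for [u], which
     lies in [M], would give a basis of [L] with more columns in [M]. *)
  have iC : integral_mx (col_replace j c).
    by move=> k l; rewrite mxE; case: ifP => // _; case: eqP; rewrite ?fabs0 ?fabs1.
  have dC : fabs (\det (col_replace j c)) = 1 by rewrite det_col_replace.
  have LC : L = lat (A *m col_replace j c) by rewrite lat_mul_eq.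
  have Cu : A *m col_replace j c \in unitmx.
    by rewrite unitmx_mul Au; have [-> _] := integral_invmx iC dC.
  have := nmax _ (asboolT (ex_intro _ _ (And3 Cu LC erefl))).
  rewrite leqNgt => /negP; apply; apply: proper_card.
  apply/properP; split; last first.
    exists j; rewrite inE ?(negPf nMj) //; apply/asboolP.
    by rewrite col_mul_replace eqxx mulKVmx.
  apply/fintype.subsetP => k; rewrite !inE => /asboolP Mk; apply/asboolP.
  rewrite col_mul_replace; case: eqP => // kj; move: nMj; rewrite -kj.
  by move/asboolP.
have Lj : L (col j A) by rewrite LA; apply: lat_col.
move=> cj; apply: (scl_le oL cj); by exists (col j A).
Qed.

(** The equivalence expresses g L = L and not merely g L inside L. *)
Definition stabilizes L : set (GL F N) := [set g | forall u, L u <-> L (g *m u)].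

(* The kernel of the reduction modulo pi on the stabilizer of a lattice. *)
Definition congruence L : set (GL F N) :=
  [set g | forall u, L u -> scl pi L (g *m u - u)].

Lemma stabilizes_scl c L g : c != 0 -> stabilizes L g -> stabilizes (scl c L) g.
Proof.
move=> c0 Lg u; rewrite !(sclE _ _ c0).
by apply: iff_trans (Lg _) _; rewrite scalemxAr.
Qed.

Lemma stabilizes_in L g u : stabilizes L g -> L u -> L (g *m u).
Proof. by move=> /(_ u) []. Qed.

Lemma mulGLVK g u : GL_mx g *m (GL_mx g^-1%g *m u) = u.
Proof. by rewrite -[GL_mx g^-1%g]/(invmx g) mulKVmx //; exact: Defs.GL_unit. Qed.

Lemma mulGLKV g u : GL_mx g^-1%g *m (GL_mx g *m u) = u.
Proof. by rewrite -[GL_mx g^-1%g]/(invmx g) mulKmx //; exact: Defs.GL_unit. Qed.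

Lemma stabilizesV L g : stabilizes L g -> stabilizes L g^-1%g.
Proof.
move=> Lg u; apply: iff_trans (iff_sym (Lg _)).
by rewrite mulGLVK.
Qed.

Lemma mulGLmx g h u : GL_mx (g * h)%g *m u = GL_mx g *m (GL_mx h *m u).
Proof. by rewrite mulmxA. Qed.

(** Only g L inside L is immediate. Conversely, if g u lies in L, then pi^(n+1) u in L makes pi^n (g
    u - u), hence pi^n u, lie in L, and descent applies. *)
Lemma congruence_stabilizes L g : lattice L -> congruence L g -> stabilizes L g.
Proof.
move=> lL Lg u; have oL := lattice_omodule lL.
split=> [Lu|Lgu].
  rewrite -(subrK u (g *m u)); apply: omoduleD => //.
  exact: (scl_pi_sub piP oL (Lg u Lu)).
apply: lattice_descent => // n Ln.
have /(sclE _ _ pi0) := Lg _ Ln.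
rewrite -scalemxAr -scalerBr scalerA exprS mulKf // scalerBr => LB.
have -> : pi ^+ n *: u = pi ^+ n *: (g *m u) - (pi ^+ n *: (g *m u) - pi ^+ n *: u).
  by rewrite opprB addrC subrK.
apply: omoduleB => //; apply: omoduleZ => //; exact: fabs_pi_exp_le1.
Qed.

Lemma congruence1 L : lattice L -> congruence L 1%g.
Proof.
move=> /lattice_omodule oL u Lu; rewrite mul1mx subrr.
exact: omodule0 (omodule_scl pi oL).
Qed.

Lemma congruenceM L g h : lattice L -> congruence L g -> congruence L h ->
  congruence L (g * h)%g.
Proof.
move=> lL Lg Lh u Lu; have oL := lattice_omodule lL.
have -> : (g * h)%g *m u - u = (g *m (h *m u) - h *m u) + (h *m u - u).
  by rewrite addrA subrK mulmxA.
apply: omoduleD; [exact: omodule_scl| |exact: Lh].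
by apply: Lg; apply: stabilizes_in Lu; apply: congruence_stabilizes.
Qed.

Lemma congruenceV L g : lattice L -> congruence L g -> congruence L g^-1%g.
Proof.
move=> lL Lg u Lu; have sLg := congruence_stabilizes lL Lg.
have Lv : L (g^-1%g *m u) by apply: stabilizes_in Lu; apply: stabilizesV.
have -> : g^-1%g *m u - u = - (g *m (g^-1%g *m u) - g^-1%g *m u).
  by rewrite mulGLVK opprB.
apply: omoduleN; last exact: Lg.
exact/omodule_scl/lattice_omodule.
Qed.

Lemma congruence_conj L g h : stabilizes L g -> congruence L h ->
  congruence L (g^-1 * h * g)%g.
Proof.
move=> Lg Lh u Lu.
have -> : (g^-1 * h * g)%g *m u - u = g^-1%g *m (h *m (g *m u) - g *m u).
  by rewrite mulmxBr mulGLKV !mulmxA.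
apply: (stabilizes_in (stabilizes_scl pi0 (stabilizesV Lg))); apply: Lh.
exact: stabilizes_in Lu.
Qed.

(** Invertibility of 1 + a: if a u = - u, then descent puts every multiple of u in L, and a lattice
    contains no line. *)
Lemma exists_congruence L (a : 'M[F]_N) : lattice L ->
  (forall u, L u -> scl pi L (a *m u)) ->
  exists g, GL_mx g = 1%:M + a /\ congruence L g.
Proof.
move=> lL La; have oL := lattice_omodule lL.
have ker u : (1%:M + a) *m u = 0 -> u = 0.
  rewrite mulmxDl mul1mx => /eqP; rewrite addr_eq0 => /eqP uE.
  apply: (lattice_no_line lL) => c; apply: lattice_descent => // n.
  move=> /La /(sclE _ _ pi0); rewrite -!scalemxAr (scalerA pi^-1) exprS mulKf // => L'.
  rewrite uE !scalerN; exact: omoduleN.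
have u1 : 1%:M + a \in unitmx.
  rewrite -unitmx_tr -row_free_unit; apply: inj_row_free => v va.
  apply: trmx_inj; rewrite trmx0; apply: ker.
  by rewrite -[LHS]trmxK trmx_mul trmxK va trmx0.
exists (MkGL u1); split=> // u Lu /=.
by rewrite mulmxDl mul1mx addrC addKr; apply: La.
Qed.

Lemma congruence_adj_stabilizes L M g : lattice L -> lattice M ->
  scl pi L `<=` M -> M `<=` L -> congruence L g -> stabilizes M g.
Proof.
move=> lL lM LM ML Lg.
have imp h : congruence L h -> forall u, M u -> M (h *m u).
  move=> Lh u Mu; rewrite -(subrK u (h *m u)); apply: omoduleD => //.
    exact: lattice_omodule.
  exact/LM/Lh/ML.
move=> u; split; first exact: imp.
by move=> /(imp _ (congruenceV lL Lg)); rewrite mulGLKV.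
Qed.

Lemma stabilizes_sclE c L g : c != 0 -> stabilizes (scl c L) g -> stabilizes L g.
Proof.
move=> c0 /(stabilizes_scl (c := c^-1)); rewrite sclA mulVf // scl1.
by apply; rewrite invr_eq0.
Qed.

Lemma congruence_adj_stabilizes' L M g : lattice L -> lattice M ->
  scl pi M `<=` L -> L `<=` M -> congruence L g -> stabilizes M g.
Proof.
move=> lL lM ML LM Lg; apply: (stabilizes_sclE pi0).
apply: (congruence_adj_stabilizes lL _ _ ML Lg); first exact: lattice_scl.
exact: sclS.
Qed.

(** With g = 1 + a and [s] a linear splitting of L + M, the matrix s a maps L + M to pi L, and (1 -
    s) a maps it to pi M. The right factor is 1 + (1 - s) a, and the left one differs from 1 by s a
    times the inverse of the right one. *)
Lemma congruence_lsum L M g : lattice L -> lattice M ->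
  congruence (lsum L M) g -> exists a b, [/\ congruence L a, congruence M b & g = (a * b)%g].
Proof.
move=> lL lM gS; have lS := lattice_lsum lL lM.
have [[oL oM] oS] := (lattice_omodule lL, lattice_omodule lM, lattice_omodule lS).
have [s sP] := lattice_split lL lM.
pose a : 'M[F]_N := GL_mx g - 1%:M.
have aE u : a *m u = g *m u - u by rewrite mulmxBl mul1mx.
have aS u : lsum L M u -> scl pi L (s *m a *m u) /\ scl pi M ((a - s *m a) *m u).
  move=> /gS; rewrite mulmxBl -!mulmxA -aE => -[v /sP [Lv Mv] <-].
  rewrite -!scalemxAr -scalerBr; split; first by exists (s *m v).
  by exists (v - s *m v).
have cM u : lsum L M u -> scl pi (lsum L M) ((a - s *m a) *m u).
  by move=> /aS [_]; apply: sclS; apply: lsumr.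
have [b [bE bS]] := exists_congruence lS cM.
have bM : congruence M b.
  move=> u Mu; rewrite bE mulmxDl mul1mx addrC addKr.
  by have [] := aS u (lsumr oL Mu).
exists (g * b^-1)%g, b; split; rewrite ?mulgVK //.
move=> u Lu.
have Sv : lsum L M (b^-1%g *m u).
  by apply: (stabilizes_in (stabilizesV (congruence_stabilizes lS bS))); apply: lsuml.
have [sv _] := aS _ Sv.
rewrite mulGLmx -[X in _ - X](mulGLVK b) -mulmxBl.
have -> // : GL_mx g - GL_mx b = s *m a.
by rewrite bE opprD addrA -/a opprB addrCA subrr addr0.
Qed.

(** Dual to the case of a sum: the splitting [s] of L + pi^-1 K acts on the other side of a = g - 1.
    It maps pi^-1 K to J, and 1 - s maps L to J. Hence 1 + a s is congruent to 1 on K, and the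
    remaining factor differs from 1 by (1 + a s)^-1 a (1 - s), which maps L to pi J. *)
Lemma congruence_cap K L g : lattice K -> lattice L -> K `<=` L ->
  congruence (L `&` scl pi^-1 K) g ->
  exists a b, [/\ congruence K a, congruence L b & g = (a * b)%g].
Proof.
move=> lK lL KL; set K' := scl pi^-1 K; set J := L `&` K' => gJ.
have pV0 : pi^-1 != 0 by rewrite invr_eq0.
have lK' : lattice K' by apply: lattice_scl.
have lJ : lattice J by apply: latticeI.
have [[[oK oL] oK'] oJ] := (lattice_omodule lK, lattice_omodule lL,
  lattice_omodule lK', lattice_omodule lJ).
have KJ : K `<=` J.
  move=> u Ku; split; first exact: KL.
  by apply/(sclE _ _ pV0); rewrite invrK; apply: omoduleZ => //; apply/ltW/fabs_pi_lt1.
have piJK : scl pi J `<=` K.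
  by move=> _ [u [_ /(sclE _ _ pV0)] + <-]; rewrite invrK.
have [s sP] := lattice_split lL lK'.
have sK' u : K' u -> J (s *m u).
  move=> Ku; have [Lsu Ksu] := sP u (lsumr oL Ku); split=> //.
  by rewrite -[s *m u](subKr u); apply: omoduleB.
have sL u : L u -> J (u - s *m u).
  move=> Lu; have [Lsu Ksu] := sP u (lsuml oK' Lu); split=> //.
  exact: omoduleB.
pose a : 'M[F]_N := GL_mx g - 1%:M.
have aE u : a *m u = g *m u - u by rewrite mulmxBl mul1mx.
have aJ u : J u -> scl pi J (a *m u) by rewrite aE; apply: gJ.
have bK u : K u -> scl pi K (a *m s *m u).
  move=> Ku; have K'u : K' (pi^-1 *: u) by exists u.
  have := piJK _ (aJ _ (sK' _ K'u)); rewrite -mulmxA -!scalemxAr => H.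
  by apply/(sclE _ _ pi0).
have [al [alE alK]] := exists_congruence lK bK.
have alJ : stabilizes J al by apply: congruence_adj_stabilizes' alK.
exists al, (al^-1 * g)%g; split; rewrite ?mulKVg //.
move=> u Lu; have Jv := sL u Lu.
have -> : (al^-1 * g)%g *m u - u = al^-1%g *m (a *m (u - s *m u)).
  rewrite mulGLmx -[X in _ - X](mulGLKV al) -mulmxBr.
  rewrite (_ : g *m u - al *m u = a *m (u - s *m u)) //.
  by rewrite mulmxBr mulmxA aE alE mulmxDl mul1mx opprD addrA.
apply: (sclS (L := J)); first by move=> ? [].
by apply: (stabilizes_in (stabilizes_scl pi0 (stabilizesV alJ))); apply: aJ.
Qed.

End LatticeOperations.

(** * Averaging over compact subgroups *)

Section GLTopology.
Variables (R : realType) (F : nonArchFieldType R) (N : nat).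
Implicit Types (g h : GL F N) (O : set (GL F N)).

Lemma positive_lower_bound (T : eqType) (s : seq T) (f : T -> R) :
  (forall i, 0 < f i) -> exists2 r, 0 < r & forall i, i \in s -> r <= f i.
Proof.
move=> f0; elim: s => [|i s [r r0 rs]]; first by exists 1.
exists (Num.min r (f i)); first by rewrite lt_min r0 f0.
by move=> j; rewrite inE ge_min => /orP[/eqP->|/rs ->//]; rewrite lexx orbT.
Qed.

Lemma nbhs_GL_ball g (r : R) : 0 < r ->
  nbhs g [set h | forall i j, fabs (h i j - g i j) < r].
Proof.
move=> r0.
have : nbhs (GL_mx g) [set M : 'M[F]_N | forall i j, fabs (M i j - g i j) < r].
  exists (fun i j => [set y | fabs (y - g i j) < r]); last by move=> M MP i j; apply: MP.
  by move=> i j; apply/fabs_nbhs; exists r.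
exact: (@initial_continuous _ _ (@GL_mx F N)).
Qed.

Lemma GL_open_ball O g : open O -> O g ->
  exists2 r : R, 0 < r & forall h, (forall i j, fabs (h i j - g i j) < r) -> O h.
Proof.
move=> [A oA <-] Ag; have [P Pg PA] : nbhs (GL_mx g) A by apply: open_nbhs_nbhs.
have /choice [f fP] : forall ij : 'I_N * 'I_N, exists r : R, 0 < r /\
    forall y, fabs (y - g ij.1 ij.2) < r -> P ij.1 ij.2 y.
  by move=> [i j]; have /fabs_nbhs [r r0 rP] := Pg i j; exists r.
have [|r r0 rf] := @positive_lower_bound _ (enum [set: 'I_N * 'I_N]%SET) f.
  by move=> ij; case: (fP ij).
exists r => // h hg; apply: PA => i j; have [_] := fP (i, j); apply.
by apply: lt_le_trans (hg i j) _; apply: rf; rewrite mem_enum inE.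
Qed.

Lemma GL_openP O : (forall g, O g -> exists2 r : R, 0 < r &
  forall h, (forall i j, fabs (h i j - g i j) < r) -> O h) -> open O.
Proof.
move=> OP; rewrite openE => g Og; have [r r0 rO] := OP g Og.
by rewrite /interior; apply: filterS (nbhs_GL_ball g r0) => h hg; apply: rO.
Qed.

Definition entries_le m n (X : 'M[F]_(m, n)) (r : R) := forall i j, fabs (X i j) <= r.

Lemma entries_bounded m n (X : 'M[F]_(m, n)) : exists2 r, 0 < r & entries_le X r.
Proof.
have [|r r0 rP] := @positive_lower_bound _ (enum [set: 'I_m * 'I_n]%SET)
    (fun ij => (1 + fabs (X ij.1 ij.2))^-1).
  by move=> ij; rewrite invr_gt0 ltr_pwDl // fabs_ge0.
exists r^-1; rewrite ?invr_gt0 // => i j.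
have := rP (i, j); rewrite mem_enum inE => /(_ isT) /= rX.
rewrite (@le_trans _ _ (1 + fabs (X i j))) ?ler_wpDl //.
by rewrite -[leLHS]invrK lef_pV2 // posrE ?invr_gt0 // ltr_pwDl // fabs_ge0.
Qed.

(** The ultrametric inequality avoids a factor [n]. *)
Lemma entries_le_mul m n p (X : 'M[F]_(m, n)) (Y : 'M[F]_(n, p)) (r s : R) :
  0 <= r -> 0 <= s -> entries_le X r -> entries_le Y s -> entries_le (X *m Y) (r * s).
Proof.
move=> r0 s0 Xr Ys i j; rewrite mxE; apply: fabs_sum_le; first exact: mulr_ge0.
by move=> k _; rewrite fabsM ler_pM ?fabs_ge0.
Qed.

(** Translation of the ball about 1: g^-1 h - 1 = g^-1 (h - g) is small once h - g is small relative
    to the entries of g^-1. *)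
Lemma GL_open_subgroup O : (forall g h, O g -> O h -> O (g * h)%g) ->
  (exists2 r : R, 0 < r & forall h, entries_le (GL_mx h - 1%:M) r -> O h) -> open O.
Proof.
move=> OM [r r0 rO]; apply: GL_openP => g Og.
have [c c0 cg] := entries_bounded (GL_mx g^-1%g).
exists (r / c); first exact: divr_gt0.
move=> h hg; rewrite -(mulKVg g h); apply: OM => //; apply: rO.
have -> : GL_mx (g^-1 * h)%g - 1%:M = GL_mx g^-1%g *m (GL_mx h - GL_mx g).
  by rewrite mulmxBr; congr (_ - _); rewrite mulVmx // Defs.GL_unit.
have -> : r = c * (r / c) by rewrite mulrC divfK // gt_eqF.
apply: entries_le_mul cg _; rewrite ?divr_ge0 ?ltW // => i j.
by rewrite !mxE; apply/ltW/hg.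
Qed.

Lemma GL_open_ball1 O : open O -> O 1%g ->
  exists2 r : R, 0 < r & forall h, entries_le (GL_mx h - 1%:M) r -> O h.
Proof.
move=> oO O1; have [r r0 rO] := GL_open_ball oO O1.
exists (r / 2); first exact: divr_gt0.
move=> h h1; apply: rO => i j; have := h1 i j; rewrite !mxE => /le_lt_trans; apply.
by rewrite ltr_pdivrMr // ltr_pMr // ltr1n.
Qed.

End GLTopology.

(** * Congruence groups are open, with finitely many cosets modulo small balls *)

Section CongruenceTopology.
Variables (R : realType) (F : nonArchFieldType R) (N : nat) (pi : F).
Hypothesis piP : uniformizer pi.
Implicit Types (g h : GL F N) (L : set 'cV[F]_N).

Lemma congruence_ball L : lattice L -> exists2 r : R, 0 < r &
  forall h, entries_le (GL_mx h - 1%:M) r -> congruence pi L h.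
Proof.
move=> [A Au ->]; rewrite -/(lat A).
have [c c0 cA] := entries_bounded A; have [d d0 dA] := entries_bounded (invmx A).
(* Passing to the basis [A] enlarges entries by at most d c, and one factor pi has to be divided
   out. *)
exists (fabs pi / (d * c)); first by rewrite divr_gt0 ?mulr_gt0 ?fabs_pi_gt0.
move=> h h1 u /(latE _ Au) iu; apply/(sclE _ _ (pi_neq0 piP)); apply/(latE _ Au) => i.
have -> : invmx A *m (pi^-1 *: (h *m u - u)) =
    pi^-1 *: (invmx A *m (GL_mx h - 1%:M) *m A *m (invmx A *m u)).
  rewrite -scalemxAr; congr (_ *: _).
  by rewrite -!mulmxA (mulKVmx Au) mulmxBl mul1mx.
rewrite mxE fabsM fabsV mulrC ler_pdivrMr ?fabs_pi_gt0 // mul1r.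
have E : fabs pi = d * (fabs pi / (d * c)) * c * 1.
  by rewrite mulr1 mulrAC [_ * c]mulrC mulrCA divff ?mulr1 // mulf_neq0 // gt_eqF.
have p0 : 0 <= fabs pi / (d * c) by rewrite divr_ge0 ?fabs_ge0 // mulr_ge0 ?ltW.
have [cc dd] := (ltW c0, ltW d0).
move: h1 p0 E; move: (fabs pi / (d * c)) => q h1 p0 E.
rewrite E; apply: entries_le_mul; rewrite ?mulr_ge0 //.
  by apply: entries_le_mul; rewrite ?mulr_ge0 //; apply: entries_le_mul.
by move=> k l; rewrite (ord1 l).
Qed.

Hypothesis lc : locally_compact [set: F].

(** In a basis of [L] the elements of the group have integral entries. Sorting these into finitely
    many small balls, two elements of one class differ by a factor close to 1. This is the form in
    which compactness is used. *)
Lemma congruence_finite_cosets L (r : R) : lattice L -> 0 < r ->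
  exists (I : finType) (cls : GL F N -> I), forall g h,
    congruence pi L g -> congruence pi L h -> cls g = cls h ->
    entries_le (GL_mx (g^-1 * h)%g - 1%:M) r.
Proof.
move=> lL r0; have [A Au LA] := lL.
have [c c0 cA] := entries_bounded A; have [d d0 dA] := entries_bounded (invmx A).
have e0 : 0 < r / (c * d) by rewrite divr_gt0 // mulr_gt0.
have [s sP] := ring_of_integers_totally_bounded lc e0.
pose Y g : 'M[F]_N := invmx A *m g *m A.
have iY g : congruence pi L g -> integral_mx (Y g).
  move=> Lg i j; have sg := congruence_stabilizes piP lL Lg.
  have : L (g *m col j A) by apply: stabilizes_in sg _; rewrite LA; apply: lat_col.
  rewrite LA => /(latE _ Au) /(_ i).
  by rewrite colE !mulmxA -colE mxE.
pose near_ (a : F) (k : 'I_(size s)) := fabs (a - nth 0 s k) < r / (c * d).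
have near_ex a : fabs a <= 1 -> exists k, near_ a k.
  move=> /sP [b bs ab]; have bi : (index b s < size s)%N by rewrite index_mem.
  by exists (Ordinal bi); rewrite /near_ /= nth_index.
(* The value [None] marks an entry near no centre; it does not occur for elements of the congruence
   group. *)
pose cls g : {ffun 'I_N * 'I_N -> option 'I_(size s)} :=
  [ffun ij => [pick k | near_ (Y g ij.1 ij.2) k]].
exists {ffun 'I_N * 'I_N -> option 'I_(size s)}, cls => g h Lg Lh ghE.
have gh : entries_le (Y h - Y g) (r / (c * d)).
  move=> i j; have := congr1 (fun f : {ffun _} => f (i, j)) ghE; rewrite !ffunE /=.
  case: pickP => [k gk|ng]; last by have [k] := near_ex _ (iY g Lg i j); rewrite ng.
  case: pickP => [k' hk' [kk]|//]; rewrite kk in gk.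
  apply/ltW.
  have -> : (Y h - Y g) i j = (Y h i j - nth 0 s k') + (nth 0 s k' - Y g i j).
    by rewrite addrA subrK [LHS]mxE [X in _ + X]mxE.
  by apply: fabsD_lt => //; rewrite fabsB.
have iV : integral_mx (Y g^-1%g) by apply/iY/congruenceV.
have -> : GL_mx (g^-1 * h)%g - 1%:M = A *m (Y g^-1%g *m (Y h - Y g)) *m invmx A.
  have -> : Y h - Y g = invmx A *m (GL_mx h - GL_mx g) *m A.
    by rewrite mulmxBr mulmxBl.
  rewrite /Y !mulmxA mulmxV // mul1mx !mulmxK // mulmxBr; congr (_ - _).
  by rewrite mulVmx // Defs.GL_unit.
have -> : r = c * (1 * (r / (c * d))) * d.
  by rewrite mul1r mulrAC mulrC divfK // mulf_neq0 // gt_eqF.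
have [cc dd ee] := And3 (ltW c0) (ltW d0) (ltW e0).
move: gh ee; move: (r / (c * d)) => q gh ee.
by do 2!(apply: entries_le_mul; rewrite ?mulr_ge0 //); apply: entries_le_mul.
Qed.

End CongruenceTopology.

Section Averaging.
Variables (R : realType) (F : nonArchFieldType R) (N : nat).
Variables (V : lmodType R[i]) (rho : GL F N -> V -> V).
Hypothesis rho_smooth : smooth_representation [set: V] rho.
Implicit Types (g h : GL F N) (u v : V) (H : set (GL F N)).

Lemma rhoL g a u v : rho g (a *: u + v) = a *: rho g u + rho g v.
Proof. exact: (smooth_linear rho_smooth). Qed.

Lemma rhoD g u v : rho g (u + v) = rho g u + rho g v.
Proof. by have := rhoL g 1 u v; rewrite !scale1r. Qed.

Lemma rho0 g : rho g 0 = 0.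
Proof. by apply: (addrI (rho g 0)); rewrite -rhoD !addr0. Qed.

Lemma rhoZ g a u : rho g (a *: u) = a *: rho g u.
Proof. by have := rhoL g a u 0; rewrite rho0 !addr0. Qed.

Lemma rho1 v : rho 1%g v = v.
Proof. exact: (smooth_act1 rho_smooth). Qed.

Lemma rhoM g h v : rho (g * h)%g v = rho g (rho h v).
Proof. exact: (smooth_actM rho_smooth). Qed.

Lemma rhoK g : cancel (rho g) (rho g^-1%g).
Proof. by move=> v; rewrite -rhoM mulVg rho1. Qed.

Lemma rhoVK g : cancel (rho g^-1%g) (rho g).
Proof. by move=> v; rewrite -rhoM mulgV rho1. Qed.

Lemma rho_sum g (I : Type) (r : seq I) (P : pred I) (f : I -> V) :
  rho g (\sum_(i <- r | P i) f i) = \sum_(i <- r | P i) rho g (f i).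
Proof. exact: (big_morph (rho g) (rhoD g) (rho0 g)). Qed.

Definition orb H v : set V := [set rho h v | h in H].

(** The projection onto the vectors fixed by [H]: the group acts transitively on the orbit, so the
    mean over the orbit is the integral over the group. In exchange, additivity has to be proved,
    through orbits of pairs. *)
Definition avg H v : V :=
  let s := enum_fset (fset_set (orb H v)) in
  (size s)%:R^-1 *: \sum_(w <- s) w.

(** Compactness enters as finiteness of the orbits in [V], so this is a property of [H] relative to
    [rho]. *)
Record compact_group H : Prop := {
  cgroup1 : H 1%g;
  cgroupM : forall g h, H g -> H h -> H (g * h)%g;
  cgroupV : forall g, H g -> H g^-1%g;
  cgroup_orb : forall v, finite_set (orb H v) }.

Section Subgroup.
Variable H : set (GL F N).
Hypothesis cH : compact_group H.

Lemma mem_orb v w : w \in enum_fset (fset_set (orb H v)) <-> orb H v w.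
Proof.
have fo := cgroup_orb cH v.
by rewrite -[_ \in enum_fset _]/(w \in fset_set (orb H v)) in_fset_set // in_setE.
Qed.

Definition pair_orb u v : set (V * V) := [set (rho h u, rho h v) | h in H].

Lemma pair_orb_finite u v : finite_set (pair_orb u v).
Proof.
apply: (@sub_finite_set _ _ (orb H u `*` orb H v)).
  by move=> _ [h Hh <-]; split; exists h.
by apply: finite_setX; apply: cgroup_orb.
Qed.

Let ps u v := enum_fset (fset_set (pair_orb u v)).

Lemma mem_pair_orb u v p : p \in ps u v <-> pair_orb u v p.
Proof.
have fo := pair_orb_finite u v.
by rewrite -[_ \in ps u v]/(p \in fset_set (pair_orb u v)) in_fset_set // in_setE.
Qed.

(* The orbit of f (u, v) is the image of the orbit of (u, v), with fibres of
   equal size since the group permutes them transitively. *)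
Lemma avg_pair u v (f : V * V -> V) :
  (forall h p, f (rho h p.1, rho h p.2) = rho h (f p)) ->
  avg H (f (u, v)) = (size (ps u v))%:R^-1 *: \sum_(p <- ps u v) f p.
Proof.
move=> fH; rewrite /avg; set s := enum_fset _; set A := ps u v.
have us : uniq s by exact: fset_uniq.
have uA : uniq A by exact: fset_uniq.
have fA p : p \in A -> f p \in s.
  move=> /mem_pair_orb [h Hh <-]; apply/mem_orb; exists h => //.
  by rewrite -fH.
pose c := count (fun p => f p == f (u, v)) A.
have cE w : w \in s -> count (fun p => f p == w) A = c.
  move=> /mem_orb [h Hh <-].
  pose act (p : V * V) := (rho h p.1, rho h p.2).
  have actI : injective act.
    by move=> [a b] [a' b'] [/(can_inj (rhoK h)) -> /(can_inj (rhoK h)) ->].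
  have pA : perm_eq (map act A) A.
    apply: uniq_perm; rewrite ?map_inj_uniq // => p; apply/idP/idP.
      move=> /mapP [q /mem_pair_orb [k Hk <-] ->]; apply/mem_pair_orb.
      by exists (h * k)%g; rewrite /act ?rhoM //; apply: cgroupM.
    move=> /mem_pair_orb [k Hk <-]; apply/mapP.
    exists (rho (h^-1 * k)%g u, rho (h^-1 * k)%g v).
      apply/mem_pair_orb; exists (h^-1 * k)%g => //.
      by apply: cgroupM => //; apply: cgroupV.
    by rewrite /act /= -!rhoM !mulKVg.
  rewrite -(seq.permP pA) count_map; apply: eq_count => p /=.
  by rewrite fH (inj_eq (can_inj (rhoK h))).
have part : \sum_(p <- A) f p = (\sum_(w <- s) w) *+ c.
  have -> : \sum_(p <- A) f p = \sum_(p <- A) \sum_(w <- s) (if f p == w then w else 0).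
    rewrite big_seq [RHS]big_seq; apply: eq_bigr => p pA.
    rewrite (bigD1_seq (f p)) ?fA //= eqxx big1 ?addr0 // => w.
    by rewrite eq_sym => /negPf ->.
  rewrite exchange_big /= -sumrMnl big_seq [RHS]big_seq; apply: eq_bigr => w ws.
  by rewrite -big_mkcond big_const_seq iter_addr_0 cE.
have sizeA : size A = (size s * c)%N.
  rewrite -sum1_size.
  have -> : (\sum_(p <- A) 1 = \sum_(p <- A) \sum_(w <- s) (if f p == w then 1 else 0))%N.
    rewrite big_seq [RHS]big_seq; apply: eq_bigr => p pA.
    rewrite (bigD1_seq (f p)) ?fA //= eqxx big1 ?addn0 // => w.
    by rewrite eq_sym => /negPf ->.
  rewrite exchange_big /= big_seq.
  under eq_bigr => w ws do rewrite -big_mkcond sum1_count cE //.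
  by rewrite -big_seq big_const_seq count_predT iter_addn_0 mulnC.
have c0 : c != 0%N.
  rewrite -lt0n -has_count; apply/hasP; exists (u, v) => //.
  by apply/mem_pair_orb; exists 1%g; rewrite ?rho1 //; apply: cgroup1.
rewrite part sizeA natrM invfM -[X in _ = _ *: X]scaler_nat scalerA mulfVK //.
by rewrite pnatr_eq0.
Qed.

Lemma avgD u v : avg H (u + v) = avg H u + avg H v.
Proof.
rewrite (@avg_pair u v (fun p => p.1 + p.2)) => [|h p]; last by rewrite rhoD.
rewrite (@avg_pair u v fst) // (@avg_pair u v snd) //.
by rewrite big_split scalerDr.
Qed.

Lemma avgZ a u : avg H (a *: u) = a *: avg H u.
Proof.
rewrite (@avg_pair u u (fun p => a *: p.1)) => [|h p]; last by rewrite rhoZ.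
by rewrite (@avg_pair u u fst) // -scaler_sumr !scalerA mulrC.
Qed.

Lemma size_orb_neq0 v : (size (enum_fset (fset_set (orb H v))))%:R != 0 :> R[i].
Proof.
rewrite pnatr_eq0 size_eq0; apply/eqP => s0.
have : v \in enum_fset (fset_set (orb H v)).
  by apply/mem_orb; exists 1%g; rewrite ?rho1 //; apply: cgroup1.
by rewrite s0.
Qed.

Lemma avg_morph (f : V -> V) v : (forall u w, f (u + w) = f u + f w) ->
  (forall a u, f (a *: u) = a *: f u) -> (forall h, H h -> f (rho h v) = f v) ->
  f (avg H v) = f v.
Proof.
move=> fD fZ fH; rewrite /avg fZ.
have f0 : f 0 = 0 by apply: (addrI (f 0)); rewrite -fD !addr0.
rewrite (big_morph f fD f0) big_seq.
rewrite (eq_bigr (fun=> f v)) => [|w /mem_orb [h Hh <-]]; last exact: fH.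
rewrite -big_seq big_const_seq count_predT iter_addr_0 -[f v *+ _]scaler_nat scalerA mulVf ?scale1r //.
exact: size_orb_neq0.
Qed.

Lemma avg_id v : (forall h, H h -> rho h v = v) -> avg H v = v.
Proof. by move=> vH; apply: (@avg_morph (fun w => w) v) => // h /vH. Qed.

Lemma avg_conj g v : (forall h, H h -> H (g^-1 * h * g)%g) ->
  (forall h, H h -> H (g * h * g^-1)%g) -> avg H (rho g v) = rho g (avg H v).
Proof.
move=> Hg gH; rewrite /avg rhoZ rho_sum.
set s := enum_fset _; set s' := enum_fset _.
have ps' : perm_eq s (map (rho g) s').
  apply: uniq_perm; rewrite ?(map_inj_uniq (can_inj (rhoK g))) ?fset_uniq // => w.
  apply/idP/idP.
    move=> /mem_orb [h Hh <-]; apply/mapP; exists (rho (g^-1 * h * g)%g v).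
      by apply/mem_orb; exists (g^-1 * h * g)%g => //; apply: Hg.
    by rewrite -!rhoM !mulgA mulgV mul1g.
  move=> /mapP [_ /mem_orb [h Hh <-] ->]; apply/mem_orb.
  by exists (g * h * g^-1)%g; [exact: gH|rewrite -!rhoM mulgVK].
by rewrite (perm_big _ ps') (perm_size ps') size_map big_map.
Qed.

Lemma avg_act h v : H h -> avg H (rho h v) = avg H v.
Proof.
move=> Hh; rewrite /avg; suff -> : orb H (rho h v) = orb H v by [].
apply/seteqP; split=> [_ [k Hk <-]|_ [k Hk <-]].
  by exists (k * h)%g; [exact: cgroupM|rewrite rhoM].
exists (k * h^-1)%g; last by rewrite -rhoM mulgVK.
by apply: cgroupM => //; apply: cgroupV.
Qed.

Lemma avg_fixed h v : H h -> rho h (avg H v) = avg H v.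
Proof.
move=> Hh; have Vh := cgroupV cH Hh; rewrite -avg_conj ?avg_act // => k Hk.
  by do 2!(apply: cgroupM => //).
by do 2!(apply: cgroupM => //).
Qed.

End Subgroup.
End Averaging.

(** * Vertices and pro-unipotent radicals *)

Section Vertices.
Variables (R : realType) (F : nonArchFieldType R) (N : nat) (pi : F).
Hypothesis piP : uniformizer pi.
Hypothesis N_gt0 : (0 < N)%N.
Local Notation vtx := (set (set 'cV[F]_N)).
Implicit Types (L M K X Y Z J : set 'cV[F]_N) (x y z : vtx) (g h : GL F N).

Let pi0 : pi != 0 := pi_neq0 piP.
Let pi1 : fabs pi < 1 := fabs_pi_lt1 piP.

Definition normal L := [/\ lattice L, L `<=` @integral_vectors R F N &
  exists u i, L u /\ fabs (u i 0) = 1].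

Lemma vertex_mem x M : vertices x -> x M -> lattice M /\ x = homothety_class M.
Proof.
move=> [L lL ->] [c c0 ->]; rewrite -/(scl c L); split; first exact: lattice_scl.
apply/seteqP; split=> [_ [d d0 ->]|_ [d d0 ->]]; rewrite -!/(scl _ _).
  exists (d / c); first by rewrite mulf_neq0 ?invr_eq0.
  by rewrite -/(scl _ _) sclA divfK.
exists (d * c); first by rewrite mulf_neq0.
by rewrite -!/(scl _ _) sclA.
Qed.

Lemma vertices_class L : lattice L -> vertices (homothety_class L).
Proof. by exists L. Qed.

Lemma homothety_class_refl L : homothety_class L L.
Proof. by exists 1; rewrite ?oner_eq0 // -/(scl 1 L) scl1. Qed.

Lemma exists_max_entry (A : 'M[F]_N) : A \in unitmx ->
  exists i j, A i j != 0 /\ forall k l, fabs (A k l) <= fabs (A i j).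
Proof.
move=> Au; pose i0 := Ordinal N_gt0.
have [[i j] _ /= ijmax] := @Order.TotalTheory.arg_maxP _ R _ (i0, i0) xpredT
  (fun ij => fabs (A ij.1 ij.2)) isT.
exists i, j; have max k l : fabs (A k l) <= fabs (A i j) by apply: (ijmax (k, l)).
split=> //; apply: contraTneq Au => Aij.
have -> : A = 0.
  apply/matrixP => k l; rewrite mxE; apply/eqP; rewrite -fabs_eq0b.
  by rewrite eq_le fabs_ge0 andbT (le_trans (max k l)) // Aij fabs0.
apply/negP => /mulmxV; rewrite mul0mx => /matrixP /(_ i0 i0) /eqP.
by rewrite !mxE eqxx eq_sym oner_eq0.
Qed.

(** A basis divided by its largest entry is integral and keeps an entry equal to 1. *)
Lemma normal_representative x : vertices x -> exists M, x M /\ normal M.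
Proof.
move=> [L [A Au LA] xL]; have [i [j [Aij max]]] := exists_max_entry Au.
have lL : lattice L by exists A.
pose c := (A i j)^-1; have c0 : c != 0 by rewrite invr_eq0.
exists (scl c L); split; first by rewrite xL; exists c.
have E : scl c L = lat (c *: A) by rewrite LA -[X in scl c X]/(lat A) scl_lat.
split; first exact: lattice_scl.
- rewrite E => _ [u iu <-]; apply: integral_mulmx iu => k l.
  rewrite mxE fabsM fabsV mulrC ler_pdivrMr ?mul1r ?max //.
  by rewrite fabs_gt0.
exists (col j (c *: A)), i; split; first by rewrite E; exact: lat_col.
by rewrite !mxE /c mulVf // fabs1.
Qed.

Lemma normal_lattice L : normal L -> lattice L. Proof. by case. Qed.

Lemma normal_scl_le c M : normal M -> normal (scl c M) -> fabs c <= 1.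
Proof.
move=> [lM _ [u [i [Mu ui]]]] [_ cM _].
have /cM /(_ i) : scl c M (c *: u) by exists u.
by rewrite mxE fabsM ui mulr1.
Qed.

Lemma normal_unique x M M' : vertices x -> x M -> x M' -> normal M -> normal M' -> M = M'.
Proof.
move=> vx xM; have [lM ->] := vertex_mem vx xM.
move=> [c c0 ->] nM nM'; rewrite -/(scl c M) in nM' *.
have c1 := normal_scl_le nM nM'.
have c1' : fabs c^-1 <= 1 by apply: (normal_scl_le nM'); rewrite sclA mulVf // scl1.
have oM := lattice_omodule lM.
rewrite -[LHS]scl1; apply: scl_eq => //; apply/eqP; rewrite fabs1 eq_le c1 andbT.
by move: c1'; rewrite fabsV invf_le1 // fabs_gt0.
Qed.

Definition nrm x : set 'cV[F]_N := xget set0 [set M | x M /\ normal M].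

Lemma nrmP x : vertices x -> x (nrm x) /\ normal (nrm x).
Proof.
move=> /normal_representative [M xM]; rewrite /nrm.
by case: xgetP => [M' _ //|/(_ M)].
Qed.

Lemma nrm_mem x : vertices x -> x (nrm x). Proof. by case/nrmP. Qed.
Lemma nrm_normal x : vertices x -> normal (nrm x). Proof. by case/nrmP. Qed.
Lemma nrm_lattice x : vertices x -> lattice (nrm x).
Proof. by move=> /nrm_normal []. Qed.
Lemma nrm_omodule x : vertices x -> omodule (nrm x).
Proof. by move=> /nrm_lattice /lattice_omodule. Qed.

Lemma nrm_classE x : vertices x -> x = homothety_class (nrm x).
Proof. by move=> vx; have [_] := vertex_mem vx (nrm_mem vx). Qed.

Lemma nrm_mult x L : vertices x -> x L -> exists2 c, c != 0 & L = scl c (nrm x).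
Proof. by move=> vx xL; move: xL; rewrite [in x L](nrm_classE vx). Qed.

Lemma vertex_scl x L c : vertices x -> c != 0 -> x L -> x (scl c L).
Proof. by move=> vx c0 xL; have [_ ->] := vertex_mem vx xL; exists c. Qed.

Lemma nrm_inj x y : vertices x -> vertices y -> nrm x = nrm y -> x = y.
Proof. by move=> vx vy xy; rewrite (nrm_classE vx) xy -nrm_classE. Qed.

Lemma nrm_class L : normal L -> nrm (homothety_class L) = L.
Proof.
move=> nL; have vx := vertices_class (normal_lattice nL).
exact: (normal_unique vx (nrm_mem vx) (homothety_class_refl L) (nrm_normal vx) nL).
Qed.

Definition adjacent x y := forall L M, x L -> y M -> L `<=` M \/ M `<=` L.

Definition near_lattice X Y := X `<=` Y /\ scl pi Y `<=` X.

(** The alternative [X] inside pi [Y] is excluded, since [X] has a vector with a coordinate of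
    absolute value 1 while [Y] is integral. *)
Lemma normal_near X Y : normal X -> normal Y -> X `<=` Y ->
  scl pi Y `<=` X \/ X `<=` scl pi Y -> near_lattice X Y.
Proof.
move=> [lX _ [u [i [Xu ui]]]] [lY iY _] XY [piYX|/(_ u Xu) [v Yv vu]]; first by split.
move: ui; rewrite -vu mxE fabsM => /eqP; rewrite eq_sym eq_le => /andP[+ _].
move=> /le_trans /(_ (_ : _ <= fabs pi)).
by rewrite ler_piMr ?fabs_ge0 ?iY // leNgt pi1 => /(_ isT).
Qed.

Lemma adjacent_near x y : vertices x -> vertices y -> adjacent x y ->
  near_lattice (nrm x) (nrm y) \/ near_lattice (nrm y) (nrm x).
Proof.
move=> vx vy axy; have [[xX nX] [yY nY]] := (nrmP vx, nrmP vy).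
have [XY|YX] := axy _ _ xX yY; [left|right]; apply: normal_near => //.
  by have [] := axy _ _ xX (vertex_scl vy pi0 yY); [right|left].
by have [] := axy _ _ (vertex_scl vx pi0 xX) yY; [left|right].
Qed.

(** Discreteness of the absolute value: if |d| < |c|, then already |d| <= |c pi|. *)
Lemma near_comparable X Y c d : omodule X -> omodule Y -> c != 0 -> d != 0 ->
  near_lattice X Y -> scl c X `<=` scl d Y \/ scl d Y `<=` scl c X.
Proof.
move=> oX oY c0 d0 [XY YX]; have [cd|dc] := leP (fabs c) (fabs d).
  by left; apply: subset_trans (scl_le oY cd); apply: sclS.
right; have dc' : fabs d <= fabs (c * pi).
  have := fabs_pi_max piP (c := d / c); rewrite !fabsM fabsV ltr_pdivrMr ?fabs_gt0 // mul1r.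
  by move=> /(_ dc); rewrite ler_pdivrMr ?fabs_gt0 // mulrC.
apply: subset_trans (scl_le oY dc') _.
by rewrite -sclA; apply: sclS.
Qed.

Lemma near_adjacent x y : vertices x -> vertices y ->
  near_lattice (nrm x) (nrm y) \/ near_lattice (nrm y) (nrm x) -> adjacent x y.
Proof.
move=> vx vy xy L M /(nrm_mult vx) [c c0 ->] /(nrm_mult vy) [d d0 ->].
have [oX oY] := (nrm_omodule vx, nrm_omodule vy).
case: xy => n; first exact: near_comparable.
by case: (near_comparable oY oX d0 c0 n); [right|left].
Qed.

Lemma near_refl X : omodule X -> near_lattice X X.
Proof. by move=> oX; split=> //; apply: scl_pi_sub. Qed.

Lemma adjacent_refl x : vertices x -> adjacent x x.
Proof. by move=> vx; apply: near_adjacent => //; left; apply/near_refl/nrm_omodule. Qed.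

Lemma adjacent_sym x y : adjacent x y -> adjacent y x.
Proof. by move=> xy L M yL xM; case: (xy M L xM yL); [right|left]. Qed.

Lemma vol_sub_power L M : lattice L -> lattice M -> L `<=` M ->
  exists n, vol L = vol M * fabs pi ^+ n.
Proof.
move=> [A Au ->] [B Bu ->]; rewrite -!/(lat _) => AB.
have [X iX AX] := lat_sub Au Bu AB; rewrite !vol_lat //.
have dX0 : \det X != 0.
  by move: Au; rewrite AX unitmx_mul => /andP[_]; rewrite unitmxE unitfE.
have [n dn] := uniformizer_power piP dX0 (fabs_det_le iX).
by exists n; rewrite AX det_mulmx fabsM dn.
Qed.

Lemma pi_expI m n : fabs pi ^+ m = fabs pi ^+ n -> m = n.
Proof.
by apply: ieexprIn; rewrite ?fabs_pi_gt0 // lt_eqF.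
Qed.

(** The valuation of the determinant, a natural number for integral lattices ([rankE]); larger
    lattices have smaller rank. *)
Definition rank L : nat := xget 0%N [set n | vol L = fabs pi ^+ n].

Lemma integral_lattice : lattice (@integral_vectors R F N) /\
  vol (@integral_vectors R F N) = 1.
Proof.
have E : @integral_vectors R F N = lat 1%:M.
  apply/seteqP; split=> [u iu|_ [u iu <-]]; last by rewrite mul1mx.
  by exists u; rewrite ?mul1mx.
rewrite E vol_lat ?unitmx1 // det1 fabs1; split=> //.
by apply: lattice_lat; rewrite unitmx1.
Qed.

Lemma rankE L : lattice L -> L `<=` @integral_vectors R F N -> vol L = fabs pi ^+ rank L.
Proof.
move=> lL iL; have [lO vO] := integral_lattice.
have [n] := vol_sub_power lL lO iL; rewrite vO mul1r => vn.
by rewrite /rank; case: xgetP => [m _ //|/(_ n)].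
Qed.

Lemma rank_lt L M : lattice L -> lattice M -> M `<=` @integral_vectors R F N ->
  L `<=` M -> L <> M -> (rank M < rank L)%N.
Proof.
move=> lL lM iM LM nLM; have vLM := vol_le lL lM LM.
rewrite ltnNge; apply/negP => rLM; apply: nLM; apply: vol_eq => //.
apply/eqP; rewrite eq_le vLM /= !rankE //; last exact: subset_trans iM.
by rewrite ler_wiXn2l ?fabs_ge0 // ltW.
Qed.

Lemma scl_pi_neq L : lattice L -> scl pi L <> L.
Proof.
move=> lL E; have := vol_gt0 lL; have := vol_scl pi0 lL; rewrite E => vE v0.
move/eqP: vE; rewrite -[X in X == _]mul1r (inj_eq (mulIf (lt0r_neq0 v0))) eq_sym.
by rewrite lt_eqF // exprn_ilt1 ?fabs_ge0 // -lt0n.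
Qed.

Definition vrank x := rank (nrm x).

Lemma near_rank x y : vertices x -> vertices y ->
  near_lattice (nrm x) (nrm y) -> (vrank y <= vrank x)%N.
Proof.
move=> vx vy [XY _]; have [nX nY] := (nrm_normal vx, nrm_normal vy).
have [E|nE] := pselect (nrm x = nrm y); first by rewrite /vrank E.
by apply/ltnW/rank_lt; case: nX nY => // ? ? _ [].
Qed.

Lemma adjacent_rank x y : vertices x -> vertices y -> adjacent x y ->
  vrank x = vrank y -> x = y.
Proof.
move=> vx vy axy rxy; apply: nrm_inj => //.
have [nX nY] := (nrm_normal vx, nrm_normal vy).
have [[XY _]|[YX _]] := adjacent_near vx vy axy.
  apply: contrapT => ne; have : (vrank y < vrank x)%N.
    by apply: rank_lt; case: nX nY => // ? ? _ [].
  by rewrite rxy ltnn.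
apply: contrapT => ne; have : (vrank x < vrank y)%N.
  by apply: rank_lt => //; [case: nY|case: nX|case: nX|move=> E; apply: ne].
by rewrite rxy ltnn.
Qed.

Lemma adjacent_near_lt x y : vertices x -> vertices y -> adjacent x y ->
  (vrank y < vrank x)%N -> near_lattice (nrm x) (nrm y).
Proof.
move=> vx vy axy ryx; have [//|/(near_rank vy vx)] := adjacent_near vx vy axy.
by rewrite leqNgt ryx.
Qed.

Lemma adjacent_near_le x y : vertices x -> vertices y -> adjacent x y ->
  (vrank y <= vrank x)%N -> near_lattice (nrm x) (nrm y).
Proof.
move=> vx vy axy; rewrite leq_eqVlt => /orP[/eqP E|]; last exact: adjacent_near_lt.
by rewrite (adjacent_rank vy vx (adjacent_sym axy) E); apply/near_refl/nrm_omodule.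
Qed.

(** Multiplication by pi adds N to the rank, and pi [nrm y] is strictly inside [nrm x], which is not
    contained in pi O^N. This is the source of the dimension N - 1. *)
Lemma vrank_gap x y : vertices x -> vertices y -> adjacent x y ->
  (vrank x < vrank y + N)%N.
Proof.
move=> vx vy axy; have [nX nY] := (nrm_normal vx, nrm_normal vy).
have [yx|xy] := leqP (vrank y) (vrank x); last by rewrite ltn_addr.
have [XY piYX] := adjacent_near_le vx vy axy yx.
have [lX iX _] := nX; have [lY iY [u [i [Yu ui]]]] := nY.
have lP := lattice_scl pi0 lY.
have -> : (vrank y + N)%N = rank (scl pi (nrm y)).
  apply: pi_expI; rewrite -rankE //; last exact: subset_trans iX.
  by rewrite vol_scl // (rankE lY iY) exprD mulrC.
apply: rank_lt => // E; have [_ _ [w [j [Xw wj]]]] := nX.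
move: Xw; rewrite -E => -[v Yv vw]; move: wj; rewrite -vw mxE fabsM => /eqP.
rewrite lt_eqF // (le_lt_trans _ pi1) // ler_piMr ?fabs_ge0 //; exact: iY.
Qed.

(* The lattice J lies on the geodesic from K to K + K'. *)
Lemma hull_lattice K K' : normal K -> normal K' -> K <> K' -> (rank K' <= rank K)%N ->
  let S := lsum K K' in let J := S `&` scl pi^-1 K in
  [/\ normal S, normal J, near_lattice K J & K <> J].
Proof.
move=> [lK iK [u [i [Ku ui]]]] [lK' iK' _] nKK' rKK' S J.
have [oK oK'] := (lattice_omodule lK, lattice_omodule lK').
have pV0 : pi^-1 != 0 by rewrite invr_eq0.
have lS : lattice S by apply: (lattice_lsum piP).
have lJ : lattice J by apply: (latticeI piP) => //; apply: lattice_scl.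
have KS : K `<=` S by apply: lsuml.
have iS : S `<=` @integral_vectors R F N.
  by apply: lsum_sub => //; exact: integral_vectors_omodule.
have KJ : K `<=` J.
  move=> v Kv; split; first exact: KS.
  by apply/(sclE _ _ pV0); rewrite invrK; apply: omoduleZ => //; apply: ltW.
split.
- by split=> //; exists u, i; split=> //; apply: KS.
- split=> //; first by move=> v [/iS].
  by exists u, i; split=> //; apply: KJ.
- split=> // _ [v [_ Kv] <-]; move/(sclE _ _ pV0): Kv; by rewrite invrK.
(* If J = K, a vector of S whose multiple by pi lies in K lies itself in K. Descent then puts K'
   strictly inside K, against the inequality of ranks. *)
move=> KJE; have K'K : K' `<=` K.
  move=> v K'v; apply: (lattice_descent piP lK) => n Kn.
  rewrite KJE; split.
    apply: (omoduleZ (lattice_omodule lS)); first exact: fabs_pi_exp_le1.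
    exact: lsumr K'v.
  by apply/(sclE _ _ pV0); rewrite invrK scalerA -exprS.
have : (rank K < rank K')%N by apply: rank_lt => //; move=> E; apply: nKK'.
by rewrite ltnNge rKK'.
Qed.

End Vertices.

(** * The pro-unipotent radical of a simplex and the congruence groups of its vertices *)

Section Radical.
Variables (R : realType) (F : nonArchFieldType R) (N : nat) (pi : F).
Hypothesis piP : uniformizer pi.
Hypothesis N_gt0 : (0 < N)%N.
Local Notation vtx := (set (set 'cV[F]_N)).
Implicit Types (L M K X Y Z J : set 'cV[F]_N) (x y z : vtx) (g h : GL F N).
Implicit Types (s : set vtx).

Let pi0 : pi != 0 := pi_neq0 piP.
Let pi1 : fabs pi < 1 := fabs_pi_lt1 piP.

Lemma congruence_scl c L g : congruence pi L g -> congruence pi (scl c L) g.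
Proof.
move=> Lg _ [u Lu <-]; rewrite sclA mulrC -sclA -scalemxAr -scalerBr.
by exists (g *m u - u) => //; apply: Lg.
Qed.

Lemma stabilizes_act L g : stabilizes L g -> lattice_act g L = L.
Proof.
move=> Lg; apply/seteqP; split=> [_ [u Lu <-]|u Lu]; first exact: stabilizes_in Lu.
exists (g^-1%g *m u); last exact: mulGLVK.
by apply: stabilizes_in Lu; apply: stabilizesV.
Qed.

Definition vertex_congruence x : set (GL F N) := congruence pi (nrm x).

Lemma vertex_congruence_stabilizes x y L g : vertices x -> vertices y ->
  adjacent x y -> vertex_congruence x g -> y L -> stabilizes L g.
Proof.
move=> vx vy axy xg /(nrm_mult N_gt0 vy) [c c0 ->]; apply: stabilizes_scl => //.
have [lX lY] := (nrm_lattice N_gt0 vx, nrm_lattice N_gt0 vy).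
have [[XY YX]|[YX XY]] := adjacent_near piP N_gt0 vx vy axy.
  exact: (congruence_adj_stabilizes' piP lX).
exact: (congruence_adj_stabilizes piP lX).
Qed.

Lemma simplex_adjacent s x y : simplex s -> s x -> s y -> adjacent x y.
Proof. by move=> [_ _ _ tot] sx sy L M xL yM; apply: tot; [exists x|exists y]. Qed.

Lemma simplex_vertex s x : simplex s -> s x -> vertices x.
Proof. by move=> [_ _ sv _] /sv. Qed.

Lemma vertex_mult x L M : vertices x -> x L -> x M -> exists2 c, c != 0 & M = scl c L.
Proof.
by move=> vx xL xM; have [_ xE] := vertex_mem vx xL; move: xM; rewrite xE.
Qed.

Lemma vertex_mem_lattice x L : vertices x -> x L -> lattice L.
Proof. by move=> vx /(vertex_mem vx) []. Qed.

Lemma proper_mult x L M : vertices x -> x L -> x M -> M `<` L -> M `<=` scl pi L.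
Proof.
move=> vx xL xM [ML nLM]; have [c c0 ME] := vertex_mult vx xL xM.
have oL := lattice_omodule (vertex_mem_lattice vx xL).
rewrite ME; apply: scl_le => //; apply: (fabs_pi_max piP); rewrite ltNge.
apply/negP => c1; apply: nLM; rewrite ME -{1}(scl1 L); apply: scl_le => //.
by rewrite fabs1.
Qed.

Lemma scl_pi_proper L : lattice L -> scl pi L `<` L.
Proof.
move=> lL; have oL := lattice_omodule lL; split; first exact: scl_pi_sub.
by move=> sub; apply: (scl_pi_neq piP N_gt0 lL); apply/seteqP; split=> //; apply: scl_pi_sub.
Qed.

(** For consecutive lattices [L], [M] of the chain some lattice X' of the class [x] satisfies pi X'
    <= M and L <= X'; then (g - 1) L lies in (g - 1) X', hence in pi X', hence in [M]. *)
Lemma vertex_congruence_radical s x g : simplex s -> s x -> vertex_congruence x g ->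
  pro_unipotent_radical s g.
Proof.
move=> ss sx xg; have vx := simplex_vertex ss sx.
have [xX nX] := nrmP N_gt0 vx; have lX := normal_lattice nX.
split=> [L [y sy yL]|L M [sL sM [ML nLM] next] u Lu].
  apply: stabilizes_act; apply: (vertex_congruence_stabilizes vx _ _ xg yL).
    exact: simplex_vertex sy.
  exact: simplex_adjacent sx sy.
have tot : forall L M, lattices_of s L -> lattices_of s M -> L `<=` M \/ M `<=` L.
  by case: ss.
have lat_s L' : lattices_of s L' -> lattice L'.
  by move=> [y sy]; apply: vertex_mem_lattice; apply: simplex_vertex sy.
have [oL oM] := (lattice_omodule (lat_s _ sL), lattice_omodule (lat_s _ sM)).
suff [X' [xX' LX' X'M]] : exists X', [/\ x X', L `<=` X' & scl pi X' `<=` M].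
  apply: X'M; have [c c0 XE] := nrm_mult N_gt0 vx xX'; rewrite XE in LX' *.
  apply: congruence_scl => //.
  exact: LX'.
have [X1 [xX1 LX1 piL]] : exists X', [/\ x X', L `<=` X' & scl pi X' `<=` L].
  have [y sy yL] := sL; have vy := simplex_vertex ss sy.
  have [d d0 ->] := nrm_mult N_gt0 vy yL.
  have [[XY YX]|[YX XY]] := adjacent_near piP N_gt0 vx vy (simplex_adjacent ss sx sy).
    exists (scl (d / pi) (nrm x)); split.
    - by apply: vertex_scl => //; rewrite mulf_neq0 // invr_eq0.
    - rewrite -sclA; apply: sclS; move=> v Yv; apply/sclE; rewrite ?invr_eq0 //.
      by rewrite invrK; apply: YX; exists v.
    by rewrite sclA mulrC divfK //; apply: sclS.
  exists (scl d (nrm x)); split; first exact: vertex_scl.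
    exact: sclS.
  by rewrite sclA mulrC -sclA; apply: sclS.
have oX1 := lattice_omodule (vertex_mem_lattice vx xX1).
have spi : lattices_of s (scl pi X1) by exists x => //; apply: vertex_scl.
(* pi X1 is itself in the chain and below [L]. If it is not below [M], consecutiveness makes it [M]
   or [L]; in the last case [L] belongs to the class [x] and serves as X'. *)
have [MpiX|piXM] := tot _ _ sM spi; last by exists X1.
have [piXE|piXE] := next _ spi MpiX piL; first by exists X1; split; rewrite // piXE.
have xL : x L by rewrite -piXE; apply: vertex_scl.
exists L; split=> //.
have spiL : lattices_of s (scl pi L) by exists x => //; apply: vertex_scl.
have [MpiL|//] := tot _ _ sM spiL.
have [<-//|piLE] := next _ spiL MpiL (scl_pi_sub piP oL).
by case: (scl_pi_neq piP N_gt0 (lat_s _ sL)).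
Qed.

(** Unlike in the radical, [M] need not be the next lattice and may depend on [u]. This weaker form
    is what can be re-established after a vertex has been removed. *)
Definition moves_down s g := forall L u, lattices_of s L -> L u ->
  exists M, [/\ lattices_of s M, M `<` L & M (g *m u - u)].

(** A next lattice exists below [L]: volumes are discrete, pi [L] is a candidate, and a proper
    sublattice in the chain of largest volume is next. *)
Lemma radical_moves_down s g : simplex s -> pro_unipotent_radical s g -> moves_down s g.
Proof.
move=> ss [_ gd] L u sL Lu; have [y sy yL] := sL.
have tot : forall L M, lattices_of s L -> lattices_of s M -> L `<=` M \/ M `<=` L.
  by case: ss.
have lat_s L' : lattices_of s L' -> lattice L'.
  by move=> [z sz]; apply: vertex_mem_lattice; apply: simplex_vertex sz.
have lL := lat_s _ sL.
pose P n := `[< exists M, [/\ lattices_of s M, M `<` L & vol M = vol L * fabs pi ^+ n] >].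
have PE M : lattices_of s M -> M `<` L -> exists2 n, P n & vol M = vol L * fabs pi ^+ n.
  move=> sM ML; have [n vn] := vol_sub_power piP (lat_s _ sM) lL (properW ML).
  by exists n => //; apply/asboolP; exists M.
have exP : exists n, P n.
  have [|n Pn _] := PE _ _ (scl_pi_proper lL); last by exists n.
  by exists y => //; apply: vertex_scl => //; apply: simplex_vertex sy.
case: (ex_minnP exP) => n /asboolP [M [sM ML vM]] nmin.
exists M; split=> //; apply: gd Lu; split=> // L' sL' ML' L'L.
have [LL'|nLL'] := pselect (L `<=` L'); first by right; apply/seteqP.
have [m Pm vm] := PE L' sL' (conj L'L nLL'); left; apply/esym.
apply: vol_eq (ML') _; [exact: lat_s|exact: lat_s|apply/eqP].
rewrite eq_le vol_le //=; [|exact: lat_s|exact: lat_s].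
by rewrite vm vM ler_pM2l ?vol_gt0 // ler_wiXn2l ?fabs_ge0 ?nmin // ltW.
Qed.

Lemma exists_min_rank (T : eqType) (t : seq T) (f : T -> nat) : t != [::] ->
  exists2 x : T, x \in t & forall y : T, y \in t -> (f x <= f y)%N.
Proof.
elim: t => // a [|b t] IH _.
  by exists a; rewrite ?mem_head // => y; rewrite inE => /eqP ->.
have [x xt xmin] := IH isT; have [ax|xa] := leqP (f a) (f x).
  exists a; rewrite ?mem_head // => y; rewrite inE => /orP[/eqP->//|/xmin].
  exact: leq_trans.
exists x; first by rewrite inE xt orbT.
by move=> y; rewrite inE => /orP[/eqP->|/xmin//]; apply: ltnW.
Qed.

Lemma exists_max_rank (T : eqType) (t : seq T) (f : T -> nat) : t != [::] ->
  exists2 x : T, x \in t & forall y : T, y \in t -> (f y <= f x)%N.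
Proof.
elim: t => // a [|b t] IH _.
  by exists a; rewrite ?mem_head // => y; rewrite inE => /eqP ->.
have [x xt xmax] := IH isT; have [ax|xa] := leqP (f x) (f a).
  exists a; rewrite ?mem_head // => y; rewrite inE => /orP[/eqP->//|/xmax yx].
  exact: leq_trans ax.
exists x; first by rewrite inE xt orbT.
by move=> y; rewrite inE => /orP[/eqP->|/xmax//]; apply: ltnW.
Qed.

(* With M0 the largest and M1 the smallest normalized lattice of the simplex, s a
   projector of M0 onto M1 modulo pi M0, and b = (g - 1) s, the element 1 + b lies
   in the congruence group of M0, and (1 + b)^-1 g moves down the remaining chain. *)
Lemma radical_generated (P : set (GL F N)) (t : seq vtx) g :
  t != [::] -> uniq t -> (forall x, x \in t -> vertices x) ->
  (forall x y, x \in t -> y \in t -> adjacent x y) ->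
  (forall g h, P g -> P h -> P (g * h)%g) ->
  (forall x, x \in t -> vertex_congruence x `<=` P) ->
  moves_down [set` t] g -> P g.
Proof.
move: {2}(size t) (leqnn (size t)) => n; elim: n t g => [|n IHn] t g.
  by rewrite leqn0 size_eq0 => /eqP ->.
move=> tn t0 ut vt at_ PM tP gd.
have [x xt xmin] := exists_min_rank (vrank pi) t0.
have [y yt ymax] := exists_max_rank (vrank pi) t0.
have [vx vy] := (vt x xt, vt y yt).
have [[xX nX] [yY nY]] := (nrmP N_gt0 vx, nrmP N_gt0 vy).
have [[lX _ _] [lY _ _]] := (nX, nY).
have [oX oY] := (lattice_omodule lX, lattice_omodule lY).
have sx L : x L -> lattices_of [set` t] L by exists x.
have nearX z : z \in t -> near_lattice pi (nrm z) (nrm x).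
  by move=> zt; apply: adjacent_near_le => //; [exact: vt|exact: at_|exact: xmin].
have nearY z : z \in t -> near_lattice pi (nrm y) (nrm z).
  by move=> zt; apply: adjacent_near_le => //; [exact: vt|exact: at_|exact: ymax].
have [s [sX sY]] := lattice_projector piP lX lY (proj1 (nearX y yt)).
pose a : 'M[F]_N := GL_mx g - 1%:M.
have aE u : a *m u = g *m u - u by rewrite mulmxBl mul1mx.
(* [a] moves the smallest lattice into some c Z strictly inside it. As Z contains the smallest
   lattice, |c| < 1, so c Z lies in pi Z and hence in pi times the largest lattice. *)
have aY u : nrm y u -> scl pi (nrm x) (a *m u).
  move=> Yu; have [|M [[z zt zM] MY]] := gd (nrm y) u _ Yu; first by exists y.
  rewrite -aE; have [c c0 ME] := nrm_mult N_gt0 (vt z zt) zM.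
  have oZ := nrm_omodule N_gt0 (vt z zt).
  have [YZ _] := nearY z zt; have [ZX _] := nearX z zt.
  rewrite ME in MY * => Mau.
  have c1 : fabs c < 1.
    rewrite ltNge; apply/negP => c1; have [_] := MY; apply.
    apply: subset_trans YZ _; rewrite -{1}(scl1 (nrm z)); apply: scl_le => //.
    by rewrite fabs1.
  by apply: (sclS ZX); apply: (scl_le oZ (fabs_pi_max piP c1)).
have bX u : nrm x u -> scl pi (nrm x) (a *m s *m u).
  by move=> Xu; rewrite -mulmxA; apply/aY/sX.
have [al [alE alX]] := exists_congruence piP lX bX.
have Pal : P al by apply: tP alX.
have [n0|n0] := eqVneq n 0%N.
  have tx : t = [:: x].
    move: tn xt; rewrite n0; case: (t) => [|z [|? ?]] //= _.
    by rewrite inE => /eqP ->.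
  apply: (tP x xt) => u Xu; have [|M [[z + zM] MX Mu]] := gd (nrm x) u _ Xu.
    exact: sx.
  rewrite /= tx inE => /eqP zx; rewrite zx in zM.
  exact: (proper_mult vx xX zM MX).
have [t1|t1] := eqVneq (rem x t) [::].
  have tx : t = [:: x].
    by apply: perm_small_eq; rewrite ?size_rem // (perm_trans (perm_to_rem xt)) ?t1.
  apply: (tP x xt) => u Xu; have [|M [[z + zM] MX Mu]] := gd (nrm x) u _ Xu.
    exact: sx.
  rewrite /= tx inE => /eqP zx; rewrite zx in zM.
  exact: (proper_mult vx xX zM MX).
rewrite -(mulKVg al g); apply: (PM) => //.
have remt z : z \in rem x t -> z \in t by apply: mem_rem.
apply: (IHn (rem x t)) => //; rewrite ?rem_uniq ?size_rem //.
- by rewrite -ltnS prednK // lt0n size_eq0.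
- by move=> z /remt /vt.
- by move=> z z' /remt zt /remt; apply: at_.
- by move=> z /remt; apply: tP.
have stab L : lattices_of [set` t] L -> stabilizes L al.
  move=> [z zt zL]; apply: (vertex_congruence_stabilizes vx (vt z zt) _ alX zL).
  exact: at_.
have subt L : lattices_of [set` rem x t] L -> lattices_of [set` t] L.
  by move=> [z zt zL]; exists z => //; apply: remt.
have yr : y \in rem x t.
  rewrite mem_rem_uniq // inE yt andbT; apply/eqP => yx.
  move/eqP: t1; apply; apply/eqP; rewrite -size_eq0 size_rem //.
  have all_x z : z \in t -> z = x.
    move=> zt; apply: (adjacent_rank piP N_gt0 (vt z zt) vx (at_ _ _ zt xt)).
    by apply/eqP; rewrite eqn_leq xmin // andbT -yx ymax.
  move: ut all_x; case: (t) => [|z1 [|z2 t']] //= /andP[nz _] all_x.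
  move: nz; rewrite (all_x z1) ?mem_head // (all_x z2) ?mem_head //.
  by rewrite inE mem_head orbT.
(* Since al^-1 g - 1 = al^-1 (g - 1) (1 - s) and al^-1 preserves the lattices of the chain, only (g
   - 1) (1 - s) matters, and by homothety only on normalized lattices. *)
suff key z : z \in rem x t -> forall u, nrm z u ->
    exists M, [/\ lattices_of [set` rem x t] M, M `<` nrm z & M (a *m (u - s *m u))].
  move=> L u [z zr zL] Lu; have vz := vt z (remt z zr).
  have [c c0 LE] := nrm_mult N_gt0 vz zL; rewrite LE in Lu *.
  have Zu : nrm z (c^-1 *: u) by apply/(sclE _ _ c0).
  have [M [sM MZ Mau]] := key z zr _ Zu.
  have sMc : lattices_of [set` rem x t] (scl c M).
    have [w wr wM] := sM; exists w => //.
    by apply: vertex_scl => //; apply/vt/remt.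
  exists (scl c M); split=> //.
    split; first exact: sclS (properW MZ).
    move=> sub; have [_] := MZ; apply => v Zv.
    have /sub : scl c (nrm z) (c *: v) by exists v.
    by move=> /(sclE _ _ c0); rewrite scalerA mulVf // scale1r.
  have -> : (al^-1 * g)%g *m u - u = al^-1%g *m (a *m (u - s *m u)).
    rewrite mulGLmx -[X in _ - X](mulGLKV al) -mulmxBr.
    rewrite (_ : g *m u - al *m u = a *m (u - s *m u)) //.
    by rewrite mulmxBr mulmxA aE alE mulmxDl mul1mx opprD addrA.
  apply: stabilizes_in; first exact/stabilizesV/stab/subt.
  apply/(sclE _ _ c0); move: Mau.
  by rewrite -!scalemxAr -scalerBr -scalemxAr.
move=> zr u Zu; have zt := remt z zr; have vz := vt z zt.
have [[ZX piXZ] [YZ piZY]] := (nearX z zt, nearY z zt).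
have lZ := nrm_lattice N_gt0 vz; have oZ := lattice_omodule lZ.
have Zsu : nrm z (u - s *m u) by apply: omoduleB => //; apply/YZ/sX/ZX.
have zx : z != x by move: zr; rewrite mem_rem_uniq // inE => /andP[].
have ZXn : ~ nrm x `<=` nrm z.
  by move=> XZ; case/eqP: zx; apply: (nrm_inj N_gt0) => //; apply/seteqP.
(* For z other than y the lattice given by [moves_down] works unless it is in the removed class [x];
   then it is inside pi [nrm x], hence inside [nrm y], which takes its place. *)
have [zy|zy] := eqVneq z y; last first.
  have [|M [[w wt wM] MZ]] := gd (nrm z) _ _ Zsu; first by exists z => //; apply: nrm_mem.
  rewrite -aE => Mau; have [wx|wx] := eqVneq w x; last first.
    exists M; split=> //; exists w => //=.
    by rewrite mem_rem_uniq // inE wx.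
  exists (nrm y); split.
  - by exists y => //; apply: nrm_mem.
  - split=> // ZY; case/eqP: zy; apply: (nrm_inj N_gt0) => //.
    by apply/seteqP.
  rewrite wx in wM; have [piXY] := nearX y yt; apply.
  apply: (proper_mult vx xX wM) Mau.
  split; first exact: subset_trans (properW MZ) ZX.
  by move=> XM; case: MZ => MZ; apply; apply: subset_trans ZX XM.
(* On the smallest lattice, 1 - s has values in pi [nrm x], so [moves_down] is applied to [nrm x]
   and the result multiplied by pi; if that lattice is again in the class [x], pi [nrm y] replaces
   it. *)
have [v Xv vu] : scl pi (nrm x) (u - s *m u) by apply: sY; rewrite -zy.
rewrite -vu -scalemxAr.
have [|M [[w wt wM] MX]] := gd (nrm x) v _ Xv; first exact: sx.
rewrite -aE => Mav.
have piMY : scl pi M `<=` nrm y.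
  have [_ piXY] := nearX y yt; apply: subset_trans piXY; exact: sclS (properW MX).
have [wx|wx] := eqVneq w x; last first.
  exists (scl pi M); split; last by exists (a *m v).
    exists w; first by rewrite /= mem_rem_uniq // inE wx.
    by apply: vertex_scl => //; apply: vt.
  rewrite zy; split=> // YM; have [_] := MX; apply.
  have [_ piXY] := nearX y yt => w' Xw'.
  have /YM/(sclE _ _ pi0) : nrm y (pi *: w') by apply: piXY; exists w'.
  by rewrite scalerA mulVf // scale1r.
rewrite wx in wM; have := proper_mult vx xX wM MX => MpiX.
exists (scl pi (nrm y)); split.
- by exists y => //; apply: vertex_scl => //; apply: nrm_mem.
- by rewrite zy; apply: scl_pi_proper.
have [_ piXY] := nearX y yt.
exists (a *m v) => //; apply/piXY/MpiX/Mav.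
Qed.

End Radical.

(** * The commuting projectors of the vertices and their hull property *)

Section Projectors.
Variables (R : realType) (F : nonArchFieldType R) (N : nat) (pi : F).
Variables (V : lmodType R[i]) (rho : GL F N -> V -> V).
Hypothesis piP : uniformizer pi.
Hypothesis N_gt0 : (0 < N)%N.
Hypothesis lc : locally_compact [set: F].
Hypothesis rho_smooth : smooth_representation [set: V] rho.
Local Notation vtx := (set (set 'cV[F]_N)).
Implicit Types (L M J : set 'cV[F]_N) (H K S : set (GL F N)) (x y : vtx) (g h : GL F N) (v : V).

Let pi0 : pi != 0 := pi_neq0 piP.

Lemma stabilizer_ball v : exists2 r : R, 0 < r &
  forall h, entries_le (GL_mx h - 1%:M) r -> rho h v = v.
Proof.
apply: (GL_open_ball1 (O := [set g | rho g v = v])).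
  exact: (smooth_stabilizer rho_smooth).
exact: (rho1 rho_smooth).
Qed.

(** By smoothness the stabilizer of [v] contains a ball about 1, so [rho g v] depends only on which
    of finitely many classes contains [g]. *)
Lemma congruence_compact L : lattice L -> compact_group rho (congruence pi L).
Proof.
move=> lL; split.
- exact: congruence1.
- by move=> g h; apply: congruenceM.
- by move=> g; apply: congruenceV.
move=> v; have [r r0 rP] := stabilizer_ball v.
have [I [cls clsP]] := congruence_finite_cosets piP lc lL r0.
pose val_ i : V := xget 0 [set u | exists g, [/\ congruence pi L g, cls g = i & u = rho g v]].
apply: (@sub_finite_set _ _ (val_ @` [set: I])); last first.
  exact/finite_image/finite_finset.
move=> _ [g Lg <-]; exists (cls g) => //.
rewrite /val_; case: xgetP => [_ _ [h [Lh hg ->]]|/(_ (rho g v))]; last by case; exists g.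
have := rP _ (clsP _ _ Lg Lh (esym hg)).
by rewrite rhoM // => /(congr1 (rho g)); rewrite rhoVK.
Qed.

(** [H] normalizes [K], so each [rho h] commutes with the average over [K]. *)
Lemma avgC H K v : compact_group rho H -> compact_group rho K ->
  (forall h k, H h -> K k -> K (h^-1 * k * h)%g) ->
  avg rho H (avg rho K v) = avg rho K (avg rho H v).
Proof.
move=> cH cK HK.
have conj h w : H h -> avg rho K (rho h w) = rho h (avg rho K w).
  move=> Hh; apply: avg_conj => // k Kk; first exact: HK.
  by have := HK h^-1%g k (cgroupV cH Hh) Kk; rewrite invgK.
rewrite -[RHS](avg_id rho_smooth cH) => [|h Hh]; last first.
  by rewrite -conj // avg_fixed.
apply/esym; apply: (avg_morph rho_smooth cH (f := fun w => avg rho H (avg rho K w))).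
- by move=> u w; rewrite !avgD.
- by move=> a u; rewrite !avgZ.
by move=> h Hh; rewrite conj // avg_act.
Qed.

(** For g = a b, the average over [H] of g v is that of a v, hence that of v: it is constant on the
    [K]-orbit of [v]. *)
Lemma avg_absorb H K S v : compact_group rho H -> compact_group rho K ->
  (forall g, K g -> exists a b, [/\ H a, S b & g = (a * b)%g]) ->
  (forall b, S b -> rho b v = v) -> avg rho H (avg rho K v) = avg rho H v.
Proof.
move=> cH cK KHS Sv; apply: (avg_morph rho_smooth cK (f := avg rho H)).
- by move=> u w; rewrite avgD.
- by move=> a u; rewrite avgZ.
by move=> g /KHS [a [b [Ha Sb ->]]]; rewrite rhoM // (Sv b) // avg_act.
Qed.

(* The value on non-vertices is irrelevant; it only has to be additive. *)
Definition projector x v : V :=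
  if `[< vertices x >] then avg rho (vertex_congruence pi x) v else v.

Lemma projectorE x v : vertices x -> projector x v = avg rho (vertex_congruence pi x) v.
Proof. by move=> vx; rewrite /projector asboolT. Qed.

Lemma vertex_compact x : vertices x -> compact_group rho (vertex_congruence pi x).
Proof. by move=> vx; apply: congruence_compact; apply: nrm_lattice. Qed.

Lemma projector_idP x v : vertices x ->
  projector x v = v <-> forall g, vertex_congruence pi x g -> rho g v = v.
Proof.
move=> vx; have cx := vertex_compact vx; rewrite projectorE //.
by split=> [<- g xg|]; [exact: avg_fixed|exact: avg_id].
Qed.

Lemma projector_idem x v : vertices x -> projector x (projector x v) = projector x v.
Proof.
move=> vx; apply/projector_idP => // g xg; rewrite projectorE //.
by apply: avg_fixed => //; apply: vertex_compact.
Qed.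

Lemma projectorC x y v : vertices x -> vertices y -> adjacent x y ->
  projector x (projector y v) = projector y (projector x v).
Proof.
move=> vx vy axy; rewrite !projectorE //; apply: avgC; [exact: vertex_compact|exact: vertex_compact|].
move=> h k xh yk; apply: congruence_conj => //.
apply: (vertex_congruence_stabilizes piP N_gt0 vx vy axy xh).
exact: nrm_mem.
Qed.

Lemma projectorD x v w : projector x (v + w) = projector x v + projector x w.
Proof.
rewrite /projector; case: asboolP => // vx.
by apply: avgD => //; apply: vertex_compact.
Qed.

(** With S = X + Y and J = S /\ pi^-1 X, the factorization of the group of J gives e_x e_J e_S v =
    e_x e_S v, and that of the group of S gives e_x e_S v = e_x v. The witness v' is e_S v; it stays
    fixed by [tau] because S, though perhaps not adjacent to x, is adjacent to [tau]. *)
Lemma projector_hull (tau : seq vtx) (x y : vtx) v :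
  (forall z, z \in tau -> vertices z) ->
  vertices x -> vertices y -> x <> y -> (vrank pi y <= vrank pi x)%N ->
  above (@adjacent R F N) (vrank pi) tau x -> above (@adjacent R F N) (vrank pi) tau y ->
  fixes projector (y :: tau) v ->
  exists z v', [/\ vertices z /\ adjacent z x, (vrank pi z < vrank pi x)%N,
    (forall t, t \in tau -> adjacent z t), fixes projector tau v' &
    projector x v = projector x (projector z v')].
Proof.
move=> vtau vx vy xy ryx ax ay fv.
have [nX nY] := (nrm_normal N_gt0 vx, nrm_normal N_gt0 vy).
have nXY : nrm x <> nrm y by move=> E; apply: xy; apply: (nrm_inj N_gt0).
have [] := hull_lattice piP nX nY nXY ryx.
set Y1 := lsum _ _; set J := _ `&` _ => nS nJ XJ XneJ.
have [[lX iX _] [lY _ _] [lS _ _] [lJ iJ _]] := And4 nX nY nS nJ.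
have [oX oY] := (lattice_omodule lX, lattice_omodule lY).
pose zS := homothety_class Y1; pose zJ := homothety_class J.
have [vS vJ] : vertices zS /\ vertices zJ by split; apply: vertices_class.
have [nrmS nrmJ] := (nrm_class N_gt0 nS, nrm_class N_gt0 nJ).
have nearS t : t \in tau -> near_lattice pi (nrm t) Y1.
  move=> tt; have vt := vtau t tt.
  have [[axt rxt] [ayt ryt]] := (ax t tt, ay t tt).
  have [TX piXT] := adjacent_near_lt piP N_gt0 vt vx (adjacent_sym axt) rxt.
  have [_ piYT] := adjacent_near_lt piP N_gt0 vt vy (adjacent_sym ayt) ryt.
  split; first by apply: subset_trans TX _; apply: lsuml.
  move=> _ [_ [u [w [Xu Yw ->]]] <-]; rewrite scalerDr.
  by apply: omoduleD; [exact: nrm_omodule|apply: piXT; exists u|apply: piYT; exists w].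
have nearJ t : t \in tau -> near_lattice pi (nrm t) J.
  move=> tt; have vt := vtau t tt; have [_ piST] := nearS t tt.
  have [axt rxt] := ax t tt.
  have [TX _] := adjacent_near_lt piP N_gt0 vt vx (adjacent_sym axt) rxt.
  split; first exact: subset_trans TX (proj1 XJ).
  by apply: subset_trans piST; apply: sclS => u [].
have adjS t : t \in tau -> adjacent zS t.
  move=> tt; apply: (near_adjacent piP N_gt0) => //; first exact: vtau.
  by right; rewrite nrmS; apply: nearS.
exists zJ, (projector zS v); split.
- split=> //; apply: (near_adjacent piP N_gt0) => //.
  by right; rewrite nrmJ.
- by rewrite /vrank nrmJ; apply: rank_lt => //; case: XJ.
- move=> t tt; apply: (near_adjacent piP N_gt0) => //; first exact: vtau.
  by right; rewrite nrmJ; apply: nearJ.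
- move=> t tt; rewrite -(projectorC v vS (vtau t tt) (adjS t tt)) fv //.
  by rewrite inE tt orbT.
have [cX cS cJ] := And3 (vertex_compact vx) (vertex_compact vS) (vertex_compact vJ).
have -> : projector x (projector zJ (projector zS v)) = projector x (projector zS v).
  rewrite !projectorE //; apply: (@avg_absorb _ _ (vertex_congruence pi zS)) => //.
    move=> g; rewrite /vertex_congruence nrmS nrmJ; apply: congruence_cap => //.
    exact: lsuml.
  by move=> b Sb; apply: avg_fixed.
apply/esym; rewrite !projectorE //; apply: (@avg_absorb _ _ (vertex_congruence pi y)) => //.
  by move=> g; rewrite /vertex_congruence nrmS; apply: congruence_lsum.
by apply/projector_idP => //; apply: fv; rewrite mem_head.
Qed.

End Projectors.

(** * The complex of oriented chains *)

Section TuplePermutations.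
Variables (R : realType) (F : nonArchFieldType R) (N : nat) (C : numFieldType).
Variable V : lmodType C.
Local Notation vtx := (set (set 'cV[F]_N)).
Implicit Types (n : nat).

Lemma tuple_permM n (p q : 'S_n) (t : n.-tuple vtx) :
  tuple_perm (p * q)%g t = tuple_perm p (tuple_perm q t).
Proof. by apply: eq_from_tnth => i; rewrite !tnth_mktuple permM. Qed.

Lemma tuple_perm_swap n (t : n.-tuple vtx) (i j : 'I_n) (s1 s2 : seq vtx) a b :
  tval t = s1 ++ a :: b :: s2 -> nat_of_ord i = size s1 -> nat_of_ord j = (size s1).+1 ->
  tval (tuple_perm (tperm i j) t) = s1 ++ b :: a :: s2.
Proof.
move=> tE iE jE; have szt := size_tuple t; rewrite tE in szt.
have tn k : tnth t k = nth a (s1 ++ a :: b :: s2) k by rewrite (tnth_nth a) tE.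
apply: (@eq_from_nth _ a); first by rewrite size_tuple -szt !size_cat.
move=> k; rewrite size_tuple => kn.
rewrite -[k]/(nat_of_ord (Ordinal kn)) -tnth_nth tnth_mktuple tn.
have [->|ki] := eqVneq (Ordinal kn) i.
  rewrite tpermL jE iE !nth_cat ltnNge leqnSn /= ltnn subSnn subnn //.
have [->|kj] := eqVneq (Ordinal kn) j.
  by rewrite tpermR jE iE !nth_cat [in RHS]ltnNge leqnSn /= ltnn subSnn subnn.
rewrite tpermD 1?eq_sym // !nth_cat /=; case: ltnP => // sk.
move: ki kj; rewrite -!val_eqE /= iE jE => ki kj.
case E : (k - size s1)%N => [|[|m]] //.
  by move: ki; rewrite eqn_leq sk andbT -subn_eq0 E.
by move: kj; rewrite -(subnK sk) E add1n eqxx.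
Qed.

(** The permutations obeying the sign rule are closed under products. A transposition of entries at
    distance k + 1 is conjugate, by an adjacent one, to a transposition at distance k. *)
Lemma alternating_tuple_perm n (z : seq vtx -> V) (p : 'S_n) (t : n.-tuple vtx) :
  alternating z -> z (tuple_perm p t) = (-1) ^+ odd_perm p *: z t.
Proof.
move=> alt; move: t.
pose Q (p : 'S_n) := forall t : n.-tuple vtx,
  z (tuple_perm p t) = (-1) ^+ odd_perm p *: z t.
rewrite -/(Q p).
have QM p1 p2 : Q p1 -> Q p2 -> Q (p1 * p2)%g.
  by move=> Q1 Q2 t; rewrite tuple_permM Q1 Q2 odd_permM signr_addb scalerA.
have Q1 : Q 1%g.
  move=> t; rewrite odd_perm1 scale1r; congr (z _); congr tval.
  by apply: eq_from_tnth => i; rewrite tnth_mktuple perm1.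
have adj (i j : 'I_n) : nat_of_ord j = i.+1 -> Q (tperm i j).
  move=> ji t; have ij : i != j by rewrite -val_eqE /= ji neq_ltn ltnSn.
  rewrite odd_tperm ij expr1 scaleN1r.
  have x0 : vtx := tnth t i.
  have tE : tval t = take i t ++ nth x0 t i :: nth x0 t i.+1 :: drop i.+2 t.
    have it : (i < size t)%N by rewrite size_tuple.
    have it1 : (i.+1 < size t)%N by rewrite size_tuple -ji.
    by rewrite -(drop_nth x0 it1) -(drop_nth x0 it) cat_take_drop.
  have szi : size (take i t) = i by rewrite size_takel // size_tuple ltnW.
  by rewrite (tuple_perm_swap tE) ?szi // [X in - z X]tE alt.
have lt k : forall i j : 'I_n, nat_of_ord j = (i + k.+1)%N -> Q (tperm i j).
  elim: k => [|k IHk] i j ji; first by apply: adj; rewrite ji addn1.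
  have kn : (i + k.+1 < n)%N by apply: leq_ltn_trans (ltn_ord j); rewrite ji leq_add2l.
  pose m := Ordinal kn.
  have mj : nat_of_ord j = m.+1 by rewrite /= ji addnS.
  have im : i != m by rewrite -val_eqE /= -[X in X != _]addn0 eqn_add2l.
  have ij : i != j by rewrite -val_eqE /= ji -[X in X != _]addn0 eqn_add2l.
  have -> : tperm i j = (tperm m j * tperm i m * tperm m j)%g.
    have := tpermJ i m (tperm m j); rewrite tpermL tpermD // 1?eq_sym //.
    by rewrite /conjg tpermV => <-; rewrite mulgA.
  by apply: (QM); [apply: (QM)|]; [exact: adj|exact: IHk|exact: adj].
have Qt (i j : 'I_n) : Q (tperm i j).
  case: (ltngtP i j) => [ij|ji|/val_inj->]; last by rewrite tperm1.
    by apply: (lt (j - i).-1); rewrite prednK ?subn_gt0 // subnKC // ltnW.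
  by rewrite tpermC; apply: (lt (i - j).-1); rewrite prednK ?subn_gt0 // subnKC // ltnW.
have [ts -> _] := prod_tpermP p.
by elim/big_ind: _ => // -[i j] _; apply: Qt.
Qed.

Lemma finite_tuples n (r : seq vtx) : finite_set [set t : n.-tuple vtx | {subset t <= r}].
Proof.
pose f (t : n.-tuple (seq_sub r)) : n.-tuple vtx := map_tuple val t.
apply: (@sub_finite_set _ _ (f @` [set: n.-tuple (seq_sub r)])).
  move=> t tr.
  have tr' i : tnth t i \in r by apply: tr; apply: mem_tnth.
  exists [tuple SeqSub (tr' i) | i < n] => //.
  by apply: eq_from_tnth => i; rewrite tnth_map tnth_mktuple.
exact/finite_image/finite_finset.
Qed.

End TuplePermutations.

Section ChainsAsFunctionsOnSequences.
Variables (R : realType) (F : nonArchFieldType R) (N : nat) (pi : F).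
Variables (V : lmodType R[i]) (rho : GL F N -> V -> V).
Hypothesis piP : uniformizer pi.
Hypothesis N_gt0 : (0 < N)%N.
Hypothesis lc : locally_compact [set: F].
Hypothesis rho_smooth : smooth_representation [set: V] rho.
Local Notation vtx := (set (set 'cV[F]_N)).
Local Notation proj := (projector pi rho).
Local Notation link := (link_chain (@vertices R F N) (@adjacent R F N) (vrank pi) proj).
Implicit Types (x y : vtx) (g h : GL F N) (v : V) (s : seq vtx).

(** The building is a flag complex: the condition on lattice chains involves two lattices at a
    time. *)
Lemma ordered_simplexP q (t : q.+1.-tuple vtx) :
  ordered_simplex t <-> simplicial (@vertices R F N) (@adjacent R F N) t.
Proof.
split=> [[ut st]|[ut vt at_]].
  split=> // [x xt|x y xt yt]; first exact: (simplex_vertex st xt).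
  exact: (simplex_adjacent st xt yt).
split=> //; split.
- exact: finite_seq.
- by exists (tnth t ord0); apply: mem_tnth.
- by move=> x /vt.
by move=> L M [x xt xL] [y yt yM]; apply: at_ xL yM.
Qed.

(** One direction holds because the radical contains the vertex groups, the other because it is
    generated by them; [radical_generated] is applied to the stabilizer of [v]. *)
Lemma coefficient_spaceP q (t : q.+1.-tuple vtx) v : ordered_simplex t ->
  coefficient_space rho [set` t] v <-> fixes proj t v.
Proof.
move=> ot; have [ut st] := ot; have [_ vt at_] := (ordered_simplexP t).1 ot.
split=> [tv x xt|fv g gt].
  apply/(projector_idP piP N_gt0 lc rho_smooth) => [|g xg]; first exact: vt.
  by apply: tv; apply: (vertex_congruence_radical piP N_gt0 st xt xg).
apply: (radical_generated piP N_gt0 (P := [set g | rho g v = v]) (t := t)) => //.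
- by rewrite -size_eq0 size_tuple.
- by move=> a b /= av bv; rewrite rhoM // bv av.
- move=> x xt h xh /=; move: h xh.
  by apply/(projector_idP piP N_gt0 lc rho_smooth); [exact: vt|exact: fv].
exact: (radical_moves_down piP N_gt0 st gt).
Qed.

(** Extension by zero to the other lengths, which removes the degree from the type and turns the
    augmentation into a boundary. *)
Definition lift q (w : q.-tuple vtx -> V) : seq vtx -> V :=
  fun s => oapp w 0 (insub s).

Lemma lift_tuple q (w : q.-tuple vtx -> V) (t : q.-tuple vtx) : lift w t = w t.
Proof. by rewrite /lift valK. Qed.

Lemma lift_size q (w : q.-tuple vtx -> V) s : size s != q -> lift w s = 0.
Proof. by move=> sq; rewrite /lift insubN. Qed.

Lemma lift_neq0 q (w : q.-tuple vtx -> V) s : lift w s != 0 ->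
  exists2 t : q.-tuple vtx, s = t & w t != 0.
Proof.
by rewrite /lift; case: insubP => [t _ <- wt|]; [exists t|rewrite /= eqxx].
Qed.

Lemma link_chain_lift q (w : q.+1.-tuple vtx -> V) : oriented_chain rho w ->
  link [::] q.+1 (lift w).
Proof.
move=> cw.
have os t : w t != 0 -> ordered_simplex t.
  by apply: contra_neqP; apply: (chain_simplex cw).
split.
- move=> s /lift_neq0 [t -> wt]; rewrite size_tuple; split=> //.
  exact/ordered_simplexP/os.
- move=> s /lift_neq0 [t -> wt]; rewrite cats0 lift_tuple.
  by apply/(coefficient_spaceP _ (os t wt))/(chain_coefficient cw)/os.
- move=> s1 a b s2; have [szs|szs] := eqVneq (size (s1 ++ a :: b :: s2)) q.+1; last first.
    rewrite !lift_size ?oppr0 //; move: szs; by rewrite !size_cat.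
  pose t : q.+1.-tuple vtx := tcast szs (in_tuple (s1 ++ a :: b :: s2)).
  have tE : tval t = s1 ++ a :: b :: s2 by rewrite val_tcast.
  have i1 : (size s1 < q.+1)%N by rewrite -szs size_cat /=; lia.
  have i2 : ((size s1).+1 < q.+1)%N.
    by rewrite -szs size_cat /=; lia.
  pose i := Ordinal i1; pose j := Ordinal i2.
  have ij : i != j by rewrite -val_eqE /= neq_ltn ltnSn.
  have := chain_odd cw (p := tperm i j) t; rewrite odd_tperm ij => /(_ isT) E.
  have := tuple_perm_swap (i := i) (j := j) tE erefl erefl => E2.
  by rewrite -tE -E2 !lift_tuple E opprK.
have [r rE] := (finite_seqP _).1 (chain_support cw).
apply: (@finsupp_seq _ _ _ _ (flatten [seq tval t | t <- r])).
move=> s /lift_neq0 [t -> wt] x xt; apply/flattenP; exists (tval t) => //.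
apply: map_f; have : [set t | w t != 0] t by [].
by rewrite rE.
Qed.

Lemma oriented_chain_of_link q (z : seq vtx -> V) : link [::] q.+1 z ->
  oriented_chain rho (fun t : q.+1.-tuple vtx => z t).
Proof.
move=> cz.
have os (t : q.+1.-tuple vtx) : z t != 0 -> ordered_simplex t.
  by move=> /(link_supp cz) [_ st _]; apply/ordered_simplexP.
split.
- by move=> t; apply: contra_notP => /eqP; apply: os.
- have [r [ur zr]] := link_fin cz.
  by apply: sub_finite_set (finite_tuples q.+1 r) => t; apply: zr.
- move=> t ot; apply/coefficient_spaceP => //.
  have [->|zt] := eqVneq (z t) 0.
    by apply: fixes0 => x u w; apply: projectorD.
  by have := link_fix cz zt; rewrite cats0.
- move=> p t /negPf podd; rewrite (alternating_tuple_perm _ _ (link_alt cz)) podd.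
  by rewrite expr0 scale1r.
move=> p t podd; rewrite (alternating_tuple_perm _ _ (link_alt cz)) podd.
by rewrite expr1 scaleN1r.
Qed.

Lemma boundary_link q (z : seq vtx -> V) (t : q.+1.-tuple vtx) : link [::] q.+2 z ->
  boundary (fun t : q.+2.-tuple vtx => z t) t = bd z t.
Proof.
move=> cz; apply: fsbig_widen => // v [_ nov] /=.
apply/eqP; apply: contra_notT nov => zv.
by have [_ st _] := link_supp cz zv; apply/ordered_simplexP.
Qed.

Lemma augmentation_link (z : seq vtx -> V) : link [::] 1 z ->
  augmentation (fun t : 1.-tuple vtx => z t) = bd z [::].
Proof.
move=> cz; apply: fsbig_widen => // v [_ nov] /=.
apply/eqP; apply: contra_notT nov => zv.
by have [_ [_ vv _] _] := link_supp cz zv; apply: vv; rewrite mem_head.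
Qed.

Lemma restrict_lift q (w : q.-tuple vtx -> V) : (fun t : q.-tuple vtx => lift w t) = w.
Proof. by apply/funext => t; rewrite lift_tuple. Qed.

Lemma boundary_lift q (w : q.+2.-tuple vtx -> V) (t : q.+1.-tuple vtx) :
  oriented_chain rho w -> boundary w t = bd (lift w) t.
Proof. by move=> /link_chain_lift /boundary_link <-; rewrite restrict_lift. Qed.

Lemma augmentation_lift (w : 1.-tuple vtx -> V) :
  oriented_chain rho w -> augmentation w = bd (lift w) [::].
Proof. by move=> /link_chain_lift /augmentation_link <-; rewrite restrict_lift. Qed.

Lemma bd_supp q (z : seq vtx -> V) s : link [::] q.+1 z -> size s != q -> bd z s = 0.
Proof.
move=> cz sq; rewrite /bd fsumT0 // => v; apply/eqP/negPn/negP => zv.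
by have [[szv] _ _] := link_supp cz zv; rewrite szv eqxx in sq.
Qed.

Let eD x u v : proj x (u + v) = proj x u + proj x v :=
  projectorD piP N_gt0 lc rho_smooth x u v.

Lemma boundary_chain q (w : q.+2.-tuple vtx -> V) :
  oriented_chain rho w -> oriented_chain rho (boundary w).
Proof.
move=> cw; have -> : boundary w = (fun t => bd (lift w) t).
  by apply/funext => t; apply: boundary_lift.
exact/oriented_chain_of_link/(link_chain_bd eD)/link_chain_lift.
Qed.

Lemma boundary_boundary q (w : q.+3.-tuple vtx -> V) :
  oriented_chain rho w -> boundary (boundary w) = (fun=> 0).
Proof.
move=> /link_chain_lift cw; apply/funext => t.
have -> : boundary w = (fun t => bd (lift w) t).
  by apply/funext => t'; rewrite -(restrict_lift w) boundary_link // restrict_lift.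
rewrite boundary_link; last exact: link_chain_bd eD _ _ _ cw.
by rewrite bd_bd //; [exact: link_fin cw|exact: link_alt cw].
Qed.

Lemma augmentation_boundary (w : 2.-tuple vtx -> V) :
  oriented_chain rho w -> augmentation (boundary w) = 0.
Proof.
move=> /link_chain_lift cw.
have -> : boundary w = (fun t => bd (lift w) t).
  by apply/funext => t'; rewrite -(restrict_lift w) boundary_link // restrict_lift.
rewrite augmentation_link; last exact: link_chain_bd eD _ _ _ cw.
by rewrite bd_bd //; [exact: link_fin cw|exact: link_alt cw].
Qed.

Lemma link_fill_buildings q (w : seq vtx -> V) : link [::] q.+1 w ->
  bd w = (fun=> 0) -> exists z, link [::] q.+2 z /\ bd z = w.
Proof.
apply: link_fill => //.
- exact: adjacent_sym.
- by move=> x vx; apply: (adjacent_refl piP N_gt0 vx).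
- by move=> x y vx vy axy; apply: (adjacent_rank piP N_gt0 vx vy axy).
- by move=> x v; apply: projector_idem.
- by move=> x y v; apply: projectorC.
by move=> tau x y v; apply: projector_hull.
Qed.

Lemma boundary_exact q (w : q.+2.-tuple vtx -> V) : oriented_chain rho w ->
  boundary w = (fun=> 0) ->
  exists2 z : q.+3.-tuple vtx -> V, oriented_chain rho z & boundary z = w.
Proof.
move=> cw bw; have lw := link_chain_lift cw.
have [|z [cz bz]] := link_fill_buildings lw.
  apply/funext => s; have [sq|sq] := eqVneq (size s) q.+1; last exact: bd_supp lw sq.
  have -> : s = tcast sq (in_tuple s) by rewrite val_tcast.
  by rewrite -boundary_lift // bw.
exists (fun t => z t); first exact: oriented_chain_of_link.
by apply/funext => t; rewrite boundary_link // bz lift_tuple.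
Qed.

Lemma augmentation_exact (w : 1.-tuple vtx -> V) : oriented_chain rho w ->
  augmentation w = 0 ->
  exists2 z : 2.-tuple vtx -> V, oriented_chain rho z & boundary z = w.
Proof.
move=> cw bw; have lw := link_chain_lift cw.
have [|z [cz bz]] := link_fill_buildings lw.
  apply/funext => s; have [/size0nil ->|sq] := eqVneq (size s) 0%N.
    by rewrite -augmentation_lift.
  exact: bd_supp lw sq.
exists (fun t => z t); first exact: oriented_chain_of_link.
by apply/funext => t; rewrite boundary_link // bz lift_tuple.
Qed.

(** The vertices of a simplex have distinct ranks, all in the window of length N that starts at the
    least one. *)
Lemma oriented_chain_dim q (w : q.+1.-tuple vtx -> V) : (N <= q)%N ->
  oriented_chain rho w -> w = (fun=> 0).
Proof.
move=> Nq cw; apply/funext => t; apply: (chain_simplex cw).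
move=> /ordered_simplexP [ut vt at_].
have t0 : tval t != [::] by rewrite -size_eq0 size_tuple.
have [x xt xmin] := exists_min_rank (vrank pi) t0.
have ur : uniq [seq vrank pi y | y <- t].
  rewrite map_inj_in_uniq // => y z yt zt E.
  by apply: (adjacent_rank piP N_gt0 (vt y yt) (vt z zt) (at_ y z yt zt) E).
have sub : {subset [seq vrank pi y | y <- t] <= iota (vrank pi x) N}.
  move=> _ /mapP [y yt ->]; rewrite mem_iota xmin //=.
  by apply: (vrank_gap piP N_gt0); [exact: vt|exact: vt|exact: at_].
have := uniq_leq_size ur sub; rewrite size_map size_tuple size_iota.
by rewrite ltnNge Nq.
Qed.

Lemma oriented_chain0 q : oriented_chain rho (fun _ : q.+1.-tuple vtx => 0).
Proof. exact: oriented_chain_of_link (link_chain0 _ _ _ _ _ _). Qed.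

Lemma oriented_chain_lin q a (w z : q.+1.-tuple vtx -> V) :
  oriented_chain rho w -> oriented_chain rho z ->
  oriented_chain rho (a *: w + z).
Proof.
move=> cw cz.
have E t : (a *: w + z) t = a *: w t + z t by [].
split.
- by move=> t ot; rewrite !E (chain_simplex cw) // (chain_simplex cz) // scaler0 addr0.
- apply: (@sub_finite_set _ _ ([set t | w t != 0] `|` [set t | z t != 0])).
    move=> t azt; have [wt|wt] := eqVneq (w t) 0; last by left.
    have [zt|zt] := eqVneq (z t) 0; last by right.
    by move: azt; rewrite /= E wt zt scaler0 addr0 eqxx.
  by rewrite finite_setU; split; [exact: (chain_support cw)|exact: (chain_support cz)].
- move=> t ot g gt; rewrite !E rhoL //.
  by rewrite (chain_coefficient cw ot gt) (chain_coefficient cz ot gt).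
- by move=> p t pe; rewrite !E (chain_even cw) // (chain_even cz).
by move=> p t po; rewrite !E (chain_odd cw) // (chain_odd cz) // opprD scalerN.
Qed.

Lemma submod_chains q : submod_closed [in chains rho q].
Proof.
split; first exact: (@mem_set _ (chains rho q) _ (oriented_chain0 q)).
move=> a w z cw cz; apply: (@mem_set _ (chains rho q)); apply: oriented_chain_lin.
  exact: (@set_mem _ (chains rho q) _ cw).
exact: (@set_mem _ (chains rho q) _ cz).
Qed.

Lemma lift_lin q a (w z : q.-tuple vtx -> V) :
  lift (a *: w + z) = (fun s => a *: lift w s + lift z s).
Proof.
apply/funext => s; rewrite /lift; case: insubP => [t _ _|_] //=.
by rewrite scaler0 addr0.
Qed.

Lemma bd_lin a (w z : seq vtx -> V) : finsupp w -> finsupp z ->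
  bd (fun s => a *: w s + z s) = (fun s => a *: bd w s + bd z s).
Proof.
move=> fw fz; have [r [ur wr]] := fw.
have wr' s : a *: w s != 0 -> {subset s <= r}.
  by rewrite scaler_eq0 negb_or => /andP[_ /wr].
have faw : finsupp (fun s => a *: w s) by exists r.
rewrite (bdD faw fz); apply/funext => s; congr (_ + _).
by rewrite (bdE _ ur wr) (bdE s ur wr') scaler_sumr.
Qed.

Lemma boundary_lin q : linear_on (chains rho q.+1) (@boundary R F N V q).
Proof.
move=> a w z cw cz; apply/funext => t.
rewrite boundary_lift; last exact: oriented_chain_lin.
rewrite lift_lin bd_lin; [|exact: link_fin (link_chain_lift _)..].
by rewrite -!boundary_lift.
Qed.

Lemma augmentation_lin : linear_on (chains rho 0) (@augmentation R F N V).
Proof.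
move=> a w z cw cz; rewrite augmentation_lift; last exact: oriented_chain_lin.
rewrite lift_lin bd_lin; [|exact: link_fin (link_chain_lift _)..].
by rewrite !augmentation_lift.
Qed.

Lemma augmentation_onto x v : vertices x -> proj x v = v ->
  exists2 w : 1.-tuple vtx -> V, oriented_chain rho w & augmentation w = v.
Proof.
move=> vx xv; pose z s := if s == [:: x] then v else 0.
have zE s : z s != 0 -> s = [:: x] by rewrite /z; case: ifP => [/eqP//|]; rewrite eqxx.
have cz : link [::] 1 z.
  split.
  - move=> s /zE ->; split=> //; split=> // [y|y y']; rewrite !inE.
      by move=> /eqP ->.
    by move=> /eqP-> /eqP->; apply: (adjacent_refl piP N_gt0).
  - by move=> s /zE ->; rewrite /z eqxx cats0 => y; rewrite inE => /eqP ->.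
  - have z2 s : (1 < size s)%N -> z s = 0.
      move=> s2; apply/eqP; apply: contraTT s2 => /zE -> //.
    by move=> s1 a b s2; rewrite !z2 ?oppr0 // size_cat /= !addnS.
  by exists [:: x]; split=> // s /zE ->.
exists (fun t => z t); first exact: oriented_chain_of_link.
rewrite augmentation_link // /bd (@fsumT1 _ _ x) => [|y yx]; first by rewrite /z eqxx.
by rewrite /z eqseq_cons (negPf yx).
Qed.

End ChainsAsFunctionsOnSequences.

(** * Equivariance and smoothness of the complex, and surjectivity of the augmentation *)

Section GroupAction.
Variables (R : realType) (F : nonArchFieldType R) (N : nat) (pi : F).
Variables (V : lmodType R[i]) (rho : GL F N -> V -> V).
Hypothesis piP : uniformizer pi.
Hypothesis N_gt0 : (0 < N)%N.
Hypothesis lc : locally_compact [set: F].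
Hypothesis rho_smooth : smooth_representation [set: V] rho.
Local Notation vtx := (set (set 'cV[F]_N)).
Implicit Types (x y : vtx) (g h : GL F N) (v : V) (s : seq vtx).
Implicit Types (L M : set 'cV[F]_N) (S : set vtx).

Lemma lattice_actM g h L : lattice_act (g * h)%g L = lattice_act g (lattice_act h L).
Proof.
apply/seteqP; split=> [_ [u Lu <-]|_ [_ [u Lu <-] <-]].
  by exists (GL_mx h *m u); [exists u|rewrite mulGLmx].
by exists u; rewrite // mulGLmx.
Qed.

Lemma lattice_act1 L : lattice_act 1%g L = L.
Proof.
apply/seteqP; split=> [_ [u Lu <-]|u Lu]; rewrite ?mul1mx //.
by exists u; rewrite ?mul1mx.
Qed.

Lemma lattice_actK g : cancel (@lattice_act R F N g) (lattice_act g^-1%g).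
Proof. by move=> L; rewrite -lattice_actM mulVg lattice_act1. Qed.

Lemma vertex_actM g h x : vertex_act (g * h)%g x = vertex_act g (vertex_act h x).
Proof.
apply/seteqP; split=> [_ [L xL <-]|_ [_ [L xL <-] <-]].
  by exists (lattice_act h L); [exists L|rewrite lattice_actM].
by exists L; rewrite // lattice_actM.
Qed.

Lemma vertex_act1 x : vertex_act 1%g x = x.
Proof.
apply/seteqP; split=> [_ [L xL <-]|L xL]; rewrite ?lattice_act1 //.
by exists L; rewrite ?lattice_act1.
Qed.

Lemma vertex_actK g : cancel (@vertex_act R F N g) (vertex_act g^-1%g).
Proof. by move=> x; rewrite -vertex_actM mulVg vertex_act1. Qed.

Lemma vertex_actVK g : cancel (@vertex_act R F N g^-1%g) (vertex_act g).
Proof. by move=> x; rewrite -vertex_actM mulgV vertex_act1. Qed.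

Lemma vertex_act_bij g : bijective (@vertex_act R F N g).
Proof. exists (vertex_act g^-1%g); [exact: vertex_actK|exact: vertex_actVK]. Qed.

Lemma vertex_act_vertices g x : vertices x -> vertices (vertex_act g x).
Proof.
move=> [L [A Au LA] ->]; exists (lattice_act g L).
  exists (GL_mx g *m A); first by rewrite unitmx_mul Au andbT; exact: Defs.GL_unit.
  rewrite LA; apply/seteqP; split=> [_ [_ [u iu <-] <-]|_ [u iu <-]].
    by exists u; rewrite // mulmxA.
  by exists (A *m u); [exists u|rewrite mulmxA].
have actZ c M : lattice_act g [set c *: u | u in M] = [set c *: u | u in lattice_act g M].
  apply/seteqP; split=> [_ [_ [u Mu <-] <-]|_ [_ [u Mu <-] <-]].
    by exists (GL_mx g *m u); [exists u|rewrite scalemxAr].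
  by exists (c *: u); [exists u|rewrite scalemxAr].
apply/seteqP; split=> [_ [_ [c c0 ->] <-]|_ [c c0 ->]].
  by exists c => //; rewrite actZ.
by exists [set c *: u | u in L]; [exists c|rewrite actZ].
Qed.

Lemma lattices_of_act g S L :
  lattices_of (vertex_act g @` S) (lattice_act g L) <-> lattices_of S L.
Proof.
split=> [[_ [x Sx <-] [M xM E]]|[x Sx xL]].
  by exists x => //; rewrite -(can_inj (lattice_actK g) E).
by exists (vertex_act g x); [exists x|exists L].
Qed.

Lemma lattices_of_actE g S M : lattices_of (vertex_act g @` S) M ->
  exists2 L, lattices_of S L & M = lattice_act g L.
Proof. by move=> [_ [x Sx <-] [L xL <-]]; exists L => //; exists x. Qed.

Lemma lattice_act_sub g L M : lattice_act g L `<=` lattice_act g M <-> L `<=` M.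
Proof.
split=> [LM u Lu|LM _ [u Lu <-]]; last by exists u => //; apply: LM.
have [|v Mv E] := LM (GL_mx g *m u); first by exists u.
by rewrite -(mulGLKV g u) -E mulGLKV.
Qed.

Lemma simplex_act g S : simplex S -> simplex (vertex_act g @` S).
Proof.
move=> [fS [x Sx] vS tot]; split.
- exact: finite_image.
- by exists (vertex_act g x); exists x.
- by move=> _ [y Sy <-]; apply/vertex_act_vertices/vS.
move=> _ _ /lattices_of_actE [L SL ->] /lattices_of_actE [M SM ->].
by case: (tot L M SL SM) => LM; [left|right]; apply/lattice_act_sub.
Qed.

Lemma radical_conj g S h : pro_unipotent_radical (vertex_act g @` S) h ->
  pro_unipotent_radical S (g^-1 * h * g)%g.
Proof.
move=> [hP hU]; split=> [L SL|L M [SL SM [ML nLM] next] u Lu].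
  rewrite !lattice_actM hP ?lattice_actK //.
  exact/lattices_of_act.
have nxt : next_lattice (vertex_act g @` S) (lattice_act g L) (lattice_act g M).
  split; [exact/lattices_of_act|exact/lattices_of_act| |].
    split; first exact/lattice_act_sub.
    by move=> /lattice_act_sub.
  move=> _ /lattices_of_actE [L' SL' ->] /lattice_act_sub ML' /lattice_act_sub L'L.
  by case: (next L' SL' ML' L'L) => ->; [left|right].
have [|v Mv vE] := hU _ _ nxt (GL_mx g *m u); first by exists u.
suff -> : (g^-1 * h * g)%g *m u - u = v by [].
apply: (can_inj (mulGLKV g)); rewrite vE mulmxBr !mulGLmx mulGLVK.
by [].
Qed.

Lemma set_of_map_tuple q g (t : q.-tuple vtx) :
  [set` map_tuple (vertex_act g) t] = vertex_act g @` [set` t].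
Proof.
apply/seteqP; split=> [x /= /mapP [y yt ->]|_ [y yt <-]]; first by exists y.
exact: map_f.
Qed.

Lemma ordered_simplex_act q g (t : q.-tuple vtx) :
  ordered_simplex t -> ordered_simplex (map_tuple (vertex_act g) t).
Proof.
move=> [ut st]; split; last by rewrite set_of_map_tuple; apply: simplex_act.
by rewrite map_inj_uniq //; apply: can_inj (vertex_actK g).
Qed.

Lemma map_tuple_actK q g (t : q.-tuple vtx) :
  map_tuple (vertex_act g) (map_tuple (vertex_act g^-1%g) t) = t.
Proof. by apply: eq_from_tnth => i; rewrite !tnth_map vertex_actVK. Qed.

Lemma map_tuple_actVK q g (t : q.-tuple vtx) :
  map_tuple (vertex_act g^-1%g) (map_tuple (vertex_act g) t) = t.
Proof. by apply: eq_from_tnth => i; rewrite !tnth_map vertex_actK. Qed.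

Lemma tuple_perm_map q (p : 'S_q) (f : vtx -> vtx) (t : q.-tuple vtx) :
  map_tuple f (tuple_perm p t) = tuple_perm p (map_tuple f t).
Proof. by apply: eq_from_tnth => i; rewrite !(tnth_map, tnth_mktuple). Qed.

Lemma chain_act_chain q g (w : q.+1.-tuple vtx -> V) :
  oriented_chain rho w -> oriented_chain rho (chain_act rho q g w).
Proof.
move=> cw; split.
- move=> t ot; rewrite /chain_act (chain_simplex cw) ?(rho0 rho_smooth) //.
  by move=> /(ordered_simplex_act g); rewrite map_tuple_actK.
- apply: sub_finite_set (finite_image (map_tuple (vertex_act g)) (chain_support cw)) => t /= wt.
  exists (map_tuple (vertex_act g^-1%g) t); last exact: map_tuple_actK.
  by apply: contra_neq wt => wt; rewrite /chain_act wt (rho0 rho_smooth).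
- move=> t ot h ht; have ot' := ordered_simplex_act g^-1%g ot.
  rewrite /chain_act; set u := w _.
  have E : rho (g^-1 * h * g)%g u = u.
    apply: (chain_coefficient cw ot'); apply: radical_conj.
    by rewrite -set_of_map_tuple map_tuple_actK.
  by rewrite -[in RHS]E -!(rhoM rho_smooth) !mulgA mulgV mul1g.
- by move=> p t pe; rewrite /chain_act tuple_perm_map (chain_even cw).
move=> p t po; rewrite /chain_act tuple_perm_map (chain_odd cw) //.
by rewrite -scaleN1r (rhoZ rho_smooth) scaleN1r.
Qed.

Lemma chain_act_lin q g : linear_on (chains rho q) (chain_act rho q g).
Proof. by move=> a w z _ _; apply/funext => t; apply: (rhoL rho_smooth). Qed.

Lemma chain_act1 q (w : q.+1.-tuple vtx -> V) : chain_act rho q 1%g w = w.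
Proof.
apply/funext => t; rewrite /chain_act (rho1 rho_smooth); congr (w _).
by apply: eq_from_tnth => i; rewrite tnth_map invg1 vertex_act1.
Qed.

Lemma chain_actM q g h (w : q.+1.-tuple vtx -> V) :
  chain_act rho q (g * h)%g w = chain_act rho q g (chain_act rho q h w).
Proof.
apply/funext => t; rewrite /chain_act (rhoM rho_smooth); congr (rho _ (rho _ (w _))).
by apply: eq_from_tnth => i; rewrite !tnth_map invMg vertex_actM.
Qed.

Lemma vertex_stabilizer_ball x : vertices x -> exists2 r : R, 0 < r &
  forall g, entries_le (GL_mx g - 1%:M) r -> vertex_act g x = x.
Proof.
move=> vx; have [r r0 rP] := congruence_ball piP (nrm_lattice N_gt0 vx).
exists r => // g /rP gx.
have fixL L : x L -> lattice_act g L = L.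
  move=> xL; apply: stabilizes_act.
  exact: (vertex_congruence_stabilizes piP N_gt0 vx vx (adjacent_refl piP N_gt0 vx) gx xL).
apply/seteqP; split=> [_ [L xL <-]|L xL]; first by rewrite fixL.
by exists L => //; apply: fixL.
Qed.

Lemma entries_le_trans (X : 'M[F]_N) (r r' : R) :
  r <= r' -> entries_le X r -> entries_le X r'.
Proof. by move=> rr' Xr i j; apply: le_trans (Xr i j) rr'. Qed.

Lemma common_ball (T : eqType) (ts : seq T) (Q : T -> GL F N -> Prop) :
  (forall t, t \in ts -> exists2 r : R, 0 < r &
    forall g, entries_le (GL_mx g - 1%:M) r -> Q t g) ->
  exists2 r : R, 0 < r &
    forall g, entries_le (GL_mx g - 1%:M) r -> forall t, t \in ts -> Q t g.
Proof.
elim: ts => [|t ts IH] tsQ; first by exists 1.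
have [r r0 rQ] := tsQ t (mem_head _ _).
have [|r' r'0 r'Q] := IH; first by move=> t' tt'; apply: tsQ; rewrite inE tt' orbT.
exists (Num.min r r'); first by rewrite lt_min r0.
move=> g gr t'; rewrite inE => /orP[/eqP ->|].
  by apply: rQ; apply: entries_le_trans gr; rewrite ge_min lexx.
by apply: r'Q; apply: entries_le_trans gr; rewrite ge_min lexx orbT.
Qed.

(** The support is finite, so one ball about 1 fixes all the values of [w] and all the vertices of
    its support. *)
Lemma chain_stabilizer_open q (w : q.+1.-tuple vtx -> V) : oriented_chain rho w ->
  open [set g | chain_act rho q g w = w].
Proof.
move=> cw; apply: GL_open_subgroup => [g h gw hw|]; first by rewrite /= chain_actM hw.
have [ts tsE] := (finite_seqP _).1 (chain_support cw).
have supp t : w t != 0 <-> t \in ts.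
  by have /= -> := congr1 (fun A : set _ => A t) tsE.
have [r r0 rP] : exists2 r : R, 0 < r & forall g, entries_le (GL_mx g - 1%:M) r ->
    forall t, t \in ts -> rho g (w t) = w t /\ map_tuple (vertex_act g) t = t.
  apply: common_ball => t /supp wt.
  have ot : ordered_simplex t by apply: contra_neqP wt; apply: (chain_simplex cw).
  have [r1 r10 r1P] := stabilizer_ball rho_smooth (w t).
  have [_ vt _] := (ordered_simplexP t).1 ot.
  have [|r2 r20 r2P] := @common_ball _ t (fun x g => vertex_act g x = x).
    by move=> x xt; apply: vertex_stabilizer_ball; apply: vt.
  exists (Num.min r1 r2); first by rewrite lt_min r10.
  move=> g gr; split.
    by apply: r1P; apply: entries_le_trans gr; rewrite ge_min lexx.
  apply: eq_from_tnth => i; rewrite tnth_map; apply: r2P; last exact: mem_tnth.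
  by apply: entries_le_trans gr; rewrite ge_min lexx orbT.
exists r => // g /rP gts; apply/funext => t; rewrite /chain_act.
set t' := map_tuple _ t.
have tE : t = map_tuple (vertex_act g) t' by rewrite map_tuple_actK.
have [w0|/supp/gts [gw gt']] := eqVneq (w t') 0; last by rewrite gw tE gt'.
(* If [t] were in the support, [g] would fix it, so [t'] would be [t] and could not lie outside the
   support. *)
rewrite w0 (rho0 rho_smooth); apply/esym/eqP/negPn/negP => wt.
have [_ gt] := gts _ ((supp t).1 wt).
have t't : t' = t by rewrite /t' -{1}gt map_tuple_actVK.
by move: wt; rewrite -t't w0 eqxx.
Qed.

Lemma chains_smooth q : smooth_representation (chains rho q) (chain_act rho q).
Proof.
split.
- exact: submod_chains piP N_gt0 lc rho_smooth q.
- by move=> g w; apply: chain_act_chain.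
- by move=> g; apply: chain_act_lin.
- by move=> w _; apply: chain_act1.
- by move=> g h w _; apply: chain_actM.
by move=> w; apply: chain_stabilizer_open.
Qed.

Lemma bd_act g (z : seq vtx -> V) s : finsupp z ->
  bd (fun s => rho g (z (map (vertex_act g^-1%g) s))) s =
  rho g (bd z (map (vertex_act g^-1%g) s)).
Proof.
move=> [r [ur zr]].
rewrite (bdE _ ur zr) (rho_sum rho_smooth) /bd.
rewrite (reindex_fsbigT (vertex_act g)); last exact: vertex_act_bij.
under eq_fsbigr do rewrite /= vertex_actK.
apply: fsumTE => // v zv; apply: (zr (v :: map (vertex_act g^-1%g) s)).
  by apply: contra_neq zv => ->; rewrite (rho0 rho_smooth).
exact: mem_head.
Qed.

Lemma lift_act q g (w : q.-tuple vtx -> V) :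
  lift (fun t => rho g (w (map_tuple (vertex_act g^-1%g) t))) =
  (fun s => rho g (lift w (map (vertex_act g^-1%g) s))).
Proof.
apply/funext => s; have [sq|sq] := eqVneq (size s) q; last first.
  by rewrite !lift_size ?size_map // (rho0 rho_smooth).
have -> : s = tcast sq (in_tuple s) by rewrite val_tcast.
by rewrite lift_tuple -(lift_tuple w).
Qed.

Lemma boundary_intertwiner q : intertwiner (chains rho q.+1) (chains rho q)
  (chain_act rho q.+1) (chain_act rho q) boundary.
Proof.
split.
- by move=> w; apply: (boundary_chain piP N_gt0 lc rho_smooth).
- exact: (boundary_lin piP N_gt0 lc rho_smooth).
move=> g w cw; apply/funext => t.
have cgw := chain_act_chain g cw.
rewrite (boundary_lift piP N_gt0 lc rho_smooth _ cgw) lift_act bd_act.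
  by rewrite /chain_act (boundary_lift piP N_gt0 lc rho_smooth).
exact: link_fin (link_chain_lift piP N_gt0 lc rho_smooth cw).
Qed.

Lemma augmentation_intertwiner : intertwiner (chains rho 0) [set: V]
  (chain_act rho 0) rho (@augmentation R F N V).
Proof.
split=> //; first exact: (augmentation_lin piP N_gt0 lc rho_smooth).
move=> g w cw; have cgw := chain_act_chain g cw.
rewrite (augmentation_lift piP N_gt0 lc rho_smooth cgw) lift_act bd_act.
  by rewrite (augmentation_lift piP N_gt0 lc rho_smooth).
exact: link_fin (link_chain_lift piP N_gt0 lc rho_smooth cw).
Qed.

(** The image is a subrepresentation. It contains every vector fixed by [I], because [I] contains
    the congruence group of a vertex of its chamber, so that such a vector is the augmentation of a
    chain supported at that vertex. *)
Lemma augmentation_surjective (I : set (GL F N)) : iwahori I ->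
  generated_by rho (fixed_vectors rho I) ->
  [set augmentation w | w in chains rho 0] = [set: V].
Proof.
move=> [s [ss _] IE] gen; apply: gen.
- split.
    apply: (@mem_set _ [set augmentation w | w in chains rho 0]).
    exists (fun=> 0); first exact: (oriented_chain0 piP N_gt0 lc rho_smooth).
    by apply: fsbig1.
  move=> a u v /(@set_mem _ [set augmentation w | w in chains rho 0]) [w cw <-].
  move=> /(@set_mem _ [set augmentation w | w in chains rho 0]) [z cz <-].
  apply: (@mem_set _ [set augmentation w | w in chains rho 0]).
  exists (a *: w + z); first exact: (oriented_chain_lin rho_smooth).
  exact: (augmentation_lin piP N_gt0 lc rho_smooth).
- move=> g v [w cw <-]; exists (chain_act rho 0 g w); first exact: chain_act_chain.
  by case: augmentation_intertwiner => _ _; apply.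
move=> v Iv; have [_ [x sx] vs _] := ss; have vx := vs x sx.
have xv : projector pi rho x v = v.
  apply/(projector_idP piP N_gt0 lc rho_smooth) => // g xg; apply: Iv; rewrite IE.
  by have [] := vertex_congruence_radical piP N_gt0 ss sx xg.
by have [w cw wv] := augmentation_onto piP N_gt0 lc rho_smooth vx xv; exists w.
Qed.

End GroupAction.

Theorem mainTheorem1 (R : realType) (F : nonArchFieldType R) (N : nat)
    (V : lmodType R[i]) (rho : GL F N -> V -> V) (I : set (GL F N)) :
  locally_compact [set: F] -> (1 <= N)%N ->
  smooth_representation [set: V] rho ->
  iwahori I -> generated_by rho (fixed_vectors rho I) ->
  (* the complex lies in the category of smooth representations *)
  [/\ forall q, smooth_representation (chains rho q) (chain_act rho q),
      forall q, intertwiner (chains rho q.+1) (chains rho q)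
        (chain_act rho q.+1) (chain_act rho q)
        boundary
    & intertwiner (chains rho 0) [set: V] (chain_act rho 0) rho
        (@augmentation R F N V)] /\
  (* it has length N - 1 and it is a resolution of V *)
  [/\ forall q, (N <= q)%N -> chains rho q = [set 0],
      forall q, [set w | chains rho q.+1 w /\ boundary w = 0] =
        [set boundary z | z in chains rho q.+2],
      [set w | chains rho 0 w /\ augmentation w = 0] =
        [set boundary z | z in chains rho 1]
    & [set augmentation w | w in chains rho 0] = [set: V]].
Proof.
move=> lc N_gt0 smooth iw gen; have [pi piP] := exists_uniformizer lc.
split; split.
- by move=> q; apply: (chains_smooth piP).
- by move=> q; apply: (boundary_intertwiner piP).
- exact: (augmentation_intertwiner piP).
- move=> q Nq; apply/seteqP; split=> [w cw|_ ->].
    by rewrite (oriented_chain_dim piP N_gt0 Nq cw).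
  exact: (oriented_chain0 piP N_gt0 lc smooth).
- move=> q; apply/seteqP; split=> [w [cw bw]|_ [z cz <-]].
    by have [z cz bz] := boundary_exact piP N_gt0 lc smooth cw bw; exists z.
  split; first exact: (boundary_chain piP N_gt0 lc smooth cz).
  exact: (boundary_boundary piP N_gt0 lc smooth cz).
- apply/seteqP; split=> [w [cw bw]|_ [z cz <-]].
    by have [z cz bz] := augmentation_exact piP N_gt0 lc smooth cw bw; exists z.
  split; first exact: (boundary_chain piP N_gt0 lc smooth cz).
  exact: (augmentation_boundary piP N_gt0 lc smooth cz).
exact: (augmentation_surjective piP N_gt0 lc smooth iw gen).
Qed.
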